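(* Let $F:\mathbb{R}^n\times\mathbb{R}\times\mathbb{R}^n\times\mathcal{S}^n\to\mathbb{R}$ satisfy: (i) (degenerate ellipticity) $F(x,u,p,X)\ge F(x,v,p,Y)$ whenever $x,p\in\mathbb{R}^n$, $u\ge v$ and $X\le Y$; (ii) $-F(x,0,p,X)\le \phi(|p|)-\mathcal{P}^-_{\lambda,\Lambda}(X)$ for all $x,p\in\mathbb{R}^n$, $X\in\mathcal{S}^n$; (iii) $F(x,s,p,X)\le\phi(|p|)+\mathcal{P}^+_{\lambda,\Lambda}(X)+\gamma(s)$ for all $s\in[0,\infty)$, $x,p\in\mathbb{R}^n$, $X\in\mathcal{S}^n$, where $0<\lambda\le\Lambda$; $\phi:[0,\infty)\to[0,\infty)$ is strictly increasing and continuous with $\phi(t)\ge t$ for all $t\geq 0$ and $\int_0^1\frac{dt}{\phi(t)}=\infty$; $\gamma$ is a function with $\gamma(s)\le C^*\phi(s)$ whenever $0\le s\le1$, for a constant $C^*$; and (iv) for every sufficiently small $\epsilon>0$, $\int_0^\epsilon f_\nu(t)\,dt\to\infty$ as $\nu\to\infty$, where $f_\nu$ solves $f_\nu'(t)=-\phi(f_\nu(t))$ with $f_\nu(0)=\nu$. Let $\Omega\subset\mathbb{R}^n$ be a domain satisfying the ball condition with radius $r_b$, let $w\in\partial\Omega$ and $0<r<r_b$. Assume that $u$ and $v$ are positive viscosity solutions of $F(x,u,Du,D^2u)=0$ in $\Omega\cap B(w,6r)$ satisfying $u=0=v$ on $\partial\Omega\cap B(w,6r)$. Put $\Gamma_{w,r}=\{x\in\Omega:r<d(x,\partial\Omega)<3r\}\cap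 B(w,6r)$. Then there exists a constant $c\geq 1$, depending only on $\lambda,\Lambda,n,\phi,r_b,C^*$, $r^{-1}\inf_{\Gamma_{w,r}}u$, $r^{-1}\inf_{\Gamma_{w,r}}v$, $r^{-1}\sup_{B(w,6r)\cap\Omega}u$ and $r^{-1}\sup_{B(w,6r)\cap\Omega}v$, such that $$\frac1c\le\frac{u(x)}{v(x)}\le c\qquad\text{for all }x\in\Omega\cap B(w,r).$$
   Context: A domain is an open connected set; $B(x,r)$ is the open ball; $d(x,E)$ is the Euclidean distance from $x$ to $E$. $\Omega$ satisfies the ball condition with radius $r_b>0$ if for every $w\in\partial\Omega$ there are $\eta^i\in\Omega$ with $B(\eta^i,r_b)\subset\Omega$, $\partial B(\eta^i,r_b)\cap\partial\Omega=\{w\}$, and $\eta^e\in\mathbb{R}^n\setminus\Omega$ with $B(\eta^e,r_b)\subset\mathbb{R}^n\setminus\Omega$, $\partial B(\eta^e,r_b)\cap\partial\Omega=\{w\}$. $\mathcal{S}^n$ is the set of symmetric $n\times n$ real matrices with the positive semi-definite ordering. For $X\in\mathcal{S}^n$ with eigenvalues $e_1,\dots,e_n$, $\mathcal{P}^+_{\lambda,\Lambda}(X):=-\lambda\sum_{e_i\ge0}e_i-\Lambda\sum_{e_i<0}e_i$ and $\mathcal{P}^-_{\lambda,\Lambda}(X):=-\Lambda\sum_{e_i\ge0}e_i-\lambda\sum_{e_i<0}e_i$. A continuous $u:U\to\mathbb{R}$ on an open set $U$ is a viscosity solution of $F(x,u,Du,D^2u)=0$ in $U$ if for every $\varphi\in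 C^2(U)$ and $x_0\in U$: $F(x_0,u(x_0),D\varphi(x_0),D^2\varphi(x_0))\le0$ if $u-\varphi$ has a local maximum at $x_0$, and $F(x_0,u(x_0),D\varphi(x_0),D^2\varphi(x_0))\ge0$ if $u-\varphi$ has a local minimum at $x_0$.
   Formalization: The dependence of c only on the listed data is claimed when both infima over Γ are positive and both suprema finite; otherwise some c ≥ 1 exists but may depend on u, v (uniformity fails there, e.g. for harmonic functions). u, v are continuous up to ∂Ω∩B(w,6r). *)

(* Defs.v *)
From HB Require Import structures.
From mathcomp Require Import all_boot all_order all_algebra.
From mathcomp Require Import all_classical all_reals all_analysis.

Set Implicit Arguments.
Unset Strict Implicit.
Unset Printing Implicit Defensive.

Import Order.TTheory GRing.Theory Num.Theory.
Import numFieldNormedType.Exports.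

Local Open Scope classical_set_scope.
Local Open Scope ring_scope.

(* Points of R^n are row vectors.  The library norm on 'rV[R]_n is the sup
   norm: it is used only through the topology it induces, and all metric
   notions (balls, distances, |p|) are taken for the Euclidean norm below. *)
Section Euclidean.
Context {R : realType} {n : nat}.
Implicit Types (x y : 'rV[R]_n) (A E : set 'rV[R]_n).

Definition eucl_norm x : R := Num.sqrt (\sum_(i < n) x ord0 i ^+ 2).

Definition eucl_ball x (r : R) : set 'rV[R]_n := [set y | eucl_norm (y - x) < r].

(* The real infimum of the empty set is 0 by convention: E should be nonempty. *)
Definition eucl_dist x E : R := inf [set eucl_norm (x - y) | y in E].

Definition bdry A : set 'rV[R]_n := closure A `\` interior A.

Definition domain A := open A /\ connected A.

Definition ball_condition A (rb : R) :=
  forall w, bdry A w ->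
    (exists eta, [/\ A eta, eucl_ball eta rb `<=` A &
                     bdry (eucl_ball eta rb) `&` bdry A = [set w]]) /\
    (exists eta, [/\ (~` A) eta, eucl_ball eta rb `<=` ~` A &
                     bdry (eucl_ball eta rb) `&` bdry A = [set w]]).

End Euclidean.

(* S^n is the set of matrices X : 'M[R]_n with X \is symmetricmx; functions on
   S^n are total functions on 'M[R]_n whose other values are irrelevant. *)
Section SymmetricMatrices.
Context {R : realType} {n : nat}.
Implicit Types X Y : 'M[R]_n.

Definition psd_le X Y :=
  forall xi : 'rV[R]_n, 0 <= (xi *m (Y - X) *m xi^T) ord0 ord0.

(* The eigenvalues with multiplicity, in some order: the roots of the
   characteristic polynomial, which splits over R when X is symmetric (the
   default value [::] is taken only when it does not split). *)
Definition eigenvalues X : seq R :=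
  xget [::] [set e : seq R | char_poly X = \prod_(a <- e) ('X - a%:P)].

Definition pucci_plus (lam Lam : R) X : R :=
  - lam * (\sum_(e <- eigenvalues X | 0 <= e) e)
  - Lam * (\sum_(e <- eigenvalues X | e < 0) e).

Definition pucci_minus (lam Lam : R) X : R :=
  - Lam * (\sum_(e <- eigenvalues X | 0 <= e) e)
  - lam * (\sum_(e <- eigenvalues X | e < 0) e).

End SymmetricMatrices.

Section Viscosity.
Context {R : realType} {n : nat}.
Implicit Types (U : set 'rV[R]_n) (psi u : 'rV[R]_n -> R).

Definition partial (i : 'I_n) psi : 'rV[R]_n -> R :=
  fun x => 'D_(delta_mx ord0 i) psi x.

Definition gradient psi x : 'rV[R]_n := \row_i partial i psi x.

Definition hessian psi x : 'M[R]_n :=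
  \matrix_(i, j) partial i (partial j psi) x.

(* Functions on the open set U are total functions whose values outside U are
   irrelevant.  Existence and continuity on U of the partial derivatives of
   orders 1 and 2; continuity of psi itself is a consequence. *)
Definition C2_on U psi :=
  forall x, U x -> forall i : 'I_n,
    [/\ derivable psi x (delta_mx ord0 i),
        {for x, continuous (partial i psi)} &
        forall j : 'I_n,
          derivable (partial i psi) x (delta_mx ord0 j) /\
          {for x, continuous (partial j (partial i psi))}].

Definition viscosity_solution
    (F : 'rV[R]_n -> R -> 'rV[R]_n -> 'M[R]_n -> R) U u :=
  (forall x, U x -> {for x, continuous u}) /\
  forall psi x0, C2_on U psi -> U x0 ->
    ((\forall y \near x0, u y - psi y <= u x0 - psi x0) ->
       F x0 (u x0) (gradient psi x0) (hessian psi x0) <= 0) /\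
    ((\forall y \near x0, u x0 - psi x0 <= u y - psi y) ->
       0 <= F x0 (u x0) (gradient psi x0) (hessian psi x0)).

End Viscosity.

Section Drift.
Context {R : realType}.
Local Notation mu := (@lebesgue_measure R).

(* f solves f' = - phi(f) on [0, +oo[ with f(0) = nu.  As phi is meaningful
   only on [0, +oo[, f is required to be nonnegative; the equation at the
   endpoint 0 follows from the one on ]0, +oo[ by continuity. *)
Definition decay_solution (phi : R -> R) (nu : R) (f : R -> R) :=
  [/\ f 0 = nu, forall t, 0 <= t -> 0 <= f t,
      {within `[0, +oo[, continuous f} &
      forall t : R, 0 < t -> is_derive t (1 : R) f (- phi (f t))].

Definition decay_blowup (phi : R -> R) :=
  exists2 f : R -> R -> R,
    forall nu, 0 < nu -> decay_solution phi nu (f nu) &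
    \forall eps \near (0 : R)^'+,
      (\int[mu]_(t in `[0%R, eps]) (f nu t)%:E)%E @[nu --> +oo] --> +oo%E.

End Drift.

(* Main.v *)
(* The theorem follows from a two-sided linear bound b d <= u <= C d, where d is
   the distance to the boundary. Everything is deduced from touching by
   quadratic polynomials whose Hessian is a multiple of the identity plus a
   rank one matrix, for which the Pucci operators are explicit. Near the
   boundary, exterior and interior tangent balls are filled with radial barriers
   whose radial derivative is a solution f of f' = - phi(f): the blow-up
   condition allows an exterior barrier above sup u, and the Osgood condition
   keeps f positive, so that the interior barrier has a positive slope.

   The interior barrier needs a lower bound of u on a ball of fixed size. When r
   is close to r_b, Gamma is so thin that this is an interior estimate of
   Krylov-Safonov type. It is obtained without measure theory by counting cells
   of a fine dyadic grid, along Savin's method of sliding paraboloids: the map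
   from contact points to vertices of touching paraboloids is Lipschitz at the
   scale of the cells, by a barrier, so that the cells containing contact points
   fill a fixed fraction; a Calderon-Zygmund induction increases this fraction
   when the opening of the paraboloids grows. *)

Require Import Defs.
From HB Require Import structures.
From mathcomp Require Import all_boot all_order all_algebra.
From mathcomp Require Import all_classical all_reals all_analysis.
From mathcomp Require Import ring lra zify.

Set Implicit Arguments.
Unset Strict Implicit.
Unset Printing Implicit Defensive.

Import Order.TTheory GRing.Theory Num.Theory.
Import numFieldNormedType.Exports.

Local Open Scope classical_set_scope.
Local Open Scope ring_scope.

(** * Euclidean geometry of row vectors *)

Section Euclid.
Context {R : realType} {n : nat}.
Implicit Types (x y z c p q : 'rV[R]_n) (a b e r s t : R).

(** The structure conditions are not homogeneous, since [phi] is arbitrary. A solution is only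
    rescaled as [u (eta + r *: x) / r], which preserves gradients and multiplies Hessians by
    [r < rb]; all work is then done at unit scale. Solutions and barriers cannot be multiplied by
    constants: a slope budget [theta] and a height budget [tau] must be respected, and smallness is
    gained by taking small cubes. The height budget comes from [gam], controlled on [0, 1] only. It
    constrains supersolutions; for subsolutions, monotonicity replaces the value by 0.

    In the boundary barriers, [f' = - phi f] makes the radial second derivative a large multiple of
    [phi f], while the slope and the value term inside [phi] are at most [f]. Both sides are then
    multiples of [phi f], and [t <= phi t] absorbs the first-order term.

    The grid is chosen after the solution, fine enough for its modulus of continuity, whereas the
    number of stages, the cube size and the final bound are fixed before. All counting estimates are
    independent of the mesh. *)

Definition dot x y : R := \sum_(i < n) x ord0 i * y ord0 i.

Lemma dotC x y : dot x y = dot y x.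
Proof. by apply: eq_bigr => i _; rewrite mulrC. Qed.

Lemma dotDl x y z : dot (x + y) z = dot x z + dot y z.
Proof. by rewrite -big_split; apply: eq_bigr => i _; rewrite mxE mulrDl. Qed.

Lemma dotZl a x y : dot (a *: x) y = a * dot x y.
Proof. by rewrite mulr_sumr; apply: eq_bigr => i _; rewrite mxE mulrA. Qed.

Lemma dotNl x y : dot (- x) y = - dot x y.
Proof. by rewrite -scaleN1r dotZl mulN1r. Qed.

Lemma dotDr x y z : dot x (y + z) = dot x y + dot x z.
Proof. by rewrite dotC dotDl !(dotC x). Qed.

Lemma dotZr a x y : dot x (a *: y) = a * dot x y.
Proof. by rewrite dotC dotZl dotC. Qed.

Lemma dotNr x y : dot x (- y) = - dot x y.
Proof. by rewrite dotC dotNl dotC. Qed.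

Lemma dot0l x : dot 0 x = 0.
Proof. by rewrite -(scale0r x) dotZl mul0r. Qed.

Lemma dot0r x : dot x 0 = 0.
Proof. by rewrite dotC dot0l. Qed.

Definition dotE := (dotDl, dotDr, dotNl, dotNr, dotZl, dotZr, dot0l, dot0r).

Lemma dot_ge0 x : 0 <= dot x x.
Proof. by apply: sumr_ge0 => i _; rewrite -expr2 sqr_ge0. Qed.

Lemma dot_eq0 x : dot x x = 0 -> x = 0.
Proof.
move=> h; apply/rowP => i; rewrite mxE.
have /eqP := h; rewrite psumr_eq0 => [|j _]; last by rewrite -expr2 sqr_ge0.
by move=> /allP /(_ i); rewrite mem_index_enum -expr2 sqrf_eq0 => /(_ isT) /eqP.
Qed.

Lemma dot_CS x y : dot x y ^+ 2 <= dot x x * dot y y.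
Proof.
have [h|h] := eqVneq (dot y y) 0.
  by rewrite (dot_eq0 h) !dot0r expr0n mulr0.
have y0 : 0 < dot y y by rewrite lt_def h dot_ge0.
have := dot_ge0 (dot y y *: x - dot x y *: y).
rewrite !dotE (dotC y x) => H.
have : 0 <= dot y y * (dot x x * dot y y - dot x y ^+ 2).
  by apply: le_trans H _; rewrite le_eqVlt; apply/orP; left; apply/eqP; ring.
by rewrite pmulr_rge0// subr_ge0.
Qed.

Local Notation "`[ x ]" := (eucl_norm x) (format "`[ x ]").

Lemma eucl_normE x : `[x] = Num.sqrt (dot x x).
Proof. by congr Num.sqrt; apply: eq_bigr => i _; rewrite expr2. Qed.

Lemma sqr_eucl_norm x : `[x] ^+ 2 = dot x x.
Proof. by rewrite eucl_normE sqr_sqrtr ?dot_ge0. Qed.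

Lemma eucl_norm_ge0 x : 0 <= `[x].
Proof. exact: sqrtr_ge0. Qed.

Lemma eucl_norm0 : `[0 : 'rV[R]_n] = 0.
Proof. by rewrite eucl_normE dot0l sqrtr0. Qed.

Lemma eucl_norm_eq0 x : `[x] = 0 -> x = 0.
Proof. by move=> h; apply: dot_eq0; rewrite -sqr_eucl_norm h expr0n. Qed.

Lemma eucl_norm_le x a : 0 <= a -> (`[x] <= a) = (dot x x <= a ^+ 2).
Proof. by move=> a0; rewrite -sqr_eucl_norm ler_sqr ?nnegrE ?eucl_norm_ge0. Qed.

Lemma eucl_norm_lt x a : 0 <= a -> (`[x] < a) = (dot x x < a ^+ 2).
Proof. by move=> a0; rewrite -sqr_eucl_norm ltr_sqr ?nnegrE ?eucl_norm_ge0. Qed.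

Lemma dot_le_norm x y : dot x y <= `[x] * `[y].
Proof.
apply: le_trans (ler_norm _) _.
rewrite -ler_sqr ?nnegrE ?mulr_ge0 ?eucl_norm_ge0//.
by rewrite exprMn !sqr_eucl_norm real_normK ?num_real// dot_CS.
Qed.

Lemma eucl_normZ a x : `[a *: x] = `|a| * `[x].
Proof. by rewrite !eucl_normE dotZl dotZr mulrA -expr2 sqrtrM ?sqr_ge0// sqrtr_sqr. Qed.

Lemma eucl_normN x : `[- x] = `[x].
Proof. by rewrite -scaleN1r eucl_normZ normrN normr1 mul1r. Qed.

Lemma eucl_normB x y : `[x - y] = `[y - x].
Proof. by rewrite -eucl_normN opprB. Qed.

Lemma eucl_normD x y : `[x + y] <= `[x] + `[y].
Proof.
rewrite eucl_norm_le ?addr_ge0 ?eucl_norm_ge0// !dotE (dotC y x).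
have := dot_le_norm x y; have := sqr_eucl_norm x; have := sqr_eucl_norm y.
by rewrite sqrrD => -> ->; lra.
Qed.

Lemma eucl_dist_triangle y x z : `[x - z] <= `[x - y] + `[y - z].
Proof. by apply: le_trans (eucl_normD _ _); rewrite addrA subrK. Qed.

Lemma coord_le_norm x i : `|x ord0 i| <= `[x].
Proof.
rewrite -ler_sqr ?nnegrE ?eucl_norm_ge0// real_normK ?num_real//.
rewrite sqr_eucl_norm /dot (bigD1 i)//= -expr2 lerDl.
by apply: sumr_ge0 => j _; rewrite -expr2 sqr_ge0.
Qed.

Lemma norm_le_coords x a : (forall i, `|x ord0 i| <= a) -> `[x] <= n%:R * a.
Proof.
move=> h; have [->|n0] := eqVneq x 0.
  rewrite eucl_norm0 mulr_natl; case: (n) x h => [|m] x h; first by rewrite mulr0n.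
  by rewrite mulrn_wge0// (le_trans _ (h ord0)).
have a0 : 0 <= a.
  case: (n) x h n0 => [|m] x h; last by rewrite (le_trans _ (h ord0)).
  by rewrite thinmx0 eqxx.
rewrite eucl_norm_le ?mulr_ge0//.
apply: (@le_trans _ _ (\sum_(i < n) a ^+ 2)).
  apply: ler_sum => i _; rewrite -expr2 -[leLHS]real_normK ?num_real//.
  by rewrite ler_sqr ?nnegrE// h.
rewrite sumr_const card_ord -[leLHS]mulr_natl exprMn ler_wpM2r ?sqr_ge0//.
by rewrite -natrX ler_nat; case: (n) => // m; rewrite leq_pmulr.
Qed.

(** A coordinate is at most the Euclidean norm, which is at most [n] times the largest coordinate.
    The divisor [n + 1] in the second half keeps the radius positive in dimension 0. *)
Lemma near_euclP x (P : set 'rV[R]_n) :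
  (\forall y \near x, P y) <-> exists2 e : R, 0 < e & forall y, `[y - x] < e -> P y.
Proof.
split.
- move=> /nbhs_ballP[e /= e0 h]; exists e => // y hy; apply: h.
  split => // i j; rewrite (ord1 i) /ball/= -normrN opprB.
  by have := coord_le_norm (y - x) j; rewrite !mxE => hh; apply: le_lt_trans hh hy.
- move=> [e e0 h]; apply/nbhs_ballP; exists (e / (n%:R + 1)) => /=.
    by rewrite divr_gt0// ltr_wpDl.
  move=> y [_ hy]; apply: h.
  apply: (@le_lt_trans _ _ (n%:R * (e / (n%:R + 1)))).
    apply: norm_le_coords => i; rewrite !mxE -normrN opprB.
    by apply/ltW/(hy ord0 i).
  have n1 : 0 < n%:R + 1 :> R by rewrite ltr_wpDl.
  rewrite mulrCA -[ltRHS]mulr1 ltr_pM2l// ltr_pdivrMr// mul1r ltrDl//.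
Qed.

Lemma eucl_continuousP (f : 'rV[R]_n -> R) x :
  {for x, continuous f} <->
  forall e : R, 0 < e -> exists2 d : R, 0 < d & forall y, `[y - x] < d -> `|f y - f x| < e.
Proof.
have E := @cvgrPdist_lt _ _ _ (nbhs x) (nbhs_filter x) f (f x).
split=> [/E h e e0|h].
  have /near_euclP[d d0 hd] := h e e0; exists d => // y hy.
  by rewrite distrC; apply: hd.
apply/E => e e0; apply/near_euclP; have [d d0 hd] := h e e0.
by exists d => // y hy; rewrite distrC; apply: hd.
Qed.

Lemma within_eucl_continuousP (A : set 'rV[R]_n) (f : 'rV[R]_n -> R) :
  {within A, continuous f} <->
  forall x, A x -> forall e : R, 0 < e ->
    exists2 d : R, 0 < d & forall y, A y -> `[y - x] < d -> `|f y - f x| < e.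
Proof.
rewrite continuous_subspace_in.
have E x := @cvgrPdist_lt _ _ _ (@nbhs_subspace _ A x) (nbhs_filter (x : subspace A)) f (f x).
split.
- move=> h x Ax e e0; have /E/(_ e e0) := h x (mem_set Ax).
  rewrite -(nbhs_subspace_in Ax) => /near_euclP[d d0 hd].
  by exists d => // y Ay hy; rewrite distrC; apply: hd.
- move=> h x /set_mem Ax; apply/E => e e0.
  rewrite -(nbhs_subspace_in Ax); apply/near_euclP.
  have [d d0 hd] := h x Ax e e0.
  by exists d => // y hy Ay; rewrite distrC; apply: hd.
Qed.

Lemma eucl_norm_continuous c : continuous (fun x => `[x - c]).
Proof.
move=> x; apply/eucl_continuousP => e e0; exists e => // y hy.
rewrite ltr_norml; have := eucl_dist_triangle x y c.
have := eucl_dist_triangle y x c; rewrite (eucl_normB x y).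
by move=> h1 h2; apply/andP; split; lra.
Qed.

Lemma sqdist_continuous c : continuous (fun x => dot (x - c) (x - c)).
Proof.
have -> : (fun x => dot (x - c) (x - c)) = (fun x => `[x - c] * `[x - c]).
  by apply/funext => x; rewrite -sqr_eucl_norm expr2.
move=> x; exact: (continuousM (@eucl_norm_continuous c x) (@eucl_norm_continuous c x)).
Qed.

Lemma eucl_ball_open c r : open (eucl_ball c r).
Proof.
rewrite openE => x; rewrite /eucl_ball/= => hx.
apply/near_euclP; exists (r - `[x - c]); first by rewrite subr_gt0.
by move=> y hy /=; have := eucl_dist_triangle x y c; lra.
Qed.

Lemma eucl_closedP (A : set 'rV[R]_n) :
  closed A <-> forall x, (forall e : R, 0 < e -> exists2 y, A y & `[y - x] < e) -> A x.
Proof.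
split=> [cA x h|h x hx].
  apply: cA => B /near_euclP[e e0 hB]; have [y Ay hy] := h e e0.
  by exists y; split=> //; apply: hB.
apply: h => e e0.
have [|y [Ay hy]] := hx [set y | `[y - x] < e].
  by apply/near_euclP; exists e.
by exists y.
Qed.

Lemma closure_euclP (A : set 'rV[R]_n) x :
  closure A x <-> forall e : R, 0 < e -> exists2 y, A y & `[y - x] < e.
Proof.
split=> [h e e0|h].
  have [|y [Ay hy]] := h [set y | `[y - x] < e].
    by apply/near_euclP; exists e.
  by exists y.
move=> B /near_euclP[e e0 hB]; have [y Ay hy] := h e e0.
by exists y; split=> //; apply: hB.
Qed.

Definition cball c r : set 'rV[R]_n := [set x | `[x - c] <= r].

Lemma cball_closed c r : closed (cball c r).
Proof.
apply/eucl_closedP => x h; rewrite /cball/= leNgt; apply/negP => hx.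
have [y hy hyx] := h (`[x - c] - r) (ltac:(lra)).
by move: hy; rewrite /cball/= => hy; have := eucl_dist_triangle y x c; rewrite (eucl_normB x y); lra.
Qed.

Lemma eucl_compact (A : set 'rV[R]_n) c r : closed A -> A `<=` cball c r -> compact A.
Proof.
move=> cA hA; apply: bounded_closed_compact cA.
exists (r + `[c]); split; first exact: num_real.
move=> M hM x /hA; rewrite /cball/= => hx.
have hxM : `[x] <= M.
  have := eucl_normD (x - c) c; rewrite subrK; lra.
rewrite /Num.norm/= mx_normrE; apply: bigmax_le => [|[i j] _].
  by rewrite (le_trans _ hxM)// eucl_norm_ge0.
by rewrite /= (ord1 i); apply: le_trans (coord_le_norm _ _) hxM.
Qed.

Lemma eucl_EVT_min (A : set 'rV[R]_n) (f : 'rV[R]_n -> R) :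
  A !=set0 -> compact A -> {within A, continuous f} ->
  exists2 x, A x & forall y, A y -> f x <= f y.
Proof.
move=> A0 cA cf; have [x /set_mem Ax hx] := compact_EVT_min A0 cA cf.
by exists x => // y Ay; apply: hx; apply: mem_set.
Qed.

End Euclid.

Notation "`[ x ]" := (eucl_norm x) (format "`[ x ]") : ring_scope.

(** * Pucci operators and touching polynomials *)

Section RankOnePerturbation.

(** The matrix determinant lemma, by computing the determinant of one block matrix in two ways. A
    factor [c] stays on both sides because it is not invertible in the intended use, where [c] is
    the polynomial ['X - al]. *)
Lemma det_rank1 (A : idomainType) (n : nat) (c b : A) (q : 'rV[A]_n) : c != 0 ->
  c * \det (c%:M - b *: (q^T *m q)) = (c - b * (q *m q^T) ord0 ord0) * c ^+ n.
Proof.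
move=> c0.
pose M : 'M[A]_(1 + n) := block_mx 1%:M q (b *: q^T) c%:M.
have d1 : \det M = \det (c%:M - b *: (q^T *m q)).
  have -> : M = block_mx 1%:M 0 (b *: q^T) 1%:M *m
                block_mx 1%:M q 0 (c%:M - b *: (q^T *m q)).
    rewrite mulmx_block ?mul1mx ?mulmx1 ?mul0mx ?mulmx0 ?addr0 ?add0r.
    by rewrite -scalemxAl addrC subrK.
  by rewrite det_mulmx det_lblock det_ublock !det1 !mul1r.
have d2 : \det M * c = (c - b * (q *m q^T) ord0 ord0) * c ^+ n.
  have dN : \det (block_mx c%:M 0 (- (b *: q^T)) 1%:M : 'M[A]_(1 + n)) = c.
    by rewrite det_lblock det1 mulr1 det_scalar expr1.
  rewrite -[X in _ * X]dN -det_mulmx mulmx_block ?mul1mx ?mulmx1 ?mulmx0 ?addr0 ?add0r.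
  rewrite -?scalemxAl mul_mx_scalar mul_scalar_mx scalerN !scalerA (mulrC c) subrr det_ublock.
  congr (_ * _); last by rewrite det_scalar.
  by rewrite det_mx11 mulmxN -scalemxAr !mxE mulr1n.
by rewrite -d1 mulrC d2.
Qed.

End RankOnePerturbation.

Section Pucci.
Context {R : realType}.

Definition quad_hess (n : nat) (al be : R) (q : 'rV[R]_n) : 'M[R]_n :=
  al%:M + be *: (q^T *m q).

Lemma quad_hess_sym n (al be : R) (q : 'rV[R]_n) : quad_hess al be q \is symmetricmx.
Proof.
apply/is_hermitianmxP; rewrite expr0 scale1r map_mx_id// /quad_hess.
by rewrite linearD linearZ /= tr_scalar_mx trmx_mul trmxK.
Qed.

Lemma dot_mulmx n (q : 'rV[R]_n) : (q *m q^T) ord0 ord0 = dot q q.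
Proof. by rewrite mxE; apply: eq_bigr => i _; rewrite mxE. Qed.

(** [det_rank1] gives the characteristic polynomial after cancelling ['X - al]. As it splits, [xget]
    returns a genuine list of roots, unique up to order. *)
Lemma eigenvalues_quad n (al be : R) (q : 'rV[R]_n.+1) :
  perm_eq (eigenvalues (quad_hess al be q)) ((al + be * dot q q) :: nseq n al).
Proof.
have cp : char_poly (quad_hess al be q) =
    \prod_(a <- (al + be * dot q q) :: nseq n al) ('X - a%:P).
  have c0 : 'X - al%:P != 0 by rewrite polyXsubC_eq0.
  apply: (mulfI c0); rewrite /char_poly /char_poly_mx.
  have -> : 'X%:M - map_mx polyC (quad_hess al be q) =
      ('X - al%:P)%:M - be%:P *: ((map_mx polyC q)^T *m map_mx polyC q).
    rewrite /quad_hess raddfD /= map_scalar_mx map_mxZ map_mxM -matrix.map_trmx raddfB /=.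
    by rewrite opprD addrA.
  rewrite (det_rank1 be%:P (map_mx polyC q) c0) matrix.map_trmx -map_mxM mxE dot_mulmx.
  rewrite big_cons.
  have -> : \prod_(a <- nseq n al) ('X - a%:P) = ('X - al%:P) ^+ n.
    elim: n {q c0} => [|k IH] /=; first by rewrite big_nil.
    by rewrite big_cons IH exprS.
  by rewrite raddfD /= rmorphM /= exprS; ring.
apply: prod_XsubC_eq; rewrite -cp /eigenvalues.
by have /= := @xgetPex _ [::] [set e | char_poly (quad_hess al be q) = \prod_(a <- e) ('X - a%:P)]
  (ex_intro _ _ cp).
Qed.

Lemma sum_eigenvalues_quad n (al be : R) (q : 'rV[R]_n.+1) (P : pred R) :
  \sum_(e <- eigenvalues (quad_hess al be q) | P e) e =
  (if P (al + be * dot q q) then al + be * dot q q else 0) + (if P al then n%:R * al else 0).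
Proof.
rewrite (perm_big _ (eigenvalues_quad al be q)) /= big_cons.
have -> : \sum_(e <- nseq n al | P e) e = if P al then n%:R * al else 0.
  elim: n {q} => [|k IH] /=; first by rewrite big_nil mul0r if_same.
  by rewrite big_cons IH; case: (P al) => //; rewrite -natr1 mulrDl mul1r addrC.
by case: (P _); rewrite ?add0r.
Qed.

Lemma sum_eigenvalues_0 (X : 'M[R]_0) (P : pred R) :
  \sum_(e <- eigenvalues X | P e) e = 0.
Proof.
rewrite /eigenvalues; set S := [set _ | _].
have S0 : S [::] by rewrite /S/= big_nil /char_poly det_mx00.
have := @xgetPex _ [::] S (ex_intro _ _ S0).
case: (xget _ _) => [|a s]; first by rewrite big_nil.
rewrite /S/= /char_poly det_mx00 => /(congr1 (fun p : {poly R} => size p)).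
by rewrite size_prod_XsubC size_poly1.
Qed.

Section Bounds.
Variables (n : nat) (lam Lam al be : R) (q : 'rV[R]_n).
Hypotheses (lL : lam <= Lam) (al0 : al <= 0) (be0 : 0 <= be).

(** The eigenvalues are [al], repeated, and [al + be * dot q q], whose sign is unknown. As
    [al <= 0 <= be] and [lam <= Lam], weighting [al] by [Lam] and the rank one part by [lam] gives a
    bound valid for both signs. *)
Lemma pucci_plus_quad :
  pucci_plus lam Lam (quad_hess al be q) <= - (n%:R * Lam * al + lam * (be * dot q q)).
Proof.
have bq := mulr_ge0 be0 (dot_ge0 q).
case: n q bq => [|m] p bp; rewrite /pucci_plus.
  by rewrite !sum_eigenvalues_0 /dot !big_ord0 !mulr0 !mul0r; lra.
rewrite !sum_eigenvalues_quad -natr1.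
have m0 : 0 <= m%:R :> R by [].
have nal : m%:R * al <= 0 by rewrite mulr_ge0_le0.
have h1 : (Lam - lam) * al <= 0 by rewrite mulr_ge0_le0// subr_ge0.
have h2 : (Lam - lam) * (m%:R * al) <= 0 by rewrite mulr_ge0_le0// subr_ge0.
have h3 : 0 <= (Lam - lam) * (be * dot p p) by rewrite mulr_ge0// subr_ge0.
move: (be * dot p p) (m%:R * al) bp nal h2 h3 (mulrA m%:R al Lam) => B A bp nal h2 h3 E.
have -> : (m%:R + 1) * Lam * al = Lam * A + Lam * al by rewrite mulrAC mulrDl mul1r mulrDl; nra.
by case: (leP 0 al) => ?; case: (leP 0 (al + B)) => ?; nra.
Qed.

Lemma pucci_minus_quad :
  - pucci_minus lam Lam (quad_hess (- al) (- be) q) <= - (n%:R * Lam * al + lam * (be * dot q q)).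
Proof.
have bq := mulr_ge0 be0 (dot_ge0 q).
case: n q bq => [|m] p bp; rewrite /pucci_minus.
  by rewrite !sum_eigenvalues_0 /dot !big_ord0 !mulr0 !mul0r; lra.
rewrite !sum_eigenvalues_quad -natr1 (mulNr be) (mulrN m%:R).
have m0 : 0 <= m%:R :> R by [].
have nal : m%:R * al <= 0 by rewrite mulr_ge0_le0.
have h1 : (Lam - lam) * al <= 0 by rewrite mulr_ge0_le0// subr_ge0.
have h2 : (Lam - lam) * (m%:R * al) <= 0 by rewrite mulr_ge0_le0// subr_ge0.
have h3 : 0 <= (Lam - lam) * (be * dot p p) by rewrite mulr_ge0// subr_ge0.
move: (be * dot p p) (m%:R * al) bp nal h2 h3 (mulrA m%:R al Lam) => B A bp nal h2 h3 E.
have -> : (m%:R + 1) * Lam * al = Lam * A + Lam * al by rewrite mulrAC mulrDl mul1r mulrDl; nra.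
by case: (leP 0 (- al)) => ?; case: (leP 0 (- al - B)) => ?; nra.
Qed.

End Bounds.

End Pucci.

Section QuadraticTest.
Context {R : realType} {n : nat}.
Implicit Types (x y p q : 'rV[R]_n) (a b k al be : R).

Lemma dot_continuous p x0 : continuous (fun x => dot p (x - x0)).
Proof.
move=> x; apply/eucl_continuousP => e e0.
have hp := eucl_norm_ge0 p; exists (e / (`[p] + 1)); first by rewrite divr_gt0//; lra.
move=> y hy; rewrite -[_ - _]/(dot p (y - x0) - dot p (x - x0)).
have -> : dot p (y - x0) - dot p (x - x0) = dot p (y - x) by rewrite !dotE; ring.
have h1 := dot_le_norm p (y - x); have := dot_le_norm (- p) (y - x).
rewrite dotNl eucl_normN => h2.
move: hy; rewrite ltr_pdivlMr; last by lra.
by move=> hy; rewrite ltr_norml; have := eucl_norm_ge0 (y - x); nra.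
Qed.

Lemma is_derive_taylor (f : 'rV[R]_n -> R) y v a b :
  (forall h : R, f (h *: v + y) = f y + h * a + h ^+ 2 * b) -> is_derive y v f a.
Proof.
move=> h.
have H : h^-1 *: ((f \o shift y) (h *: v) - f y) @[h --> 0^'] --> a.
  apply/(@cvgrPdist_lt _ _ _ (0^') _) => e e0.
  have b1 : 0 < `|b| + 1 by rewrite ltr_wpDl.
  near=> t.
  have t0 : t != 0 by near: t; exact: nbhs_dnbhs_neq.
  have -> : t^-1 *: ((f \o shift y) (t *: v) - f y) = a + t * b.
    by rewrite /= h /GRing.scale/=; field.
  rewrite opprD addrA subrr add0r normrN normrM.
  have : `|t| < e / (`|b| + 1).
    near: t; apply: dnbhs0_lt; exact: divr_gt0.
  by rewrite ltr_pdivlMr// => ht; have := normr_ge0 t; nra.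
by apply: DeriveDef; [apply/cvg_ex; exists a|apply: cvg_lim].
Unshelve. all: by end_near.
Qed.

Definition quad_test k al be p q x0 : 'rV[R]_n -> R := fun x =>
  k + dot p (x - x0) + al / 2 * dot (x - x0) (x - x0) + be / 2 * dot q (x - x0) ^+ 2.

Lemma partial_quad_test k al be p q x0 i :
  partial i (quad_test k al be p q x0) =
  fun x => p ord0 i + dot (al *: delta_mx ord0 i + (be * q ord0 i) *: q) (x - x0).
Proof.
have dotd z : dot (delta_mx ord0 i) z = z ord0 i.
  rewrite /dot (bigD1 i)//= big1 ?addr0 ?mxE ?eqxx ?mul1r// => j ji.
  by rewrite mxE (negPf ji) andbF mul0r.
apply/funext => x; apply: (@derive_val _ _ _ _ _ _ _ (is_derive_taylor (b := al / 2 * dot (delta_mx ord0 i) (delta_mx ord0 i) + be / 2 * q ord0 i ^+ 2) _)) => h.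
rewrite /quad_test.
have -> : h *: delta_mx ord0 i + x - x0 = h *: delta_mx ord0 i + (x - x0) :> 'rV[R]_n by rewrite addrA.
move: (x - x0) => z; rewrite !dotE (dotC z (delta_mx _ _)) (dotC p (delta_mx _ _)) (dotC q (delta_mx _ _)).
by rewrite !dotd; field.
Qed.

End QuadraticTest.

Section QuadraticTestC2.
Context {R : realType} {n : nat}.
Implicit Types (x y p q : 'rV[R]_n) (a b k al be : R).

Lemma is_derive_affine k p x0 y i :
  is_derive y (delta_mx ord0 i) (fun x => k + dot p (x - x0)) (p ord0 i).
Proof.
apply: (is_derive_taylor (b := 0)) => h.
have -> : h *: delta_mx ord0 i + y - x0 = h *: delta_mx ord0 i + (y - x0) :> 'rV[R]_n by rewrite addrA.
have dotd z : dot z (delta_mx ord0 i) = z ord0 i.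
  rewrite /dot (bigD1 i)//= big1 ?addr0 ?mxE ?eqxx ?mulr1// => j ji.
  by rewrite mxE (negPf ji) andbF mulr0.
by rewrite !dotE dotd; ring.
Qed.

Lemma quad_test_C2 U k al be p q x0 : C2_on U (quad_test k al be p q x0).
Proof.
have cont k' p' : continuous (fun x => k' + dot p' (x - x0) : R).
  by move=> x; exact: (continuousD (@cst_continuous _ _ k' x) (@dot_continuous _ _ p' x0 x)).
move=> x _ i; split.
- pose d : 'rV[R]_n := delta_mx ord0 i.
  apply: ex_derive; apply: (@is_derive_taylor _ _ _ _ _
    (dot p d + al * dot d (x - x0) + be * dot q d * dot q (x - x0))
    (al / 2 * dot d d + be / 2 * dot q d ^+ 2)) => h.
  rewrite /quad_test.
  have -> : h *: d + x - x0 = h *: d + (x - x0) :> 'rV[R]_n by rewrite addrA.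
  by move: (x - x0) => z; rewrite !dotE (dotC z d); field.
- rewrite partial_quad_test; exact: cont.
- move=> j; rewrite partial_quad_test; split; first by have [] :=
    is_derive_affine (p ord0 i) (al *: delta_mx ord0 i + be * q ord0 i *: q) x0 x j.
  have -> : partial j (fun x => p ord0 i + dot (al *: delta_mx ord0 i + be * q ord0 i *: q) (x - x0)) = fun=> (al *: delta_mx ord0 i + be * q ord0 i *: q) ord0 j.
    by apply/funext => y; apply: (@derive_val _ _ _ _ _ _ _ (is_derive_affine _ _ _ _ _)).
  exact: cst_continuous.
Qed.

Lemma gradient_quad_test k al be p q x0 : gradient (quad_test k al be p q x0) x0 = p.
Proof. by apply/rowP => i; rewrite mxE partial_quad_test subrr dot0r addr0. Qed.

Lemma hessian_quad_test k al be p q x0 x : hessian (quad_test k al be p q x0) x = quad_hess al be q.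
Proof.
apply/matrixP => i j; rewrite mxE partial_quad_test.
rewrite [LHS](@derive_val _ _ _ _ _ _ _ (is_derive_affine _ _ _ _ _)) !mxE eqxx /= big_ord1 !mxE.
by rewrite eq_sym mulr_natr; congr (_ + _); ring.
Qed.

(* The quadratic polynomial with value W x, gradient p and Hessian
   al I + be q^T q touches W from below at x. *)
Definition touch (W : 'rV[R]_n -> R) x al be p q :=
  exists2 e : R, 0 < e & forall y, `[y - x] < e -> quad_test (W x) al be p q x y <= W y.

(* W is a supersolution, tested only by touching polynomials with al <= 0 <= be
   and where W <= tau, of a rescaled Pucci inequality. *)
Definition ssol (lam L : R) (phi : R -> R) (D E tau : R) (U : set 'rV[R]_n) (W : 'rV[R]_n -> R) :=
  forall x al be p q, U x -> W x <= tau -> al <= 0 -> 0 <= be -> touch W x al be p q ->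
    L * al + lam * (be * dot q q) <= D * (phi `[p] + phi (E * W x)).

End QuadraticTestC2.

(** * From viscosity solutions to touching inequalities *)

Section ViscosityToTouch.
Context {R : realType} {n : nat}.
Variables (lam Lam rb Cstar : R) (phi gam : R -> R).
Variables (F : 'rV[R]_n -> R -> 'rV[R]_n -> 'M[R]_n -> R).
Hypotheses (hlam : 0 < lam) (hLam : lam <= Lam) (hrb : 0 < rb).
Hypothesis phi_ge0 : forall t : R, 0 <= t -> 0 <= phi t.
Hypothesis phi_incr : forall s t : R, 0 <= s -> s < t -> phi s < phi t.
Hypothesis F_ell : forall x p s t X Y, X \is symmetricmx -> Y \is symmetricmx ->
       t <= s -> psd_le X Y -> F x t p Y <= F x s p X.
Hypothesis F_below : forall x p X, X \is symmetricmx ->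
       - F x 0 p X <= phi (eucl_norm p) - pucci_minus lam Lam X.
Hypothesis F_above : forall s x p X, 0 <= s -> X \is symmetricmx ->
       F x s p X <= phi (eucl_norm p) + pucci_plus lam Lam X + gam s.
Hypothesis gamP : forall s, 0 <= s -> s <= 1 -> gam s <= Cstar * phi s.
Variables (U : set 'rV[R]_n) (v : 'rV[R]_n -> R) (eta : 'rV[R]_n) (r : R).
Hypotheses (vsol : viscosity_solution F U v) (vpos : forall x, U x -> 0 < v x).
Hypotheses (r0 : 0 < r) (rrb : r < rb).

Definition rescale x : R := v (eta + r *: x) / r.

Lemma quad_test_rescale k al be p q x0 y :
  quad_test k al be p q x0 y =
  quad_test (k * r) (al / r) (be / r) p q (eta + r *: x0) (eta + r *: y) / r.
Proof.
rewrite /quad_test.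
have -> : eta + r *: y - (eta + r *: x0) = r *: (y - x0).
  by rewrite scalerBr opprD addrACA subrr add0r.
by rewrite !dotE; field; rewrite gt_eqF.
Qed.

Lemma rescale_ball e x (P : set 'rV[R]_n) : 0 < e -> (forall y, `[y - x] < e -> P (eta + r *: y)) ->
  \forall z \near (eta + r *: x), P z.
Proof.
move=> e0 h; apply/near_euclP; exists (r * e); first by rewrite mulr_gt0.
move=> z hz; have E : z = eta + r *: (r^-1 *: (z - eta)).
  by rewrite scalerA divff ?gt_eqF// scale1r addrC subrK.
rewrite E; apply: h.
have -> : r^-1 *: (z - eta) - x = r^-1 *: (z - (eta + r *: x)).
  by rewrite opprD addrA [RHS]scalerBr scalerA mulVf ?gt_eqF// scale1r.
by rewrite eucl_normZ gtr0_norm ?invr_gt0// mulrC ltr_pdivrMr// mulrC.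
Qed.

Lemma phi_le s t : 0 <= s -> s <= t -> phi s <= phi t.
Proof. by move=> s0; rewrite le_eqVlt => /orP[/eqP->//|/(phi_incr s0)/ltW]. Qed.

(** Scaling back, the test polynomial keeps its gradient and has its Hessian divided by [r], so the
    right-hand side gains a factor [r < rb]. The threshold [rb^-1] ensures [v <= 1] at the contact
    point, where [gam] is controlled. The factor [n + 1] keeps the first coefficient positive in
    dimension 0, and the absolute value covers a negative [Cstar]. *)
Lemma rescale_ssol :
  ssol lam ((n%:R + 1) * Lam) phi (rb * (1 + `|Cstar|)) rb rb^-1
    [set x | U (eta + r *: x)] rescale.
Proof.
move=> x al be p q /= Ux Vtau al0 be0 [e e0 htouch].
set X := eta + r *: x; have vE : rescale x = v X / r by [].
have v0 : 0 < v X := vpos Ux.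
have vle : v X <= 1.
  move: Vtau; rewrite vE ler_pdivrMr// => h; apply: le_trans h _.
  by rewrite mulrC ler_pdivrMr// mul1r ltW.
have [_ hv] := vsol.
pose psi := quad_test (v X) (al / r) (be / r) p q X.
have [_ hv2] := hv psi X (@quad_test_C2 _ _ U _ _ _ _ _ _) Ux.
have /hv2 : \forall y \near X, v X - psi X <= v y - psi y.
  apply: (rescale_ball e0) => y hy; have := htouch y hy.
  rewrite quad_test_rescale /rescale -/X divfK ?gt_eqF// ler_pM2r ?invr_gt0//.
  have -> : psi X = v X by rewrite /psi /quad_test subrr !dot0r; ring.
  by rewrite /psi; lra.
rewrite /psi gradient_quad_test hessian_quad_test => F0.
have := F_above X p (ltW v0) (quad_hess_sym (al / r) (be / r) q).
have alr : al / r <= 0 by rewrite mulr_le0_ge0// invr_ge0 ltW.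
have ber : 0 <= be / r by rewrite divr_ge0// ltW.
have := @pucci_plus_quad _ _ lam Lam (al / r) (be / r) q hLam alr ber.
have := gamP (ltW v0) vle => g1 P1 F1.
have phv : phi (v X) <= phi (rb * rescale x).
  apply: phi_le; first exact: ltW.
  rewrite vE mulrCA; apply: ler_peMr; first exact: ltW.
  by rewrite ler_pdivlMr// mul1r ltW.
have pp : 0 <= phi `[p] by rewrite phi_ge0 ?eucl_norm_ge0.
have pv : 0 <= phi (v X) by rewrite phi_ge0 ?ltW.
have C1 : Cstar * phi (v X) <= `|Cstar| * phi (rb * rescale x).
  apply: le_trans (ler_norm _) _; rewrite normrM (ger0_norm pv).
  by rewrite ler_wpM2l.
set Q := phi `[p] + `|Cstar| * phi (rb * rescale x).
have H1 : n%:R * Lam * (al / r) + lam * (be / r * dot q q) <= Q by rewrite /Q; lra.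
have Q0 : 0 <= Q by rewrite /Q addr_ge0// mulr_ge0// (le_trans pv).
have H2 : n%:R * Lam * al + lam * (be * dot q q) <= rb * Q.
  apply: (@le_trans _ _ (r * Q)); last by rewrite ler_wpM2r// ltW.
  rewrite -ler_pdivrMl//; apply: le_trans H1.
  by rewrite le_eqVlt; apply/orP; left; apply/eqP; field; rewrite gt_eqF.
have H3 : Lam * al <= 0 by rewrite mulr_ge0_le0// (le_trans (ltW hlam)).
have H4 : Q <= (1 + `|Cstar|) * (phi `[p] + phi (rb * rescale x)).
  have := mulr_ge0 (normr_ge0 Cstar) pp; rewrite /Q [in X in _ -> X]mulrDl mul1r mulrDr.
  by have := le_trans pv phv; lra.
have H5 : rb * Q <= rb * (1 + `|Cstar|) * (phi `[p] + phi (rb * rescale x)).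
  by rewrite -mulrA ler_wpM2l// ltW.
lra.
Qed.

(** Since [v > 0], ellipticity lowers the value argument of [F] to 0 with the same matrix. No term
    in [v] remains, whence the coefficient 0 inside [phi] and the arbitrary threshold; the extra
    [phi 0] is nonnegative. *)
Lemma rescaleN_ssol tau :
  ssol lam ((n%:R + 1) * Lam) phi (rb * (1 + `|Cstar|)) 0 tau
    [set x | U (eta + r *: x)] (fun x => - rescale x).
Proof.
move=> x al be p q /= Ux Vtau al0 be0 [e e0 htouch].
set X := eta + r *: x; have vE : rescale x = v X / r by [].
have v0 : 0 < v X := vpos Ux.
have [_ hv] := vsol.
pose psi := quad_test (v X) (- (al / r)) (- (be / r)) (- p) q X.
have [hv2 _] := hv psi X (@quad_test_C2 _ _ U _ _ _ _ _ _) Ux.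
have /hv2 : \forall y \near X, v y - psi y <= v X - psi X.
  apply: (rescale_ball e0) => y hy; have := htouch y hy.
  rewrite quad_test_rescale /rescale -/X.
  rewrite -(ler_pM2r r0) divfK ?gt_eqF// !mulNr !divfK ?gt_eqF//.
  by rewrite /psi /quad_test subrr !dot0r dotNl; lra.
rewrite /psi gradient_quad_test hessian_quad_test => F0.
have F1 : F X 0 (- p) (quad_hess (- (al / r)) (- (be / r)) q) <= 0.
  apply: le_trans F0; apply: F_ell; rewrite ?quad_hess_sym ?ltW//.
  by move=> xi; rewrite subrr mulmx0 mul0mx mxE.
have := F_below X (- p) (quad_hess_sym (- (al / r)) (- (be / r)) q).
have alr : al / r <= 0 by rewrite mulr_le0_ge0// invr_ge0 ltW.
have ber : 0 <= be / r by rewrite divr_ge0// ltW.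
have := @pucci_minus_quad _ _ lam Lam (al / r) (be / r) q hLam alr ber.
rewrite eucl_normN => P1 F2.
have pp : 0 <= phi `[p] by rewrite phi_ge0 ?eucl_norm_ge0.
have H1 : n%:R * Lam * (al / r) + lam * (be / r * dot q q) <= phi `[p] by lra.
have H2 : n%:R * Lam * al + lam * (be * dot q q) <= rb * phi `[p].
  apply: (@le_trans _ _ (r * phi `[p])); last by rewrite ler_wpM2r// ltW.
  rewrite -ler_pdivrMl//; apply: le_trans H1.
  by rewrite le_eqVlt; apply/orP; left; apply/eqP; field; rewrite gt_eqF.
have H3 : Lam * al <= 0 by rewrite mulr_ge0_le0// (le_trans (ltW hlam)).
rewrite mul0r; have p0 := phi_ge0 (lexx 0).
have H4 : phi `[p] <= (1 + `|Cstar|) * (phi `[p] + phi 0).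
  have := mulr_ge0 (normr_ge0 Cstar) pp; have := mulr_ge0 (normr_ge0 Cstar) p0; nra.
have H5 : rb * phi `[p] <= rb * (1 + `|Cstar|) * (phi `[p] + phi 0).
  by rewrite -mulrA ler_wpM2l// ltW.
lra.
Qed.

End ViscosityToTouch.

(** * Radial barriers and contact paraboloids *)

Section RadialTouch.
Context {R : realType} {n : nat}.
Implicit Types (x y c : 'rV[R]_n) (a e s : R).

(** Only the first derivative of [g] at [s0] is used. Keeping [g1 / 4] in place of the Taylor
    coefficient [g1 / 2] leaves a margin: near [s0] the difference of [G] and the quadratic
    decreases before [s0] and increases after it. *)
Lemma local_quad_bound (G g : R -> R) (s0 g1 d : R) : 0 < d -> 0 < g1 ->
  (forall s, `|s - s0| < d -> is_derive s (1 : R) G (g s)) ->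
  is_derive s0 (1 : R) g g1 ->
  exists2 d' : R, 0 < d' & forall s, `|s - s0| < d' ->
    G s0 + g s0 * (s - s0) + g1 / 4 * (s - s0) ^+ 2 <= G s.
Proof.
move=> d0 g10 dG dg.
have /cvgrPdist_lt/(_ (g1 / 2)) : h^-1 *: ((g \o shift s0) (h *: 1) - g s0) @[h --> 0^'] --> g1.
  by rewrite -[X in _ --> X](@derive_val _ _ _ _ _ _ _ dg); apply: ex_derive.
have g12 : 0 < g1 / 2 by rewrite divr_gt0.
move=> /(_ g12); rewrite /at_right near_withinE near_simpl => /nbhs_ballP[d1 /= d10 hd1].
have gq h : h != 0 -> `|h| < d1 -> g1 / 2 < (g (s0 + h) - g s0) / h.
  move=> h0 hd; have := hd1 h; rewrite /ball/= sub0r normrN => /(_ hd h0).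
  rewrite /shift/= [h *: _]mulr1 addrC ltr_norml => /andP[_].
  rewrite -[_ *: _]/(h^-1 * _) [h^-1 * _]mulrC (addrC s0); lra.
exists (Num.min d d1); first by rewrite lt_min d0 d10.
move=> s; rewrite lt_min => /andP[sd sd1].
pose H t := G t - (g s0 * (t - s0) + g1 / 4 * (t - s0) ^+ 2).
pose H' t := g t - (g s0 + g1 / 2 * (t - s0)).
have dH t : `|t - s0| < d -> is_derive t (1 : R) H (H' t).
  move=> td; have := dG t td => ?.
  rewrite /H /H'; apply: is_derive_eq.
  by rewrite /GRing.scale/=; field.
suff : H s0 <= H s by rewrite /H subrr expr0n/= !mulr0 !addr0 subr0; lra.
have cH a b : `|a - s0| < d -> `|b - s0| < d -> {within `[a, b], continuous H}.
  move=> ad bd; apply: derivable_within_continuous => t.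
  rewrite in_itv/= => /andP[t1 t2]; apply: ex_derive; apply: dH.
  by move: ad bd; rewrite !ltr_norml => /andP[? ?] /andP[? ?]; apply/andP; split; lra.
have s0d : `|s0 - s0| < d by rewrite subrr normr0.
have dist t : s - s0 < 0 \/ 0 < s - s0 -> 
  (s <= t <= s0 \/ s0 <= t <= s) -> `|t - s0| <= `|s - s0|.
  by move=> _ [/andP[t1 t2]|/andP[t1 t2]]; [rewrite !ler0_norm|rewrite !ger0_norm]; lra.
have [->//|] := eqVneq s s0; rewrite neq_lt => /orP[ss|ss].
- have [t|t tI E] := @MVT _ H H' s s0 ss _ (cH _ _ sd s0d).
    rewrite in_itv/= => /andP[t1 t2]; apply: dH; apply: le_lt_trans sd; apply: dist; first lra.
    by left; rewrite !ltW.
  move: tI; rewrite in_itv/= => /andP[t1 t2].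
  have := @gq (t - s0); rewrite lt_eqF ?subr_lt0// => /(_ isT) h.
  have {}h := h (le_lt_trans (dist t (ltac:(lra)) (ltac:(left; rewrite !ltW//))) sd1).
  move: h; rewrite (addrC s0) subrK ltr_ndivlMr ?subr_lt0// => h.
  have : H' t <= 0 by rewrite /H'; lra.
  move=> h'; have := mulr_le0_ge0 h' (ltac:(rewrite subr_ge0 ltW//) : 0 <= s0 - s).
  by rewrite -E; lra.
- have [t|t tI E] := @MVT _ H H' s0 s ss _ (cH _ _ s0d sd).
    rewrite in_itv/= => /andP[t1 t2]; apply: dH; apply: le_lt_trans sd; apply: dist; first lra.
    by right; rewrite !ltW.
  move: tI; rewrite in_itv/= => /andP[t1 t2].
  have := @gq (t - s0); rewrite gt_eqF ?subr_gt0// => /(_ isT) h.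
  have {}h := h (le_lt_trans (dist t (ltac:(lra)) (ltac:(right; rewrite !ltW//))) sd1).
  move: h; rewrite (addrC s0) subrK ltr_pdivlMr ?subr_gt0// => h.
  have : 0 <= H' t by rewrite /H'; lra.
  move=> h'; have := mulr_ge0 h' (ltac:(rewrite subr_ge0 ltW//) : 0 <= s - s0).
  by rewrite -E; lra.
Qed.

Section Touch.
Variables (lam L : R) (W : 'rV[R]_n -> R).
Hypotheses (L0 : 0 <= L).

(** [G] is a function of the squared distance, so that no singularity arises at the center. *)
Definition radial a y0 c (G : R -> R) x : R :=
  - (a / 2) * dot (x - y0) (x - y0) + G (dot (x - c) (x - c)).

Lemma radial_touch a y0 c (G : R -> R) G1 G2 x : 0 <= G2 ->
  (exists2 d : R, 0 < d & forall s, `|s - dot (x - c) (x - c)| < d ->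
    G (dot (x - c) (x - c)) + G1 * (s - dot (x - c) (x - c))
      + G2 * (s - dot (x - c) (x - c)) ^+ 2 <= G s) ->
  (exists2 e : R, 0 < e & forall y, `[y - x] < e ->
     W x - radial a y0 c G x <= W y - radial a y0 c G y) ->
  forall eps, 0 < eps ->
  touch W x (2 * G1 - a - 2 * eps) (4 * G2) ((2 * G1) *: (x - c) - a *: (x - y0)) (x - c).
Proof.
move=> G20 [d d0 hd] [e e0 he] eps eps0.
have [d1 d10 hd1] := (eucl_continuousP _ _).1 (@sqdist_continuous _ _ c x) d d0.
have gg : 0 < G2 + 1 by lra.
exists (Num.min (Num.min d1 e) (Num.min 1 (eps / (G2 + 1)))).
  by rewrite !lt_min d10 e0 ltr01 divr_gt0.
move=> y; rewrite !lt_min => /andP[/andP[y1 y2] /andP[y3 y4]].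
have := he y y2; have := hd _ (hd1 y y1).
rewrite /radial /quad_test.
have -> : y - c = (x - c) + (y - x) by rewrite [RHS]addrC subrKA.
have -> : y - y0 = (x - y0) + (y - x) by rewrite [RHS]addrC subrKA.
have hle : G2 * dot (y - x) (y - x) <= eps.
  have n0 := eucl_norm_ge0 (y - x); move: y4; rewrite ltr_pdivlMr// -sqr_eucl_norm => y4.
  have : `[y - x] ^+ 2 <= `[y - x] by rewrite expr2; nra.
  by nra.
have hh := dot_ge0 (y - x).
have {}hle : G2 * dot (y - x) (y - x) ^+ 2 <= eps * dot (y - x) (y - x).
  by rewrite expr2 mulrA ler_wpM2r.
move: (y - x) (x - c) (x - y0) hh hle => h u w hh hle.
rewrite !dotE (dotC h u) (dotC h w) => H1 H2.
have sq : 0 <= G2 * (dot u h + dot h h) ^+ 2 by rewrite mulr_ge0 ?sqr_ge0.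
lra.
Qed.

(** The loss [eps] of [radial_touch] enters linearly, through [al] only, and is sent to 0. *)
Lemma radial_ineq a y0 c (G : R -> R) G1 G2 x K :
  let p := (2 * G1) *: (x - c) - a *: (x - y0) in
  0 <= G2 -> 0 <= a -> G1 <= 0 ->
  (exists2 d : R, 0 < d & forall s, `|s - dot (x - c) (x - c)| < d ->
    G (dot (x - c) (x - c)) + G1 * (s - dot (x - c) (x - c))
      + G2 * (s - dot (x - c) (x - c)) ^+ 2 <= G s) ->
  (exists2 e : R, 0 < e & forall y, `[y - x] < e ->
     W x - radial a y0 c G x <= W y - radial a y0 c G y) ->
  (forall al be, al <= 0 -> 0 <= be -> touch W x al be p (x - c) ->
     L * al + lam * (be * dot (x - c) (x - c)) <= K) ->
  L * (2 * G1 - a) + lam * (4 * G2 * dot (x - c) (x - c)) <= K.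
Proof.
move=> p G20 a0 G10 hG hmin hK; apply/ler_addgt0Pr => e e0.
have L2 : 0 < 2 * (L + 1) by have := L0; lra.
have e2 : 0 < (e : R) / (2 * (L + 1)) by rewrite divr_gt0.
have := hK _ _ _ _ (radial_touch G20 hG hmin e2).
have := divfK (lt0r_neq0 L2) (e : R).
move: (e / _) e2 => f f0 <- /(_ (ltac:(lra)) (ltac:(lra))).
by move: L0 => L0'; nra.
Qed.

End Touch.

Lemma radial_continuous a y0 c (G : R -> R) x :
  {for dot (x - c) (x - c), continuous G} -> {for x, continuous (radial a y0 c G)}.
Proof.
move=> cG; have c1 := @sqdist_continuous _ _ y0 x.
have c2 : {for x, continuous (fun x => G (dot (x - c) (x - c)))}.
  exact: (@continuous_comp _ _ _ (fun x => dot (x - c) (x - c)) G x (@sqdist_continuous _ _ c x) cG).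
apply: (@continuousD _ _ _ (fun x => - (a / 2) * dot (x - y0) (x - y0)) _ x) => //.
by apply: (@continuousM _ _ (fun=> - (a / 2)) _ x) => //; exact: cst_continuous.
Qed.

Lemma negative_min_touch (K : set 'rV[R]_n) (W psi : 'rV[R]_n -> R) :
  compact K -> {within K, continuous W} -> (forall x, K x -> {for x, continuous psi}) ->
  (exists2 x, K x & W x < psi x) ->
  (forall x, K x -> W x < psi x -> exists2 e : R, 0 < e & forall y, `[y - x] < e -> K y) ->
  exists2 x, K x /\ W x < psi x &
    exists2 e : R, 0 < e & forall y, `[y - x] < e -> W x - psi x <= W y - psi y.
Proof.
move=> cK cW cpsi [x0 Kx0 h0] hint.
have cpsi' : {within K, continuous psi}.
  by apply: continuous_in_subspaceT => x /set_mem; exact: cpsi.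
have [|x Kx hx] := @eucl_EVT_min _ _ K (fun x => W x - psi x) (ex_intro _ _ Kx0) cK.
  by move=> x; exact: (continuousB (cW x) (cpsi' x)).
have hW : W x < psi x by have := hx _ Kx0; lra.
have [e e0 he] := hint x Kx hW.
by exists x => //; exists e => // y /he; exact: hx.
Qed.

End RadialTouch.

Section Barrier.
Context {R : realType} {n : nat}.
Implicit Types (x y c z : 'rV[R]_n) (a e s : R).
Variables (lam L : R).
Hypotheses (L0 : 0 < L) (lam0 : 0 < lam).

(* Supersolutions of a Pucci inequality with bounded right-hand side, tested
   only where the value is at most tau and the slope at most theta. *)
Definition bsol (theta tau kap : R) (U : set 'rV[R]_n) (W : 'rV[R]_n -> R) :=
  forall x al be p q, U x -> W x <= tau -> `[p] <= theta -> al <= 0 -> 0 <= be ->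
    touch W x al be p q -> L * al + lam * (be * dot q q) <= kap.

(** Rate and height of an exponential bump: [lam * barA t0 * t0 ^+ 2 = 4 * L] makes its radial
    second derivative dominate outside the radius [t0 * rho], and [barC] makes the surplus exceed
    the right-hand side even where the exponential is least. *)
Definition barA t0 := 4 * L / (lam * t0 ^+ 2).
Definition barC t0 := (1 + L^-1) * expR (barA t0) / barA t0.

Lemma barA_gt0 t0 : 0 < t0 -> 0 < barA t0.
Proof. by move=> h; rewrite /barA !(divr_gt0, mulr_gt0, exprn_gt0). Qed.

Lemma barC_gt0 t0 : 0 < t0 -> 0 < barC t0.
Proof.
move=> h; rewrite /barC !(divr_gt0, mulr_gt0) ?expR_gt0 ?barA_gt0//.
by rewrite addr_gt0 ?invr_gt0.
Qed.

Definition exp_profile k mu A rho (s : R) : R := k + mu * (expR (- (A / rho ^+ 2) * s) - expR (- A)).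

Lemma is_derive_exp_scale (b : R) (s : R) :
  is_derive s (1 : R) (fun s => expR (b * s)) (b * expR (b * s)).
Proof.
have h : is_derive s (1 : R) (fun s => b * s) b.
  by apply: is_derive_eq; rewrite /GRing.scale/=; ring.
rewrite mulrC; exact: (@is_derive1_comp _ expR (fun s => b * s) s _ _ (is_derive_expR _) h).
Qed.

Lemma exp_profile_derive k mu A rho s :
  is_derive s (1 : R) (exp_profile k mu A rho)
    (mu * (- (A / rho ^+ 2) * expR (- (A / rho ^+ 2) * s))).
Proof.
have := is_derive_exp_scale (- (A / rho ^+ 2)) s => ?.
by rewrite /exp_profile; apply: is_derive_eq; rewrite /GRing.scale/=; ring.
Qed.

Lemma exp_profile_derive2 mu A rho s :
  is_derive s (1 : R) (fun s => mu * (- (A / rho ^+ 2) * expR (- (A / rho ^+ 2) * s)))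
    (mu * ((A / rho ^+ 2) ^+ 2 * expR (- (A / rho ^+ 2) * s))).
Proof.
have := is_derive_exp_scale (- (A / rho ^+ 2)) s => ?.
by apply: is_derive_eq; rewrite /GRing.scale/=; ring.
Qed.

(** Otherwise [W] exceeds the paraboloid by more than [C * rho ^+ 2] on the small ball. Add to the
    paraboloid a bump at most that high, vanishing on the sphere of radius [rho] and positive at
    [x]: the difference from [W] has a negative minimum in the annulus, where the bump violates the
    inequality. The last two hypotheses keep slope and height within the budgets. *)
Lemma barrier_contact theta tau kap (U : set 'rV[R]_n) W t0 rho z1 a y k x :
  bsol theta tau kap U W -> 0 < t0 -> 0 < rho -> 0 < a -> 0 <= kap ->
  let C := barC t0 * (kap + a) in
  cball z1 rho `<=` U -> {within cball z1 rho, continuous W} ->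
  (forall z, cball z1 rho z -> k - a / 2 * dot (z - y) (z - y) <= W z) ->
  W x <= k - a / 2 * dot (x - y) (x - y) -> `[x - z1] < rho ->
  2 * C * barA t0 * rho + a * (`[z1 - y] + rho) <= theta ->
  k + C * rho ^+ 2 <= tau ->
  exists2 z, `[z - z1] <= t0 * rho & W z <= k - a / 2 * dot (z - y) (z - y) + C * rho ^+ 2.
Proof.
move=> Wsol t00 rho0 a0 kap0 C KU cW hP hx xz1 hth htau.
apply: contrapT => hno.
have A0 := barA_gt0 t00; move: (erefl (barA t0)) A0 hth; move: {2 3 4}(barA t0) => A defA A0 hth.
have C0 : 0 < C by rewrite /C mulr_gt0 ?barC_gt0//; lra.
pose mu := C * rho ^+ 2; have mu0 : 0 < mu by rewrite mulr_gt0 ?exprn_gt0.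
pose G := exp_profile k mu A rho.
have rho2 : 0 < rho ^+ 2 by rewrite exprn_gt0.
have GE s : G s = k + mu * (expR (- (A / rho ^+ 2) * s) - expR (- A)) by [].
have sE b : - (A / rho ^+ 2) * b = - A * (b / rho ^+ 2) by ring.
have G_in s : s < rho ^+ 2 -> k < G s.
  move=> h; rewrite GE ltrDl mulr_gt0// subr_gt0 ltr_expR sE.
  have : s / rho ^+ 2 < 1 by rewrite ltr_pdivrMr// mul1r.
  nra.
have G_le s : 0 <= s -> G s <= k + mu.
  move=> s0; rewrite GE lerD2l ler_piMr// ?ltW//.
  have : expR (- (A / rho ^+ 2) * s) <= 1.
    by rewrite -expR0 ler_expR sE mulNr oppr_le0; apply: mulr_ge0 (ltW A0) (divr_ge0 s0 (ltW rho2)).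
  have := expR_gt0 (- A); lra.
have W_far z : `[z - z1] <= t0 * rho -> radial a y z1 G z < W z.
  move=> hz; rewrite ltNge; apply/negP => h; apply: hno; exists z => //.
  apply: le_trans h _; rewrite /radial.
  have := G_le _ (dot_ge0 (z - z1)); rewrite /mu; lra.
have W_bd z : `[z - z1] = rho -> cball z1 rho z -> radial a y z1 G z <= W z.
  move=> hz Kz; apply: le_trans (hP z Kz); rewrite /radial -[X in G X]sqr_eucl_norm hz.
  rewrite GE sE divff ?gt_eqF// mulr1 subrr mulr0; lra.
have Gc s : {for s, continuous G}.
  apply: differentiable_continuous; apply/derivable1_diffP.
  by have := exp_profile_derive k mu A rho s => ?; apply: ex_derive.
have [|||||z [Kz Wz] zmin] := @negative_min_touch _ _ (cball z1 rho) W (radial a y z1 G).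
- by apply: (@eucl_compact _ _ _ z1 rho) => //; exact: cball_closed.
- exact: cW.
- by move=> z _; exact: radial_continuous.
- exists x; first exact: ltW.
  have := G_in (dot (x - z1) (x - z1)); rewrite -eucl_norm_lt ?ltW// => /(_ xz1).
  by rewrite /radial; move: hx; lra.
- move=> z Kz Wz; have zr : `[z - z1] < rho.
    rewrite lt_neqAle Kz andbT; apply/eqP => h; have := W_bd z h Kz; lra.
  exists (rho - `[z - z1]); first by rewrite subr_gt0.
  by move=> z' hz'; rewrite /cball/=; have := eucl_dist_triangle z z' z1; lra.
have zt : t0 * rho < `[z - z1].
  by rewrite ltNge; apply/negP => h; have := W_far z h; lra.
set s := dot (z - z1) (z - z1) in Wz zmin.
have s_lo : t0 ^+ 2 * rho ^+ 2 <= s.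
  by rewrite -exprMn /s -sqr_eucl_norm ler_sqr ?nnegrE ?eucl_norm_ge0 ?mulr_ge0 ?ltW.
have s_hi : s <= rho ^+ 2 by rewrite /s -eucl_norm_le// ltW.
pose E := expR (- (A / rho ^+ 2) * s).
pose g := mu * (A / rho ^+ 2 * E).
have E_lo : expR (- A) <= E.
  rewrite /E ler_expR sE.
  have : s / rho ^+ 2 <= 1 by rewrite ler_pdivrMr// mul1r.
  nra.
have E_hi : E <= 1.
  by rewrite /E -expR0 ler_expR sE mulNr oppr_le0; apply: mulr_ge0 (ltW A0) (divr_ge0 (dot_ge0 _) (ltW rho2)).
have E0 : 0 < E by exact: expR_gt0.
have gE : g = C * A * E by rewrite /g /mu; field; rewrite gt_eqF.
have CA0 : 0 < C * A by rewrite mulr_gt0.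
have g0 : 0 < g by rewrite gE mulr_gt0.
have g_hi : g <= C * A by rewrite gE ler_piMr// ltW.
have hG : exists2 d, 0 < d & forall t, `|t - s| < d ->
    G s + (- g) * (t - s) + (g * A / rho ^+ 2 / 4) * (t - s) ^+ 2 <= G t.
  have [|d d0 hd] := @local_quad_bound _ G _ s _ 1 ltr01 _
     (fun t _ => exp_profile_derive k mu A rho t) (exp_profile_derive2 mu A rho s).
  - by apply: mulr_gt0 => //; apply: mulr_gt0; [apply: exprn_gt0; exact: divr_gt0|exact: expR_gt0].
  - exists d => // t ht; apply: le_trans (hd t ht).
    by rewrite le_eqVlt; apply/orP; left; apply/eqP; rewrite /g -/E; ring.
have := @radial_ineq _ _ lam L W (ltW L0) a y z1 G (- g) (g * A / rho ^+ 2 / 4) z kap.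
rewrite -/s => /(_ _ (ltW a0) _ hG zmin) H.
have {H} : L * (2 * - g - a) + lam * (4 * (g * A / rho ^+ 2 / 4) * s) <= kap.
  apply: H.
    exact: divr_ge0 (divr_ge0 (mulr_ge0 (ltW g0) (ltW A0)) (ltW rho2)) (ler0n _ 4).
    by rewrite oppr_le0 ltW.
  move=> al be al0 be0 ht; apply: (Wsol _ _ _ _ _ _ _ _ al0 be0 ht); first exact: KU.
    apply: le_trans (ltW Wz) _; apply: le_trans htau; rewrite /radial -/s.
    by have := G_le s (dot_ge0 _); have := mulr_ge0 (ltW a0) (dot_ge0 (z - y)); rewrite /mu; lra.
  apply: le_trans (eucl_normD _ _) _; rewrite eucl_normN !eucl_normZ (gtr0_norm a0).
  have g20 : 0 < 2 * g by lra.
  rewrite mulrN normrN (gtr0_norm g20).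
  have h1 : `[z - y] <= `[z1 - y] + rho.
    by have := eucl_dist_triangle z1 z y; move: Kz; rewrite /cball/=; lra.
  have h2 : 2 * g * `[z - z1] <= 2 * (C * A) * rho.
    apply: ler_pM => //; [lra|exact: eucl_norm_ge0|lra].
  have := ler_wpM2l (ltW a0) h1; lra.
(* The rank one term is at least [4 * L * g], against the first-order loss [2 * L * g]. There
   remains [2 * L * g <= kap + L * a], whereas the choice of [barC] gives
   [L * g >= (L + 1) * (kap + a)]. *)
have h1 : lam * (4 * (g * A / rho ^+ 2 / 4) * s) = lam * A * g * (s / rho ^+ 2).
  by field; rewrite gt_eqF.
have h2 : t0 ^+ 2 <= s / rho ^+ 2 by rewrite ler_pdivlMr.
have h3 : lam * A * t0 ^+ 2 = 4 * L.
  by rewrite -defA /barA; field; rewrite !gt_eqF.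
have h4 : 4 * L * g <= lam * A * g * (s / rho ^+ 2).
  have := ler_wpM2l (ltW (mulr_gt0 (mulr_gt0 lam0 A0) g0)) h2.
  by rewrite -h3; lra.
move=> h5; rewrite h1 in h5.
have h6 : 2 * L * g <= kap + L * a by lra.
have h7 : C * A * expR (- A) <= g by rewrite gE ler_pM2l.
have h8 : L * (C * A * expR (- A)) = (L + 1) * (kap + a).
  rewrite /C /barC defA expRN; field.
  by rewrite !gt_eqF ?expR_gt0.
have h9 : L * (C * A * expR (- A)) <= L * g by rewrite ler_pM2l.
have := mulr_ge0 (ltW L0) kap0; have := mulr_gt0 L0 a0.
by rewrite h8 in h9; lra.
Qed.

End Barrier.

(** * Contact points of sliding paraboloids *)

Section Contact.
Context {R : realType} {n : nat}.
Implicit Types (x y c z : 'rV[R]_n) (a e s : R).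
Variables (lam L : R).
Hypotheses (L0 : 0 < L) (lam0 : 0 < lam).

(* The paraboloid of opening -a with vertex y, slid upwards from below, first
   touches the graph of W over D at x. *)
Definition contact (D : set 'rV[R]_n) (W : 'rV[R]_n -> R) a x y :=
  D x /\ forall z, D z ->
    W x + a / 2 * dot (x - y) (x - y) <= W z + a / 2 * dot (z - y) (z - y).

Lemma cball_sub c c' (r r' : R) : `[c - c'] + r <= r' -> cball c r `<=` cball c' r'.
Proof.
by move=> h z; rewrite /cball/= => hz; have := eucl_dist_triangle c z c'; lra.
Qed.

Lemma contact_exists (D : set 'rV[R]_n) W a y x0 : compact D -> D x0 ->
  {within D, continuous W} -> exists x, contact D W a x y.
Proof.
move=> cD Dx0 cW.
have cq : continuous (fun z => a / 2 * dot (z - y) (z - y)).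
  by move=> z; apply: (@continuousM _ _ (fun=> a / 2) _ z);
    [exact: cst_continuous|exact: sqdist_continuous].
have [|x Dx hx] := @eucl_EVT_min _ _ D (fun z => W z + a / 2 * dot (z - y) (z - y)) (ex_intro _ _ Dx0) cD.
  have cq' : {within D, continuous (fun z => a / 2 * dot (z - y) (z - y))}.
    exact: continuous_subspaceT.
  by move=> z; exact: (continuousD (cW z) (cq' z)).
by exists x.
Qed.

Section Estimates.
Variables (theta tau kap : R) (U D : set 'rV[R]_n) (W : 'rV[R]_n -> R).
Hypotheses (kap0 : 0 <= kap) (Wsol : bsol lam L theta tau kap U W).
Hypotheses (DU : D `<=` U) (cD : compact D) (cW : {within D, continuous W}).

(** This replaces a second derivative bound at contact points. About [2 * s] away from [x'] in the
    direction [y' - y] there is a point [z] where [W] exceeds the first paraboloid by at most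
    [16 * C * s ^+ 2]. The second paraboloid touches at [x'] and is below [W] at [z], and the first
    is below [W] at [x']; adding these inequalities leaves the scalar product of [z - x'] and
    [y' - y]. *)
Lemma contact_lipschitz a x y x' y' s : 0 < a -> 0 < s ->
  contact D W a x y -> contact D W a x' y' -> `[x - x'] <= s ->
  cball x' (6 * s) `<=` D ->
  let C := barC lam L 4^-1 * (kap + a) in
  8 * C * barA lam L 4^-1 * s + a * (`[x' - y] + 6 * s) <= theta ->
  W x + a / 2 * dot (x - y) (x - y) + 16 * C * s ^+ 2 <= tau ->
  a * `[y' - y] <= 16 * C * s.
Proof.
move=> a0 s0 [Dx hx] [Dx' hx'] xx' KD C hth htau.
have C0 : 0 < C by rewrite /C mulr_gt0 ?barC_gt0// ?invr_gt0//; have := kap0; lra.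
have [->|yy] := eqVneq (y' - y) 0.
  by rewrite eucl_norm0 mulr0 mulr_ge0 ?ltW// mulr_gt0.
set d := `[y' - y]; have d0 : 0 < d.
  rewrite lt_def eucl_norm_ge0 andbT; apply: contra_neq yy; exact: eucl_norm_eq0.
pose e := d^-1 *: (y' - y).
have e1 : `[e] = 1 by rewrite eucl_normZ gtr0_norm ?invr_gt0// mulVf ?gt_eqF.
have ew : dot e (y' - y) = d.
  by rewrite dotZl -sqr_eucl_norm expr2 mulrA mulVf ?mul1r// gt_eqF.
pose z1 := x' + (2 * s) *: e.
have z1x' : `[z1 - x'] = 2 * s.
  by rewrite /z1 addrC addKr eucl_normZ e1 mulr1 gtr0_norm// mulr_gt0.
have KD1 : cball z1 (4 * s) `<=` D.
  by apply: subset_trans KD; apply: cball_sub; rewrite z1x'; lra.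
have q0 : 0 < 4^-1 :> R by rewrite invr_gt0.
(* The radius [4 * s] captures [x], at most [3 * s] from [z1], and the ratio [4^-1] puts [z] within
   [s] of [z1], so that [z - x'] has a component at least [s] along [e]. *)
have [| | | | | |z zz1 hz] := @barrier_contact _ _ lam L L0 lam0 theta tau kap U W 4^-1 (4 * s) z1 a y
  (W x + a / 2 * dot (x - y) (x - y)) x Wsol q0 (ltac:(lra)) a0 kap0 (subset_trans KD1 DU).
- exact: continuous_subspaceW KD1 cW.
- by move=> z /KD1 /hx; lra.
- lra.
- have := eucl_dist_triangle x' x z1; rewrite (eucl_normB x' z1) z1x'; lra.
- apply: le_trans hth; have := eucl_dist_triangle x' z1 y; rewrite z1x' -/C => h.
  have := ler_wpM2l (ltW a0) h; lra.
- by apply: le_trans htau; rewrite -/C exprMn; lra.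
have {}zz1 : `[z - z1] <= s by lra.
have Dz : D z by apply: KD1; rewrite /cball/=; lra.
have h1 := hx' z Dz; have h2 := hx x' Dx'; rewrite -/C in hz.
have h3 : a * dot (z - x') (y' - y) <= 16 * C * s ^+ 2.
  have : dot (x' - y') (x' - y') - dot (x' - y) (x' - y) + dot (z - y) (z - y)
     - dot (z - y') (z - y') = 2 * dot (z - x') (y' - y).
    rewrite !dotE (dotC y' x') (dotC y x') (dotC y z) (dotC y' z); ring.
  by move=> /(congr1 (fun t => a / 2 * t)); rewrite exprMn in hz; lra.
have h4 : s * d <= dot (z - x') (y' - y).
  have -> : z - x' = (z - z1) + (2 * s) *: e by rewrite /z1 opprD addrA subrK.
  rewrite dotDl dotZl ew; have := dot_le_norm (- (z - z1)) (y' - y).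
  by rewrite dotNl eucl_normN -/d; nra.
have : s * (a * d) <= s * (16 * C * s) by nra.
by rewrite ler_pM2l.
Qed.

(** The height coefficient of the barrier on a ball of radius [2 * m * s] when [kap] is replaced by
    [a]; the ratio [(32 * m)^-1] brings the low point within [s / 16] of the center. *)
Definition dblC m := 8 * m ^+ 2 * barC lam L (32 * m)^-1.

Lemma dblC_gt0 m : 0 < m -> 0 < dblC m.
Proof.
move=> m0; have t0 : 0 < (32 * m)^-1 by rewrite invr_gt0 mulr_gt0.
have b0 := barC_gt0 L0 lam0 t0; rewrite /dblC; apply: mulr_gt0 b0.
by apply: mulr_gt0 => //; exact: exprn_gt0.
Qed.

(** One contact near [xc] yields a contact for every [y] close to [xc]. A barrier finds a point [x2]
    near [xc] that is low over the old paraboloid. Adding a steeper paraboloid of vertex [y] gives a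
    paraboloid again, with a barycenter as vertex; its contact point competes with [x2] and, as the
    old paraboloid stays below [W], must be close to [y]. *)
Lemma contact_doubling m a x1 y1 xc s y : 1 <= m -> 0 < a -> 0 < s -> kap <= a ->
  contact D W a x1 y1 -> `[x1 - xc] <= m * s -> cball xc (4 * m * s) `<=` D ->
  let C2 := dblC m in
  C2 * barA lam L (32 * m)^-1 * a * s + a * (`[xc - y1] + 4 * m * s) <= theta ->
  W x1 + a / 2 * dot (x1 - y1) (x1 - y1) + C2 * a * s ^+ 2 <= tau ->
  `[y - xc] <= s / 16 ->
  let a2 := 512 * C2 * a in
  exists2 x, contact D W (a + a2) x ((a + a2)^-1 *: (a *: y1 + a2 *: y)) &
    `[x - y] < s / 4 /\ W x <= W x1 + a / 2 * dot (x1 - y1) (x1 - y1) + 5 * C2 * a * s ^+ 2.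
Proof.
move=> m1 a0 s0 ka [Dx1 hx1] x1c KD C2 hth htau yc a2.
have m0 : 0 < m by lra.
have ms : s <= m * s by rewrite ler_peMl// ltW.
have ma : a <= m * a by rewrite ler_peMl// ltW.
have C20 : 0 < C2 := dblC_gt0 m0.
have t0 : 0 < (32 * m)^-1 by rewrite invr_gt0; lra.
set t := (32 * m)^-1 in hth t0 *.
have rho0 : 0 < 2 * m * s by rewrite !mulr_gt0.
set k := W x1 + a / 2 * dot (x1 - y1) (x1 - y1) in htau *.
have KD1 : cball xc (2 * m * s) `<=` D.
  by apply: subset_trans KD; apply: cball_sub; rewrite subrr eucl_norm0; lra.
pose C := barC lam L t * (kap + a).
have Cle : C * (2 * m * s) ^+ 2 <= C2 * a * s ^+ 2.
  have -> : C2 * a * s ^+ 2 = (barC lam L t * (a + a)) * (2 * m * s) ^+ 2.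
    by rewrite /C2 /dblC -/t; ring.
  rewrite ler_wpM2r ?sqr_ge0// ler_wpM2l// ?lerD2r//.
  by rewrite ltW// barC_gt0.
have A0 := barA_gt0 L0 lam0 t0.
have Cle2 : 2 * C * barA lam L t * (2 * m * s) <= C2 * barA lam L t * a * s.
  have b0 := barC_gt0 L0 lam0 t0.
  have -> : C2 * barA lam L t * a * s = (4 * m * s * barA lam L t) * (barC lam L t * (2 * m * a)).
    by rewrite /C2 /dblC -/t; ring.
  have -> : 2 * C * barA lam L t * (2 * m * s) = (4 * m * s * barA lam L t) * C by ring.
  apply: ler_wpM2l; first by apply: mulr_ge0 (ltW A0); lra.
  by rewrite /C; apply: ler_wpM2l; [exact: ltW|lra].
have [| | | | | |x2 x2c hx2] := @barrier_contact _ _ lam L L0 lam0 theta tau kap U W t (2 * m * s) xc a y1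
  k x1 Wsol t0 rho0 a0 kap0 (subset_trans KD1 DU).
- exact: continuous_subspaceW KD1 cW.
- by move=> z /KD1 /hx1; rewrite -/k; lra.
- by rewrite /k; lra.
- lra.
- apply: le_trans hth; rewrite -/C; have : 0 < a * (2 * m * s) by rewrite mulr_gt0.
  lra.
- by apply: le_trans htau; rewrite -/C lerD2l.
have {}x2c : `[x2 - xc] <= s / 16.
  apply: le_trans x2c _; rewrite le_eqVlt; apply/orP; left; apply/eqP.
  by rewrite /t; field; rewrite gt_eqF.
have Dx2 : D x2 by apply: KD; rewrite /cball/=; lra.
have {}hx2 : W x2 + a / 2 * dot (x2 - y1) (x2 - y1) <= k + C2 * a * s ^+ 2.
  by move: hx2; rewrite -/C; lra.
have a20 : 0 < a2 by have := mulr_gt0 C20 a0; rewrite /a2; lra.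
set Y := _ *: _.
pose K0 := a * a2 / (2 * (a + a2)) * dot (y1 - y) (y1 - y).
have hY z : (a + a2) / 2 * dot (z - Y) (z - Y) =
    a / 2 * dot (z - y1) (z - y1) + a2 / 2 * dot (z - y) (z - y) - K0.
  rewrite /Y /K0 !dotE (dotC y1 z) (dotC y z) (dotC y y1); field.
  by rewrite gt_eqF// addr_gt0.
have [x [Dx hx]] := contact_exists (a + a2) Y cD Dx2 cW.
(* Origin of 512: [x2] is within [s / 8] of [y], so the steep paraboloid costs at most
   [4 * C2 * a * s ^+ 2] there. Then [a2 / 2 * |x - y|^2 <= 5 * C2 * a * s ^+ 2], that is
   [|x - y|^2 <= 5 / 256 * s ^+ 2], less than [(s / 4) ^+ 2]. *)
have hmin : W x + a / 2 * dot (x - y1) (x - y1) + a2 / 2 * dot (x - y) (x - y) <= k + 5 * C2 * a * s ^+ 2.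
  have := hx _ Dx2; rewrite !hY.
  have : dot (x2 - y) (x2 - y) <= (s / 8) ^+ 2.
    rewrite -eucl_norm_le; last lra.
    have := eucl_dist_triangle xc x2 y; rewrite (eucl_normB xc y); lra.
  move=> /(ler_wpM2l (ltW a20)); rewrite {2}/a2; lra.
exists x; first by split.
have h1 := hx1 x Dx; rewrite -/k in h1.
have q0 := dot_ge0 (x - y); have q1 := dot_ge0 (x - y1).
have aq0 := mulr_ge0 (ltW a20) q0; have aq1 := mulr_ge0 (ltW a0) q1.
split; last by lra.
rewrite eucl_norm_lt; last lra.
have h2 : a2 / 2 * dot (x - y) (x - y) <= 5 * C2 * a * s ^+ 2 by lra.
have C2a : 0 < C2 * a by rewrite mulr_gt0.
have : (C2 * a) * (256 * dot (x - y) (x - y)) <= (C2 * a) * (5 * s ^+ 2).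
  by move: h2; rewrite /a2; lra.
rewrite ler_pM2l// => h3; have : 0 < s ^+ 2 by rewrite exprn_gt0.
by rewrite expr_div_n; lra.
Qed.

End Estimates.

End Contact.

(** * Counting dyadic cells *)

Section Counting.
Local Close Scope classical_set_scope.
Local Open Scope set_scope.
Local Open Scope nat_scope.

Lemma modn_close_inj b x y : x <= y + b -> y <= x + b -> x %% b.+1 = y %% b.+1 -> x = y.
Proof.
wlog le : x y / x <= y.
  move=> W h1 h2 em; have [/W->//|/ltnW /W W'] := leqP x y.
  by apply/esym/W'.
move=> _ h2 em; have : y = x %[mod b.+1] by [].
move/eqP; rewrite eqn_mod_dvd// => /dvdnP[[|t]]; first lia.
by rewrite mulSn; lia.
Qed.

(** Coordinates within one fibre differ pairwise by at most [b], so their residues modulo [b.+1]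
    separate the elements, without locating the fibre. *)
Lemma card_le_fibers (n m b : nat) (J : finType) (Q : {set {ffun 'I_n -> 'I_m}})
    (T : {ffun 'I_n -> 'I_m} -> J) :
  (forall i i', i \in Q -> i' \in Q -> T i = T i' -> forall l, i l <= i' l + b) ->
  #|Q| <= #|T @: Q| * b.+1 ^ n.
Proof.
move=> h.
pose f (i : {ffun 'I_n -> 'I_m}) := (T i, [ffun l => inord (i l %% b.+1)] : {ffun 'I_n -> 'I_b.+1}).
have finj : {in Q &, injective f}.
  move=> i i' iQ i'Q [eT /ffunP ef]; apply/ffunP => l; apply/val_inj => /=.
  have := ef l; rewrite !ffunE => /(congr1 val) /=; rewrite !inordK ?ltn_mod// => em.
  exact: modn_close_inj (h i i' iQ i'Q eT l) (h i' i i'Q iQ (esym eT) l) em.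
have := card_in_imset finj => <-.
have : f @: Q \subset finset.setX (T @: Q) [set: {ffun 'I_n -> 'I_b.+1}].
  by apply/fintype.subsetP => _ /imsetP[i iQ ->]; rewrite !inE andbT /= finset.imset_f.
move=> /fintype.subset_leq_card; rewrite cardsX cardsT card_ffun !card_ord.
by [].
Qed.

Section Cubes.
Variables (I J : finType) (lab : nat -> I -> J).
Hypotheses (lab0 : injective (lab 0))
  (labS : forall j i i', lab j i = lab j i' -> lab j.+1 i = lab j.+1 i').

Definition cube j i : {set I} := [set i' | lab j i' == lab j i].

Lemma card_partition (P A : {set I}) j : 
  (forall i i', i \in P -> lab j i = lab j i' -> i' \in P) ->
  #|P :&: A| = \sum_(c : J) (if [pick i in P | lab j i == c] is Some i then #|cube j i :&: A| else 0).
Proof.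
move=> satP; rewrite -sum1_card (partition_big (lab j) predT)//=.
apply: eq_bigr => c _; case: pickP => [i /andP[iP /eqP ic]|hno].
  rewrite -sum1_card; apply: eq_bigl => i'; rewrite !inE ic.
  have [e|] := eqVneq (lab j i') c; last by rewrite ?andbF ?andFb.
  by rewrite andbT (satP i i' iP) ?andTb// e.
rewrite big_pred0// => i; rewrite !inE; have := hno i => /=.
by case: (i \in P); case: (i \in A); case: (lab j i == c).
Qed.

Lemma sum_over_cubes (P E E' : {set I}) j a b :
  (forall i i', i \in P -> lab j i = lab j i' -> i' \in P) ->
  (forall i, i \in P -> a * #|cube j i :\: E'| <= b * #|cube j i :\: E|) ->
  a * #|P :\: E'| <= b * #|P :\: E|.
Proof.
move=> satP h; rewrite !finset.setDE !(card_partition _ satP) !big_distrr /=.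
apply: leq_sum => c _; case: pickP => [i /andP[iP _]|_]; last by rewrite !muln0.
by rewrite -!finset.setDE; exact: h.
Qed.

Variables (M j0 : nat) (E E' : {set I}).
Hypothesis j0_gt0 : 0 < j0.
Hypothesis dense : forall j i, j < j0 ->
  (exists2 i', i' \in E & lab j.+1 i' = lab j.+1 i) -> #|cube j i| <= M * #|cube j i :&: E'|.

(** A Calderon-Zygmund decomposition by induction on the level, without stopping cubes. In a cube
    meeting [E], subcubes meeting [E] are covered by induction; a subcube missing [E] has a parent
    that is hit, so [dense] applies. At level 0 density forces the cell itself into [E']. *)
Lemma cube_measure_decay j i : j <= j0 -> (exists2 i', i' \in E & lab j i' = lab j i) ->
  M * #|cube j i :\: E'| <= M.-1 * #|cube j i :\: E|.
Proof.
have unhit i' k : k < j0 -> (exists2 i1, i1 \in E & lab k.+1 i1 = lab k.+1 i') ->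
    M * #|cube k i' :\: E'| <= M.-1 * #|cube k i'|.
  move=> kj /(dense kj); rewrite -(cardsID E' (cube k i')) => h.
  have : #|cube k i'| = #|cube k i' :&: E'| + #|cube k i' :\: E'| by rewrite cardsID.
  case: (M) h => [|m]; lia.
elim: j i => [|j IH] i jj [i' i'E e].
  have ii : i' = i by exact: lab0 e.
  have c1 : cube 0 i = [set i].
    by apply/setP => i1; rewrite !inE; apply/eqP/eqP => [/lab0|->].
  have h := dense j0_gt0 (ex_intro2 _ _ i' i'E (labS e)).
  have : i \in E'.
    apply: contraT => iE; move: h; rewrite c1 cards1.
    have -> : [set i] :&: E' = finset.set0.
      by apply/setP => i1; rewrite !inE; case: eqP => // ->; rewrite (negPf iE).
    by rewrite cards0 muln0.
  rewrite c1 => iE; have -> : [set i] :\: E' = finset.set0.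
    by apply/setP => i1; rewrite !inE; case: eqP => [->|]; rewrite ?iE ?andbF.
  by rewrite cards0 muln0.
apply: (@sum_over_cubes (cube j.+1 i) E E' j).
  by move=> i1 i2; rewrite !inE => /eqP <- /labS ->.
move=> i1; rewrite inE => /eqP e1.
have [/existsP[i2 /andP[i2E /eqP e2]]|hno] := boolP [exists i2, (i2 \in E) && (lab j i2 == lab j i1)].
- by apply: IH; [exact: ltnW|exists i2].
- have -> : cube j i1 :\: E = cube j i1.
    apply/setP => i2; rewrite !inE; case: eqP => [e2|]; rewrite ?andbF// andbT.
    by apply: contra hno => i2E; apply/existsP; exists i2; rewrite i2E e2 eqxx.
  by apply: unhit => //; exists i' => //; rewrite e.
Qed.

(** The second conclusion restores the hypothesis for [E'], so that the decay can be iterated. *)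
Lemma measure_decay : (forall i, exists2 i', i' \in E & lab j0 i' = lab j0 i) ->
  M * #|~: E'| <= M.-1 * #|~: E| /\ (forall i, exists2 i', i' \in E' & lab j0 i' = lab j0 i).
Proof.
move=> hit; split.
  rewrite -[~: E']finset.setTD -[~: E]finset.setTD; apply: (sum_over_cubes (j := j0)) => [//|i _].
  exact: cube_measure_decay.
move=> i; have [i' i'E e] := hit i.
have jj : j0.-1 < j0 by rewrite prednK.
have := @dense j0.-1 i jj; rewrite prednK// => /(_ (hit i)).
have : 0 < #|cube j0.-1 i| by apply/card_gt0P; exists i; rewrite inE.
have [->|/set0Pn[i1]] := eqVneq (cube j0.-1 i :&: E') finset.set0; first by rewrite cards0 muln0; lia.
rewrite !inE => /andP[/eqP e1 i1E] _ _; exists i1 => //.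
by rewrite -(prednK j0_gt0); exact: labS.
Qed.

End Cubes.

(** Bernoulli's inequality for [(1 + 1 / m) ^ N], cleared of denominators. *)
Lemma pow_ratio m N : (m + N) * m ^ N <= m * m.+1 ^ N.
Proof.
elim: N => [|N IH]; first by rewrite addn0 !expn0.
have := leq_mul IH (leqnn m.+1); rewrite -[X in _ <= X]mulnA -expnSr; apply: leq_trans.
have h : (m + N.+1) * m <= (m + N) * m.+1 by nia.
by rewrite expnS mulnA [X in _ <= X]mulnAC leq_mul.
Qed.

Lemma pow_ratio_small M a : 0 < M -> exists N, a * M.-1 ^ N < M ^ N.
Proof.
case: M => [//|[|m]] _ /=; first by exists 1; rewrite exp0n ?muln0 ?exp1n.
exists (a * m.+2); have := pow_ratio m.+1 (a * m.+2).
set p := m.+1 ^ _; set q := m.+2 ^ _ => h.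
have p0 : 0 < p by rewrite expn_gt0.
have : m.+1 * (a * p) < m.+1 * q by apply: leq_trans h; nia.
by rewrite ltn_pmul2l.
Qed.

Section Stages.
Variables (I J : finType) (lab : nat -> I -> J).
Hypotheses (lab0 : injective (lab 0))
  (labS : forall j i i', lab j i = lab j i' -> lab j.+1 i = lab j.+1 i').
Variables (M j0 N a : nat) (E : nat -> {set I}) (A : {set I}).
Hypothesis j0_gt0 : 0 < j0.
Hypothesis dense : forall s j i, s < N -> j < j0 ->
  (exists2 i', i' \in E s & lab j.+1 i' = lab j.+1 i) ->
  #|cube lab j i| <= M * #|cube lab j i :&: E s.+1|.
Hypothesis hit0 : forall i, exists2 i', i' \in E 0 & lab j0 i' = lab j0 i.
Hypotheses (hN : a * M.-1 ^ N < M ^ N) (hA : #|I| <= a * #|A|) (I0 : 0 < #|I|).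

(** After [N] stages the complement of [E N] has proportion at most [(M.-1 / M) ^ N], less than
    [1 / a], and cannot contain [A]. *)
Lemma stages_meet : exists2 i, i \in A & i \in E N.
Proof.
have H s : s <= N -> M ^ s * #|~: E s| <= M.-1 ^ s * #|I| /\
    (forall i, exists2 i', i' \in E s & lab j0 i' = lab j0 i).
  elim: s => [|s IH] sN; first by split => //; rewrite !mul1n max_card.
  have [h1 h2] := IH (ltnW sN).
  have [h3 h4] := measure_decay lab0 labS j0_gt0 (fun j i => @dense s j i sN) h2.
  split => //; rewrite !expnS -mulnA mulnCA.
  apply: leq_trans (leq_mul (leqnn (M ^ s)) h3) _.
  by rewrite mulnCA -mulnA leq_mul2l h1 orbT.
have [h _] := H N (leqnn N).
apply: contrapT => hno.
have sub : A \subset ~: E N.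
  by apply/fintype.subsetP => i iA; rewrite inE; apply/negP => iE; apply: hno; exists i.
have A0 : 0 < #|A| by move: hA I0; case: #|A| => //; lia.
have h1 : M ^ N * #|A| <= M.-1 ^ N * (a * #|A|).
  apply: leq_trans (leq_mul (leqnn _) (fintype.subset_leq_card sub)) _; apply: leq_trans h _.
  by rewrite leq_mul2l hA orbT.
move: h1; rewrite mulnA leq_pmul2r// => h1.
by move: hN; rewrite mulnC ltnNge h1.
Qed.

End Stages.

End Counting.

(** * The dyadic grid *)

Section Grid.
Context {R : realType}.
Variables (n k : nat) (h : R).
Hypothesis h0 : 0 < h.

Definition grid := {ffun 'I_n -> 'I_(2 ^ k)}.
Implicit Types (i : grid) (x : 'rV[R]_n) (l : 'I_n) (j : nat).

Lemma grid_label_proof j i l : (i l %/ 2 ^ j < 2 ^ k)%N.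
Proof. exact: leq_ltn_trans (leq_div _ _) (ltn_ord _). Qed.

(* The dyadic cube of level j containing the cell i, by its lower corner in
   units of 2 ^ j cells. *)
Definition grid_label j i : grid := [ffun l => Ordinal (grid_label_proof j i l)].

Definition side j : R := (2 ^ j)%:R * h.

Definition cube_center j i : 'rV[R]_n :=
  \row_l (((i l %/ 2 ^ j)%:R + 2^-1) * side j - side k / 2).

(** Cells are half open and tile a cube centered at 0; the shift by [side k / 2] moves its lower
    corner to the origin. *)
Definition in_cell x i :=
  forall l, (i l)%:R * h <= x ord0 l + side k / 2 /\ x ord0 l + side k / 2 < ((i l)%:R + 1) * h.

Lemma side_gt0 j : 0 < side j.
Proof. by rewrite mulr_gt0// ltr0n expn_gt0. Qed.

Lemma sideS j : side j.+1 = 2 * side j.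
Proof. by rewrite /side expnS natrM mulrA. Qed.

Lemma side_le j j' : (j <= j')%N -> side j <= side j'.
Proof. by move=> jj; rewrite ler_wpM2r ?(ltW h0)// ler_nat leq_exp2l. Qed.

Lemma grid_labelP j i i' :
  grid_label j i = grid_label j i' <-> forall l, (i l %/ 2 ^ j = i' l %/ 2 ^ j)%N.
Proof.
split=> [/ffunP e l|e].
  by have := e l; rewrite !ffunE => /(congr1 val).
by apply/ffunP => l; rewrite !ffunE; apply/val_inj; exact: e.
Qed.

Lemma grid_label0 : injective (grid_label 0).
Proof. by move=> i i' /grid_labelP e; apply/ffunP => l; apply/val_inj; have := e l; rewrite expn0 !divn1. Qed.

Lemma grid_label_le j j' i i' : (j <= j')%N ->
  grid_label j i = grid_label j i' -> grid_label j' i = grid_label j' i'.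
Proof.
move=> jj /grid_labelP e; apply/grid_labelP => l.
by rewrite -(subnKC jj) expnD !divnMA e.
Qed.

Lemma center_label j i i' : grid_label j i = grid_label j i' -> cube_center j i = cube_center j i'.
Proof. by move=> /grid_labelP e; apply/rowP => l; rewrite !mxE e. Qed.

Lemma cell_bounds j i l :
  (i l %/ 2 ^ j)%:R * side j <= (i l)%:R * h /\
  ((i l)%:R + 1) * h <= ((i l %/ 2 ^ j)%:R + 1) * side j.
Proof.
rewrite /side !mulrA -natrM natr1 natr1 -natrM; split; rewrite ler_wpM2r ?(ltW h0)// ler_nat.
  exact: leq_trunc_div.
by rewrite ltn_ceil// expn_gt0.
Qed.

Lemma in_cell_center j i i' x l : in_cell x i -> grid_label j i = grid_label j i' ->
  `|x ord0 l - cube_center j i' ord0 l| <= side j / 2.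
Proof.
move=> /(_ l)[x1 x2] /center_label <-; rewrite mxE.
have [] := cell_bounds j i l; move: (_ %/ _)%:R (side_gt0 j) => c s0 c1 c2.
by rewrite ler_norml; apply/andP; split; lra.
Qed.

Lemma center_center j j' i i' l : (j <= j')%N -> grid_label j' i = grid_label j' i' ->
  `|cube_center j i ord0 l - cube_center j' i' ord0 l| <= side j' / 2.
Proof.
move=> jj /center_label <-; rewrite !mxE.
have e : (i l %/ 2 ^ j %/ 2 ^ (j' - j) = i l %/ 2 ^ j')%N.
  by rewrite -divnMA -expnD subnKC.
have sE : side j' = (2 ^ (j' - j))%:R * side j by rewrite /side mulrA -natrM -expnD subnK.
have b1 : ((i l %/ 2 ^ j')%:R * (2 ^ (j' - j))%:R : R) <= (i l %/ 2 ^ j)%:R.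
  by rewrite -natrM ler_nat -e leq_trunc_div.
have b2 : ((i l %/ 2 ^ j)%:R + 1 : R) <= ((i l %/ 2 ^ j')%:R + 1) * (2 ^ (j' - j))%:R.
  by rewrite !natr1 -natrM ler_nat -e -ltn_divLR ?expn_gt0.
move: (ler_wpM2r (ltW (side_gt0 j)) b1) (ler_wpM2r (ltW (side_gt0 j)) b2) (side_gt0 j); rewrite sE.
move: (_ %/ _)%:R (_ %/ _)%:R (2 ^ _)%:R => c c' t h1 h2 h3.
by rewrite ler_norml; apply/andP; split; nra.
Qed.

Lemma center0_sub i i' l : cube_center 0 i ord0 l - cube_center 0 i' ord0 l = ((i l)%:R - (i' l)%:R) * h.
Proof. by rewrite !mxE expn0 !divn1 /side expn0 mul1r; ring. Qed.

Lemma center_top i : cube_center k i = 0.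
Proof.
apply/rowP => l; rewrite !mxE divn_small ?ltn_ord//.
by rewrite add0r mulrC subrr.
Qed.

Lemma center_bound j i l : (j <= k)%N -> `|cube_center j i ord0 l| <= side k / 2.
Proof.
move=> jk; have e : grid_label k i = grid_label k i by [].
have := @center_center j k i i l jk e.
by rewrite center_top [X in _ - X]mxE subr0.
Qed.

Lemma in_cell_exists j i x : (j <= k)%N ->
  (forall l, `|x ord0 l - cube_center j i ord0 l| < side j / 2) ->
  exists2 i', in_cell x i' & grid_label j i' = grid_label j i.
Proof.
move=> jk hx; pose c l := (i l %/ 2 ^ j)%N.
have hb l : ((c l)%:R * (2 ^ j)%:R) < (x ord0 l + side k / 2) / h < ((c l)%:R + 1) * (2 ^ j)%:R.
  have := hx l; rewrite mxE -/(c l) ltr_norml => /andP[x1 x2].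
  rewrite ltr_pdivlMr// ltr_pdivrMr// -!(mulrA _ (2 ^ j)%:R) -/(side j).
  by apply/andP; split; lra.
pose t l := Num.truncn ((x ord0 l + side k / 2) / h).
have ht l : (t l)%:R <= (x ord0 l + side k / 2) / h < (t l).+1%:R.
  apply: Num.Theory.truncn_itv.
  have /andP[/ltW b1 _] := hb l; apply: le_trans b1; exact: mulr_ge0.
have tc l : (c l * 2 ^ j <= t l < (c l).+1 * 2 ^ j)%N.
  have /andP[b1 b2] := hb l; have /andP[t1 t2] := ht l.
  apply/andP; split.
    by rewrite -ltnS -(ltr_nat R) natrM; exact: lt_trans b1 t2.
  by rewrite -(ltr_nat R) natrM -natr1; exact: le_lt_trans t1 b2.
have tk l : (t l < 2 ^ k)%N.
  have /andP[_ t2] := tc l; apply: leq_trans t2 _.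
  rewrite -[X in (_ <= 2 ^ X)%N](subnK jk) expnD leq_mul2r; apply/orP; right.
  by rewrite /c ltn_divLR ?expn_gt0// -expnD subnK.
exists [ffun l => Ordinal (tk l)].
  move=> l; rewrite ffunE /=; have /andP[t1 t2] := ht l.
  by rewrite -ler_pdivlMr// -ltr_pdivrMr// natr1.
apply/grid_labelP => l; rewrite ffunE /=; have /andP[t1 t2] := tc l.
apply/eqP; rewrite eqn_leq -ltnS ltn_divLR ?expn_gt0// t2 /=.
by rewrite leq_divRL ?expn_gt0.
Qed.

End Grid.

Section CellCount.
Context {R : realType} {n : nat}.
Implicit Types (x y c z : 'rV[R]_n) (a e s : R).

Lemma compact_unif_continuous (K : set 'rV[R]_n) (W : 'rV[R]_n -> R) :
  compact K -> {within K, continuous W} -> forall e : R, 0 < e ->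
  exists2 d : R, 0 < d & forall x y, K x -> K y -> `[x - y] < d -> `|W x - W y| < e.
Proof.
move=> cK /within_eucl_continuousP cW e e0.
have e2 : 0 < e / 2 by lra.
have := (compact_near_coveringP K).1 cK _ (0 : R)^'+
  (fun d x => forall y, K x -> K y -> `[x - y] < d -> `|W x - W y| < e).
case.
  move=> x Kx; have [d d0 hd] := cW x Kx _ e2.
  near=> x' d' => y Kx' Ky hy.
  have h1 : `[x' - x] < d / 2.
    near: x'; apply/near_euclP; exists (d / 2) => //; exact: divr_gt0.
  have h2 : d' < d / 2 by near: d'; apply: nbhs_right_lt; exact: divr_gt0.
  rewrite /= in Kx' Ky hy *; have h3 := hd x' Kx' (ltac:(lra)).
  have := eucl_dist_triangle x' y x; rewrite (eucl_normB y x') => h4.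
  have h5 := hd y Ky (ltac:(lra)).
  by move: h3 h5; rewrite !ltr_norml => /andP[? ?] /andP[? ?]; apply/andP; split; lra.
move=> d /= d0 hd; exists (d / 2); first exact: divr_gt0.
move=> x y Kx Ky hxy.
have d2 : 0 < d / 2 by exact: divr_gt0.
apply: (hd (d / 2) _ d2 x Kx y Kx Ky hxy).
by rewrite /= sub0r normrN gtr0_norm// ltr_pdivrMr// mulr_natr mulr2n ltrDl.
Unshelve. all: by end_near.
Qed.

Variables (k : nat) (h : R).
Hypothesis h0 : 0 < h.
Local Notation n1 := (n%:R + 1 : R).

Lemma norm_le_coords1 x a : 0 <= a -> (forall l, `|x ord0 l| <= a) -> `[x] <= n1 * a.
Proof.
by move=> a0 hx; apply: le_trans (norm_le_coords hx) _; rewrite ler_wpM2r// lerDl.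
Qed.

Lemma in_cell_close x x' (i : grid n k) : in_cell h x i -> in_cell h x' i -> `[x - x'] <= n1 * h.
Proof.
move=> hx hx'; apply: norm_le_coords1; first exact: ltW.
move=> l; have [x1 x2] := hx l; have [x3 x4] := hx' l.
by rewrite !mxE ler_norml; apply/andP; split; lra.
Qed.

(** A discrete substitute for the area formula. The vertices [y i] form a lattice of mesh [g * h],
    and contact points in one cell have vertices within [C * h]. Hence indices in a fibre differ by
    at most [C / g] in each coordinate, a bound independent of [h]. *)
Lemma count_cells (Q E' : {set grid n k}) (Good : 'rV[R]_n -> 'rV[R]_n -> Prop)
    (y : grid n k -> 'rV[R]_n) (g C : R) : 0 < g ->
  (forall i, i \in Q -> exists x, exists2 i', Good x (y i) & in_cell h x i' /\ i' \in E') ->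
  (forall x x' v v', Good x v -> Good x' v' -> `[x - x'] <= n1 * h -> `[v' - v] <= C * h) ->
  (forall i i' l, y i ord0 l - y i' ord0 l = g * (((i l)%:R - (i' l)%:R) * h)) ->
  (#|Q| <= #|E'| * (Num.truncn (C / g)).+1 ^ n)%N.
Proof.
move=> g0 hQ hLip hy.
have /choice[T hT] : forall i, exists i', i \in Q -> exists2 x, Good x (y i) & in_cell h x i' /\ i' \in E'.
  move=> i; have [iQ|iQ] := boolP (i \in Q); last by exists i.
  by have [x [i' gx [hx hi']]] := hQ i iQ; exists i' => _; exists x.
apply: (@leq_trans (#|(T @: Q)%SET| * (Num.truncn (C / g)).+1 ^ n)%N); last first.
  rewrite leq_mul2r; apply/orP; right; apply: fintype.subset_leq_card.
  by apply/fintype.subsetP => _ /imsetP[i iQ ->]; have [x _ []] := hT i iQ.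
apply: card_le_fibers => i i' iQ i'Q eT l.
have [x gx [hx _]] := hT i iQ; have [x' gx' [hx' _]] := hT i' i'Q.
rewrite -eT in hx'.
have := hLip _ _ _ _ gx' gx (in_cell_close hx' hx).
have := le_trans (ler_norm _) (coord_le_norm (y i - y i') l).
rewrite !mxE hy => h1 /(le_trans h1); rewrite mulrA ler_pM2r// mulrC -ler_pdivlMr//.
move=> h2; have [//|lt] := leqP (i l) (i' l + Num.truncn (C / g)).
have le : (i' l <= i l)%N by lia.
move: h2; rewrite -natrB// => h2.
have : (i l - i' l <= Num.truncn (C / g))%N.
  rewrite Num.Theory.truncn_ge_nat//; apply: le_trans h2; exact: ler0n.
by lia.
Qed.

End CellCount.

(** * Cells where the solution is large *)

Section Cells.
Context {R : realType} {n : nat}.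
Implicit Types (x y c z : 'rV[R]_n).
Variables (lam L : R).
Hypotheses (L0 : 0 < L) (lam0 : 0 < lam).
Local Notation n1 := (n%:R + 1 : R).
Local Notation Cq := (barC lam L 4^-1).
Local Notation Aq := (barA lam L 4^-1).

Ltac purge := clear - R n lam L L0 lam0.

Lemma cball_compact c (r : R) : compact (cball c r).
Proof. by apply: (@eucl_compact _ _ _ c r) => //; exact: cball_closed. Qed.

(** Paraboloids slide under [- V], with vertices in a shrunken copy of the grid near 0. The value at
    0 makes [V] large at the contact points, the bound [M] keeps these close to the vertices, and
    [count_cells] converts the number of vertices into a number of cells. *)
Lemma high_cells (kap m M : R) : 0 < m -> m <= M -> 0 <= kap ->
  let ell := (16 * n1)^-1 in let b := 128 * M / ell ^+ 2 in
  exists2 h1 : R, 0 < h1 & exists a : nat, forall (k : nat) (h : R) (V : 'rV[R]_n -> R),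
    0 < h -> h <= h1 -> side h k = ell ->
    bsol lam L (b + 1) 1 kap (cball 0 2^-1) (fun x => - V x) ->
    {within cball 0 2^-1, continuous V} ->
    (forall x, cball 0 2^-1 x -> V x <= M) -> m <= V 0 ->
    exists2 A : {set grid n k}, (#|{: grid n k}| <= a * #|A|)%N &
      forall i, i \in A -> exists2 x, in_cell h x i & cball 0 2^-1 x /\ m / 2 <= V x.
Proof.
move=> m0 mM kap0 ell b.
have n10 : 0 < n1 by rewrite ltr_wpDl.
have n11 : 1 <= n1 by rewrite lerDr.
have ell0 : 0 < ell by rewrite invr_gt0 mulr_gt0.
have n1ell : n1 * ell = 16^-1 by rewrite /ell; field; rewrite gt_eqF.
have M0 : 0 < M by lra.
have ellb : b * ell ^+ 2 = 128 * M by rewrite /b divfK// gt_eqF// exprn_gt0.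
have b0 : 0 < b by rewrite /b divr_gt0 ?exprn_gt0// mulr_gt0.
have q0 : 0 < 4^-1 :> R by rewrite invr_gt0.
have C0 := barC_gt0 L0 lam0 q0; have A0 := barA_gt0 L0 lam0 q0.
pose C := Cq * (kap + b); have CC0 : 0 < C by rewrite mulr_gt0//; lra.
(* Shrinking by [t2] yields [b * |y|^2 <= m], so at most [m / 2] of the height [V 0] is lost. *)
pose t2 := m / (8 * n1 * M).
have t20 : 0 < t2 by rewrite divr_gt0// !mulr_gt0.
have t2M : t2 * n1 * M = m / 8 by rewrite /t2; field; rewrite !gt_eqF.
(* The first term keeps balls of radius [6 * n1 * h] about contact points inside [D]; the second
   keeps the barriers within the slope budget [b + 1] and the height budget 1. *)
pose X := 24 * n1 + 16 * C * (Aq + 1) * n1.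
have X0' := mulr_gt0 (mulr_gt0 CC0 (addr_gt0 A0 (@ltr01 R))) n10.
have X1 : 24 * n1 <= X by rewrite /X; lra.
have X2 : 16 * C * (Aq + 1) * n1 <= X by rewrite /X; lra.
have X0 : 0 < X by lra.
exists X^-1; first by rewrite invr_gt0.
exists ((Num.truncn (16 * C * n1 / b / t2)).+1 ^ n)%N => k h V h0 hX hside Vsol cV VM Vm.
have hX1 : h * X <= 1 by rewrite -ler_pdivlMr// mul1r.
have nh : 24 * (n1 * h) <= 1.
  by apply: le_trans hX1; rewrite mulrA (mulrC h) ler_wpM2r// ltW.
have Ch : 16 * C * (Aq + 1) * (n1 * h) <= 1.
  by apply: le_trans hX1; rewrite mulrA (mulrC h) ler_wpM2r// ltW.
have nh0 : 0 < n1 * h by rewrite mulr_gt0.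
pose D : set 'rV[R]_n := cball 0 2^-1.
have cNV : {within D, continuous (fun x => - V x)}.
  by move=> x; exact: (continuousN (cV x)).
pose A : {set grid n k} := [set i | `[< exists2 x, in_cell h x i & D x /\ m / 2 <= V x >]]%SET.
exists A; last by move=> i; rewrite inE => /asboolP.
have D0 : D 0 by rewrite /D /cball/= subr0 eucl_norm0.
pose y (i : grid n k) : 'rV[R]_n := t2 *: cube_center h 0 i.
pose Good x v := [/\ contact D (fun x => - V x) b x v, `[x] <= 4^-1, `[v] <= 4^-1 &
  - V x + b / 2 * dot (x - v) (x - v) <= 0].
have cn (i : grid n k) : `[cube_center h 0 i] <= n1 * (ell / 2).
  apply: norm_le_coords1; first by rewrite ltW// divr_gt0.
  by move=> l; rewrite -hside; exact: center_bound.
have t2le : t2 <= 8^-1.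
  rewrite /t2 ler_pdivrMr ?mulr_gt0//.
  have : M <= n1 * M by rewrite ler_peMl// ltW.
  lra.
pose w := t2 * n1.
have w8 : w <= 8^-1 by rewrite -(ler_pM2r M0) /w t2M; move: mM; purge; lra.
have yw i : `[y i] <= w * (ell / 2).
  by rewrite /y eucl_normZ gtr0_norm// /w -mulrA ler_wpM2l// ltW.
have yn i : `[y i] <= ell / 16.
  by apply: le_trans (yw i) _; have := ler_wpM2r (ltW ell0) w8; purge; lra.
have yb i : b * dot (y i) (y i) <= m.
  rewrite -sqr_eucl_norm.
  have h2 : `[y i] ^+ 2 <= (w * (ell / 2)) ^+ 2.
    by rewrite ler_sqr ?nnegrE ?eucl_norm_ge0// (le_trans _ (yw i))// eucl_norm_ge0.
  apply: le_trans (ler_wpM2l (ltW b0) h2) _.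
  have -> : b * (w * (ell / 2)) ^+ 2 = (b * ell ^+ 2) * w ^+ 2 / 4 by field.
  have -> : b * ell ^+ 2 * w ^+ 2 / 4 = 4 * m * w.
    by rewrite ellb -[m](divfK (lt0r_neq0 (ltr0n R 8))) -t2M -/w; field.
  have := ler_wpM2l (ltW m0) w8; move: m0; purge; lra.
have := @count_cells _ n k h h0 [set: grid n k]%SET A Good y t2 (16 * C * n1 / b) t20.
rewrite cardsT mulnC; apply.
- move=> i _.
  have [x cx] := contact_exists b (y i) (@cball_compact _ _) D0 cNV.
  have [Dx hx] := cx.
  have h0x := hx 0 D0.
  rewrite sub0r dotNl dotNr opprK in h0x.
  have hyb := yb i.
  (* By the choice of [b], [b / 2 * (ell / 8) ^+ 2 = M], more than [V] can gain over [V 0]. *)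
  have xy : `[x - y i] < ell / 8.
    rewrite ltNge; apply/negP => hge.
    have : (ell / 8) ^+ 2 <= dot (x - y i) (x - y i).
      by rewrite -sqr_eucl_norm ler_sqr ?nnegrE ?eucl_norm_ge0// ltW// divr_gt0.
    move=> /(ler_wpM2l (ltW b0)); rewrite expr_div_n.
    have := VM x Dx; move: h0x hyb ellb m0 Vm; purge; lra.
  have xn : `[x] < ell / 4 by have := eucl_dist_triangle (y i) x 0; rewrite !subr0; move: xy (yn i) ell0; purge; lra.
  have ell1 : ell <= 1.
    by have : ell * 1 <= ell * n1 by [rewrite ler_wpM2l// ltW]; lra.
  have Vx : m / 2 <= V x.
    have := mulr_ge0 (ltW b0) (dot_ge0 (x - y i)); move: h0x hyb Vm; purge; lra.
  have [|i' hi' _] := @in_cell_exists _ n k h h0 k i x (leqnn k).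
    move=> l; rewrite center_top [X in _ - X]mxE subr0 hside.
    by apply: le_lt_trans (coord_le_norm x l) _; move: xn ell0; purge; lra.
  exists x, i'; last by split=> //; rewrite inE; apply/asboolP; exists x.
  split => //.
  + by move: xn ell1; purge; lra.
  + by move: (yn i) ell1; purge; lra.
  + by move: (mulr_ge0 (ltW b0) (dot_ge0 (x - y i))) h0x hyb m0 Vm; purge; lra.
- move=> x x' v v' [cx xn vn hx] [cx' xn' vn' hx'] xx'.
  have xv : `[x' - v] <= 2^-1 by have := eucl_normD x' (- v); rewrite eucl_normN; move: xn' vn; purge; lra.
  have := @contact_lipschitz _ n lam L L0 lam0 (b + 1) 1 kap D D (fun x => - V x) kap0 Vsol
    (fun x Dx => Dx) cNV b x v x' v' (n1 * h) b0 nh0 cx cx' xx'.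
  have KD : cball x' (6 * (n1 * h)) `<=` D by apply: cball_sub; rewrite subr0; move: xn' nh; purge; lra.
  rewrite -/C => /(_ KD).
  have s1 : 8 * C * Aq * (n1 * h) + b * (`[x' - v] + 6 * (n1 * h)) <= b + 1.
    have h1 : b * (`[x' - v] + 6 * (n1 * h)) <= b * 1 by rewrite ler_pM2l//; move: xv nh; purge; lra.
    have h2 := mulr_gt0 (mulr_gt0 CC0 A0) nh0.
    have h3 := mulr_gt0 CC0 nh0.
    by move: h1 h2 h3 Ch; purge; lra.
  have s2 : - V x + b / 2 * dot (x - v) (x - v) + 16 * C * (n1 * h) ^+ 2 <= 1.
    have h2 := mulr_gt0 (mulr_gt0 CC0 A0) nh0.
    have h3 := mulr_gt0 CC0 nh0.
    have : C * (n1 * h) * (n1 * h) <= C * (n1 * h) * 1 by apply: ler_wpM2l; [exact: ltW|move: nh nh0; purge; lra].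
    by rewrite expr2; move: hx h2 h3 Ch; purge; lra.
  move=> /(_ s1 s2) H.
  have -> : 16 * C * n1 / b * h = 16 * C * (n1 * h) / b by ring.
  by rewrite ler_pdivlMr// mulrC.
- by move=> i i' l; rewrite /y !mxE -mulrBr -center0_sub // /cube_center !mxE.
Qed.

End Cells.

(** * Growth of the set of low cells in one stage *)

Section StageDensity.
Context {R : realType} {n : nat}.
Implicit Types (x y c z : 'rV[R]_n).
Variables (lam L : R).
Hypotheses (L0 : 0 < L) (lam0 : 0 < lam).
Local Notation n1 := (n%:R + 1 : R).
Local Notation Cq := (barC lam L 4^-1).
Local Notation Aq := (barA lam L 4^-1).

(** A point of the parent cube is within [2 * n1] sides of a subcube from the center of that
    subcube, whence the argument [2 * n1]. *)
Definition stageC : R := dblC lam L (2 * n1).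
Definition stageA : R := barA lam L (32 * (2 * n1))^-1.

Definition stageK : R :=
  stageC * stageA + 16 * Cq * Aq * n1 + 8 * n1 + 2 * n1 ^+ 2 + 5 * stageC + 32 * Cq * n1 ^+ 2.

(** The fibre bound of [count_cells]: [32 * Cq * n1] is the Lipschitz constant from contact points
    to vertices, and the divisor is the mesh ratio of the lattice of vertices in [stage_dense]. *)
Definition stageM : nat :=
  ((Num.truncn (32 * Cq * n1 / (512 * stageC / (1 + 512 * stageC) / (8 * n1)))).+1 ^ n)%N.

Lemma nested_coord (t a b s : R) (y x c : 'rV[R]_n) l :
  (t *: (a *: y + b *: (x + s *: (c - x)))) ord0 l =
  t * (a * y ord0 l + b * (x ord0 l + s * (c ord0 l - x ord0 l))).
Proof. by rewrite !mxE. Qed.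

Lemma n1_ge1 : 1 <= n1. Proof. by rewrite lerDr. Qed.

Lemma stage_gt0 : [/\ 0 < Cq, 0 < Aq, 0 < stageC & 0 < stageA].
Proof.
have n1p := n1_ge1; have q0 : 0 < 4^-1 :> R by rewrite invr_gt0.
split; rewrite ?barC_gt0 ?barA_gt0 ?dblC_gt0 ?invr_gt0//; lra.
Qed.

(* The six terms of stageK bound the slopes and heights met in one doubling step. *)
Lemma stage_bounds (a S : R) : 0 <= a -> 0 <= S ->
  [/\ stageC * stageA * a * S + a * (6 * n1 * S) <= stageK * a * S,
      16 * Cq * Aq * n1 * a * S + a * (8 * n1 * S) <= stageK * a * S,
      (2 * n1 ^+ 2 + 5 * stageC) * a * S ^+ 2 <= stageK * a * S ^+ 2 &
      (2 * n1 ^+ 2 + 32 * Cq * n1 ^+ 2) * a * S ^+ 2 <= stageK * a * S ^+ 2].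
Proof.
move=> a0 S0; have [c1 c2 c3 c4] := stage_gt0; have n1p := n1_ge1.
have n12 : 0 <= n1 ^+ 2 by exact: sqr_ge0.
have p1 := mulr_ge0 (ltW c3) (ltW c4).
have n1p0 := le_trans ler01 n1p.
have p2 := mulr_ge0 (mulr_ge0 (ltW c1) (ltW c2)) n1p0.
have p3 : 0 <= Cq * n1 ^+ 2 by rewrite mulr_ge0// ltW.
have aS := mulr_ge0 a0 S0; have aS2 := mulr_ge0 a0 (sqr_ge0 S).
have E1 t : a * (t * n1 * S) = t * n1 * (a * S) by ring.
rewrite !E1 -!(mulrA _ a) -!mulrDl.
split; apply: ler_wpM2r => //; rewrite /stageK; lra.
Qed.

Lemma stageK_ge0 : 0 <= stageK.
Proof.
have [_ _ + _] := @stage_bounds 1 1 ler01 ler01.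
rewrite expr1n !mulr1; apply: le_trans; have [_ _ c3 _] := stage_gt0.
have := sqr_ge0 n1; lra.
Qed.

Section Density.
Variables (theta tau kap : R) (U : set 'rV[R]_n) (V : 'rV[R]_n -> R) (k j0 : nat) (h : R).
Hypotheses (kap0 : 0 <= kap) (Vsol : bsol lam L theta tau kap U V).
Hypotheses (cV : {within U, continuous V}) (h0 : 0 < h) (j0k : (j0 <= k)%N).

Local Notation S := (side h j0).

(** It depends only on the cube of level [j0] containing the cell, so the contacts in one such cube
    refer to a common domain at all stages. *)
Definition stage_ball (i : grid n k) := cball (cube_center h j0 i) (10 * n1 * S).

Definition low_cell a vb (i : grid n k) :=
  exists x y, [/\ in_cell h x i, contact (stage_ball i) V a x y,
    `[y - cube_center h j0 i] <= n1 * S & V x <= vb].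

Definition low_cells a vb : {set grid n k} := [set i | `[< low_cell a vb i >]]%SET.

Hypothesis ballU : forall i, stage_ball i `<=` U.

Ltac purge := clear - R n lam L L0 lam0 theta tau kap U V k j0 h kap0 Vsol cV h0 j0k ballU.

(** [contact_doubling] turns a single contact in the parent cube into one contact for each vertex of
    a lattice, all falling in the subcube; [contact_lipschitz] then makes them spread over a fixed
    fraction of its cells. *)
Lemma stage_dense (a vb : R) j (i : grid n k) : 0 < a -> kap <= a ->
  let a' := (1 + 512 * stageC) * a in
  stageK * a' * S <= theta -> vb + stageK * a * S ^+ 2 + stageK * a' * S ^+ 2 <= tau ->
  (j < j0)%N ->
  (exists2 i1, i1 \in low_cells a vb & grid_label j.+1 i1 = grid_label j.+1 i) ->
  (#|cube (@grid_label n k) j i| <=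
    stageM * #|cube (@grid_label n k) j i :&: low_cells a' (vb + stageK * a * S ^+ 2)%R|%SET)%N.
Proof.
move=> a0 ka a' hth htau jj [i1]; rewrite inE => /asboolP[x1 [y1 [hx1 cx1 yy1 vx1]]] e1.
have [Cq0 Aq0 C0 A0] := stage_gt0; have n1p := n1_ge1.
have ss0 := @side_gt0 R h h0.
set s := side h j; have s0 : 0 < s := ss0 j.
have sS : 2 * s <= S by rewrite /s -sideS; apply: side_le.
have jk : (j <= k)%N by apply: leq_trans j0k; exact: ltnW.
have S0 : 0 < S := ss0 j0.
have e0 : grid_label j0 i1 = grid_label j0 i by apply: grid_label_le e1.
set xc := cube_center h j i; pose zc := cube_center h j0 i; pose D := stage_ball i.
have DE i' : grid_label j0 i' = grid_label j0 i -> stage_ball i' = D.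
  by move=> e; rewrite /D /stage_ball (center_label _ e).
have zc1 : cube_center h j0 i1 = zc by exact: center_label.
rewrite (DE i1 e0) zc1 in cx1 yy1.
have s20 : 0 <= s / 2 by rewrite divr_ge0// ltW.
have S20 : 0 <= S / 2 by rewrite divr_ge0// ltW.
have x1z : `[x1 - zc] <= n1 * (S / 2).
  apply: norm_le_coords1 => // l; rewrite [X in `|X|]mxE [X in _ + X]mxE.
  exact: in_cell_center.
have x1c : `[x1 - xc] <= 2 * n1 * s.
  have -> : 2 * n1 * s = n1 * (2 * s) by ring.
  apply: norm_le_coords1 => [|l]; first lra.
  have h1 := in_cell_center h0 l hx1 (erefl (grid_label j.+1 i1)).
  have h2 := @center_center R n k h h0 j j.+1 i i1 l (leqnSn j) (esym e1).
  rewrite sideS -/s in h1 h2; rewrite [X in `|X|]mxE [X in _ + X]mxE -/xc.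
  move: h1 h2; rewrite /xc !ler_norml => /andP[H1 H2] /andP[H3 H4]; apply/andP; move: H1 H2 H3 H4; purge; split; lra.
have xcz : `[xc - zc] <= n1 * (S / 2).
  apply: norm_le_coords1 => // l; rewrite [X in `|X|]mxE [X in _ + X]mxE.
  by apply: center_center => //; exact: ltnW.
have DU : D `<=` U by exact: ballU.
have cD : compact D by exact: cball_compact.
have cVD : {within D, continuous V} by exact: continuous_subspaceW DU cV.
have VsolD : bsol lam L theta tau kap D V.
  by move=> x al be p q /DU; exact: Vsol.
have aa' : a <= a' by rewrite /a' ler_peMl ?ltW//; lra.
have a'0 : 0 < a' by lra.
have [B1 _ B3 _] := stage_bounds (ltW a0) (ltW S0).
have [_ B2 _ B4] := stage_bounds (ltW a'0) (ltW S0).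
have n0 : 0 < n1 by move: n1p; purge; lra.
have K0 := mulr_ge0 stageK_ge0 (ltW S0).
have KaS : stageK * a * S <= stageK * a' * S.
  by rewrite -!(mulrAC _ S) ler_wpM2l.
(* The mesh ratio of the vertices [Y]: the factor [(8 * n1)^-1] brings cell centers within [s / 16]
   of [xc], and the barycenter contributes [a2 / (a + a2)]. *)
pose g := 512 * stageC / (1 + 512 * stageC) / (8 * n1).
have C512 : 0 < 512 * stageC by move: C0; purge; lra.
have C513 : 0 < 1 + 512 * stageC by move: C512; purge; lra.
have n8 : 0 < 8 * n1 by move: n0; purge; lra.
have nS0 := mulr_gt0 n0 S0.
have g0 : 0 < g := divr_gt0 (divr_gt0 C512 C513) n8.
pose y (i' : grid n k) : 'rV[R]_n := xc + (8 * n1)^-1 *: (cube_center h 0 i' - xc).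
pose a2 := 512 * stageC * a.
have a2E : a + a2 = a' by rewrite /a' /a2; ring.
pose Y (i' : grid n k) : 'rV[R]_n := (a + a2)^-1 *: (a *: y1 + a2 *: y i').
pose vb' := vb + stageK * a * S ^+ 2.
pose Good x v := [/\ contact D V a' x v, `[x - zc] <= n1 * S, `[v - zc] <= n1 * S & V x <= vb'].
rewrite mulnC.
apply: (@count_cells R n k h h0 _ _ Good Y g (32 * Cq * n1) g0).
- move=> i'; rewrite inE => /eqP e'.
  have yc : `[y i' - xc] <= s / 16.
    rewrite /y addrC addKr eucl_normZ gtr0_norm ?invr_gt0//.
    have h1 : `[cube_center h 0 i' - xc] <= n1 * (s / 2).
      apply: norm_le_coords1 => // l; rewrite [X in `|X|]mxE [X in _ + X]mxE.
      exact: center_center.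
    rewrite ler_pdivrMl//; apply: le_trans h1 _; purge; lra.
  have KD : cball xc (4 * (2 * n1) * s) `<=` D.
    apply: cball_sub; apply: le_trans (lerD xcz (lexx _)) _.
    by have := ler_wpM2l (ltW n0) sS; move: nS0; purge; lra.
  have xcy : `[xc - y1] <= 2 * n1 * S.
    have := eucl_dist_triangle zc xc y1; rewrite (eucl_normB zc y1); move: xcz yy1 nS0; purge; lra.
  have as_ : a * s <= a * S by rewrite ler_pM2l//; move: sS s0; purge; lra.
  have m2 : 1 <= 2 * n1 by move: n1p; purge; lra.
  have th : dblC lam L (2 * n1) * barA lam L (32 * (2 * n1))^-1 * a * s
      + a * (`[xc - y1] + 4 * (2 * n1) * s) <= theta.
    apply: le_trans hth; apply: le_trans KaS; apply: le_trans B1; apply: lerD.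
      by rewrite -!(mulrA _ a); apply: ler_wpM2l as_; exact: mulr_ge0 (ltW C0) (ltW A0).
    rewrite ler_pM2l//; have := ler_wpM2l (ltW n0) sS; move: xcy; purge; lra.
  have x1y1 : a / 2 * dot (x1 - y1) (x1 - y1) <= 2 * n1 ^+ 2 * a * S ^+ 2.
    have h1 : `[x1 - y1] <= 2 * n1 * S.
      have := eucl_dist_triangle zc x1 y1; rewrite (eucl_normB zc y1); move: x1z yy1 nS0; purge; lra.
    rewrite eucl_norm_le in h1; last by move: nS0; purge; lra.
    have := ler_wpM2l (ltW a0) h1; purge; lra.
  have s2S : s ^+ 2 <= S ^+ 2 by rewrite ler_sqr ?nnegrE ?(ltW s0) ?(ltW S0)//; move: sS s0; purge; lra.
  have Cs : stageC * a * s ^+ 2 <= stageC * a * S ^+ 2.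
    by apply: ler_wpM2l s2S; exact: mulr_ge0 (ltW C0) (ltW a0).
  have CS0 : 0 <= stageC * a * s ^+ 2 := mulr_ge0 (mulr_ge0 (ltW C0) (ltW a0)) (sqr_ge0 s).
  have Ka'S : 0 <= stageK * a' * S ^+ 2 := mulr_ge0 (mulr_ge0 stageK_ge0 (ltW a'0)) (sqr_ge0 S).
  have ta : V x1 + a / 2 * dot (x1 - y1) (x1 - y1) + dblC lam L (2 * n1) * a * s ^+ 2 <= tau.
    by rewrite -/stageC; move: vx1 x1y1 Cs B3 CS0 Ka'S htau; purge; lra.
  have [x cx [xy Vx]] := contact_doubling L0 lam0 kap0 VsolD (fun x Dx => Dx) cD cVD m2 a0 s0 ka cx1 x1c KD th ta yc.
  rewrite -/stageC -/a2 -/(Y i') a2E in cx; rewrite -/stageC in Vx.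
  have Vxb : V x <= vb' by rewrite /vb'; move: Vx vx1 x1y1 Cs B3; purge; lra.
  have xxc : `[x - xc] < s / 2 by have := eucl_dist_triangle (y i') x xc; move: xy yc s0; purge; lra.
  have [|i2 hi2 e2] := @in_cell_exists R n k h h0 j i x jk.
    move=> l; apply: le_lt_trans xxc.
    by have := coord_le_norm (x - xc) l; rewrite [X in `|X|]mxE [X in _ + X]mxE.
  have xz : `[x - zc] <= n1 * S.
    have := eucl_dist_triangle xc x zc; have := ler_wpM2r (ltW S0) n1p; move: xxc xcz sS S0; purge; lra.
  (* The new vertex is a convex combination of points near [zc], so the confinement of vertices in
     [low_cell] is preserved. *)
  have Yz : `[Y i' - zc] <= n1 * S.
    have yz : `[y i' - zc] <= n1 * S.
      have := eucl_dist_triangle xc (y i') zc; have := ler_wpM2r (ltW S0) n1p; move: yc xcz sS s0 S0; purge; lra.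
    have -> : Y i' - zc = (a + a2)^-1 *: (a *: (y1 - zc) + a2 *: (y i' - zc)).
      rewrite !scalerBr addrACA -opprD -scalerDl scalerBr scalerA mulVf ?scale1r//.
      by rewrite a2E gt_eqF.
    rewrite a2E eucl_normZ gtr0_norm ?invr_gt0// ler_pdivrMl// -a2E mulrDl.
    have a20 : 0 < a2 by rewrite /a2; apply: mulr_gt0.
    apply: le_trans (eucl_normD _ _) _; rewrite !eucl_normZ !gtr0_norm//.
    by apply: lerD; rewrite ler_pM2l.
  have e20 : grid_label j0 i2 = grid_label j0 i by apply: grid_label_le e2; exact: ltnW.
  exists x, i2; first by split.
  split => //; rewrite !inE e2 eqxx /=; apply/asboolP; exists x, (Y i').
  by rewrite DE// (center_label _ e20).
- move=> x x' v v' [cx xz vz Vx] [cx' xz' vz' Vx'] xx'.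
  have nh : n1 * h <= n1 * S.
    rewrite ler_pM2l// /side; apply: ler_peMl; first exact: ltW.
    by rewrite ler1n expn_gt0.
  have nh0 := mulr_gt0 n0 h0.
  have KD : cball x' (6 * (n1 * h)) `<=` D by apply: cball_sub; move: xz' nh nS0; purge; lra.
  have xv' : `[x' - v] <= 2 * n1 * S.
    have := eucl_dist_triangle zc x' v; rewrite (eucl_normB zc v); move: xz' vz; purge; lra.
  have xv : `[x - v] <= 2 * n1 * S.
    have := eucl_dist_triangle zc x v; rewrite (eucl_normB zc v); move: xz vz; purge; lra.
  have CC : Cq * (kap + a') <= 2 * Cq * a'.
    by have := ler_wpM2l (ltW Cq0) (le_trans ka aa'); purge; lra.
  have th : 8 * (Cq * (kap + a')) * Aq * (n1 * h) + a' * (`[x' - v] + 6 * (n1 * h)) <= theta.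
    apply: le_trans hth; apply: le_trans B2; apply: lerD; last by rewrite ler_pM2l//; move: xv' nh; purge; lra.
    have p1 : Cq * (kap + a') * (n1 * h) <= 2 * Cq * a' * (n1 * S).
      apply: ler_pM CC nh; last exact: ltW.
      by apply: mulr_ge0 (ltW Cq0) _; apply: addr_ge0 kap0 (ltW a'0).
    have := ler_wpM2l (ltW Aq0) p1; purge; lra.
  have ta : V x + a' / 2 * dot (x - v) (x - v) + 16 * (Cq * (kap + a')) * (n1 * h) ^+ 2 <= tau.
    rewrite eucl_norm_le in xv; last by move: nS0; purge; lra.
    have p1 := ler_wpM2l (ltW a'0) xv.
    have p2 : (n1 * h) ^+ 2 <= (n1 * S) ^+ 2 by rewrite ler_sqr ?nnegrE ?(ltW nh0) ?(ltW nS0).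
    have p3 : Cq * (kap + a') * (n1 * h) ^+ 2 <= 2 * Cq * a' * (n1 * S) ^+ 2.
      apply: ler_pM CC p2; last exact: sqr_ge0.
      by apply: mulr_ge0 (ltW Cq0) _; apply: addr_ge0 kap0 (ltW a'0).
    rewrite /vb' in Vx; move: Vx p1 p3 B4 htau; purge; lra.
  have := contact_lipschitz L0 lam0 kap0 VsolD (fun x Dx => Dx) cVD a'0 nh0 cx cx' xx' KD th ta.
  move=> H; have {H} : a' * `[v' - v] <= a' * (32 * Cq * n1 * h).
    apply: le_trans H _; have := ler_wpM2r (ltW nh0) CC; purge; lra.
  by rewrite ler_pM2l.
- move=> i' i2 l; rewrite /Y /y !nested_coord -center0_sub.
  move: (cube_center h 0 i' ord0 l) (cube_center h 0 i2 ord0 l) (xc ord0 l) (y1 ord0 l) => u1 u2 u3 u4.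
  rewrite /g /a2; field.
  by move: a2E; rewrite /a2 => ->; rewrite (gt_eqF n0) (gt_eqF C513) (gt_eqF a'0).
Qed.

End Density.

End StageDensity.

(** * Interior lower bound *)

Section InteriorLowerBound.
Context {R : realType} {n : nat}.
Implicit Types (x y c z : 'rV[R]_n).
Variables (lam L : R) (phi : R -> R) (D E tau : R).
Hypotheses (L0 : 0 < L) (lam0 : 0 < lam) (D0 : 0 <= D) (E0 : 0 <= E) (tau0 : 0 < tau).
Hypothesis phi_ge0 : forall t : R, 0 <= t -> 0 <= phi t.
Hypothesis phi_mono : forall s t : R, 0 <= s -> s <= t -> phi s <= phi t.
Local Notation n1 := (n%:R + 1 : R).

Ltac purge := clear - R n lam L phi D E tau L0 lam0 D0 E0 tau0 phi_ge0 phi_mono.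

Lemma ssol_bsol (e theta t P : R) (U : set 'rV[R]_n) W :
  (forall x, U x -> W x <= t -> phi (e * W x) <= P) ->
  ssol lam L phi D e t U W -> bsol lam L theta t (D * (phi theta + P)) U W.
Proof.
move=> hP hW x al be p q Ux Wx hp al0 be0 ht.
apply: le_trans (hW x al be p q Ux Wx al0 be0 ht) _.
by apply: ler_wpM2l => //; apply: lerD; [exact: phi_mono (eucl_norm_ge0 _) hp|exact: hP].
Qed.

Lemma ssol_sub (e t : R) (U U' : set 'rV[R]_n) W : U' `<=` U ->
  ssol lam L phi D e t U W -> ssol lam L phi D e t U' W.
Proof. by move=> UU hW x al be p q /UU; exact: hW. Qed.

Lemma exists_pow2_ge (X : R) : exists j : nat, (0 < j)%N /\ X <= (2 ^ j)%:R.
Proof.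
exists (Num.truncn X).+1; split => //.
have := Num.Theory.truncnS_gt X; move=> /ltW h; apply: le_trans h _.
by rewrite ler_nat ltnW// ltn_expl.
Qed.

Lemma stageK_ge1 : 1 <= @stageK R n lam L.
Proof.
have [_ h _ _] := @stage_bounds R n lam L L0 lam0 1 1 ler01 ler01.
have [c1 c2 _ _] := @stage_gt0 R n lam L L0 lam0.
rewrite !mulr1 mul1r in h; apply: le_trans h.
have n1p := @n1_ge1 R n.
by have := mulr_ge0 (mulr_ge0 (ltW c1) (ltW c2)) (le_trans ler01 n1p); lra.
Qed.

(* Otherwise V is small somewhere in every small cube; doubling the opening N
   times makes V small on a fraction of the cells so large that it meets the
   fraction where V >= m / 2. *)
Lemma interior_lower_bound (m M : R) : 0 < m -> m <= M ->
  exists S : R, exists2 dl : R, 0 < S /\ 0 < dl & forall V : 'rV[R]_n -> R,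
    {within cball 0 2^-1, continuous V} ->
    (forall x, cball 0 2^-1 x -> 0 <= V x <= M) -> m <= V 0 ->
    ssol lam L phi D E tau (cball 0 2^-1) V ->
    (forall t, ssol lam L phi D 0 t (cball 0 2^-1) (fun x => - V x)) ->
    exists2 z, cball 0 8^-1 z & forall x, cball z S x -> dl <= V x.
Proof.
move=> m0 mM.
have n1p := @n1_ge1 R n; have n0 : 0 < n1 by lra.
pose ell := (16 * n1)^-1; pose b := 128 * M / ell ^+ 2.
have ell0 : 0 < ell by rewrite invr_gt0; lra.
have n1ell : n1 * ell = 16^-1 by rewrite /ell; field; rewrite gt_eqF.
have b0 : 0 < b by apply: divr_gt0; [lra|exact: exprn_gt0].
pose kap := D * (phi 1 + phi (E * tau)); pose kap2 := D * (phi (b + 1) + phi 0).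
have kap0 : 0 <= kap by rewrite mulr_ge0// addr_ge0// phi_ge0// mulr_ge0// ltW.
have kap20 : 0 <= kap2 by rewrite mulr_ge0// addr_ge0// phi_ge0//; lra.
have [h1 h10 [a hA]] := @high_cells R n lam L L0 lam0 kap2 m M m0 mM kap20.
have [N hN] := @pow_ratio_small (@stageM R n lam L) a (ltac:(by rewrite expn_gt0)).
have [_ _ C0 _] := @stage_gt0 R n lam L L0 lam0.
pose om := 1 + 512 * @stageC R n lam L; have om1 : 1 <= om by rewrite /om; lra.
(* The opening at stage [s]. Starting from [kap + 1] ensures [kap <= aa s], as [contact_doubling]
   requires. *)
pose aa s := om ^+ s * (kap + 1).
have aa0 s : 0 < aa s by rewrite mulr_gt0 ?exprn_gt0//; lra.
have aaS s : aa s.+1 = om * aa s by rewrite /aa exprS mulrA.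
have aaN s : (s <= N)%N -> aa s <= aa N.
  move=> sN; rewrite /aa ler_wpM2r//; [lra|].
  by rewrite -(subnK sN) exprD ler_peMl ?exprn_ege1// exprn_ge0//; lra.
pose K := @stageK R n lam L; have K1 : 1 <= K := stageK_ge1.
pose KN := (N%:R + 3) * K * aa N.
have N0 : 0 <= N%:R :> R by [].
have N3 : 0 < N%:R + 3 :> R by move: N0; purge; lra.
have KN0 : 0 < KN := mulr_gt0 (mulr_gt0 N3 (lt_le_trans ltr01 K1)) (aa0 N).
(* The cube size [S] is taken so small that [S * KN] is at most 1, [tau] and [m / 4]: these serve
   the slope budget, the height budget and the final contradiction. The term [40 * n1] keeps the
   stage balls in the ball of radius 1/2. *)
pose X := KN * (1 + tau^-1 + 4 / m) + 40 * n1.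
have [k0 [_ hk0]] := exists_pow2_ge (ell * X).
have p20 j : 0 < (2 ^ j)%:R :> R by rewrite ltr0n expn_gt0.
have [S SE] : exists S, S = ell / (2 ^ k0)%:R by exists (ell / (2 ^ k0)%:R).
have S0 : 0 < S by rewrite SE; exact: divr_gt0.
have SX : S * X <= 1 by rewrite SE mulrAC ler_pdivrMr// mul1r.
have w0 := mulr_gt0 S0 KN0.
have w1 : 0 < S * KN / tau := divr_gt0 w0 tau0.
have w2 : 0 < S * KN / m := divr_gt0 w0 m0.
have w3 := mulr_gt0 S0 n0.
have XE : S * X = S * KN + S * KN / tau + 4 * (S * KN / m) + 40 * (S * n1) by rewrite /X; ring.
have S1 : S * KN <= 1 by move: w0 w1 w2 w3 SX; rewrite XE; purge; lra.
have S2 : S * KN <= tau.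
  by rewrite -[tau]mul1r -ler_pdivrMr//; move: w0 w1 w2 w3 SX; rewrite XE; purge; lra.
have S3 : 4 * (S * KN) <= m.
  by rewrite -[m]mul1r -ler_pdivrMr// -mulrA; move: w0 w1 w2 w3 SX; rewrite XE; purge; lra.
have S4 : 40 * (S * n1) <= 1 by move: w0 w1 w2 w3 SX; rewrite XE; purge; lra.
have S5 : S <= 1 by move: S0 S4 (ler_wpM2l (ltW S0) n1p); purge; lra.
clear XE w0 w1 w2 w3 SX hk0 X.
(* If [V < dl] at a point, the paraboloid of opening [aa 0] with vertex there touches within
   [S / 8], because [V >= 0]. *)
pose dl := aa 0 / 2 * (S / 8) ^+ 2.
have dl0 : 0 < dl by apply: mulr_gt0; [exact: divr_gt0|apply: exprn_gt0; exact: divr_gt0].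
exists (S / 8), dl; first by split => //; exact: divr_gt0.
move=> V cV VM Vm Vsol VNsol; apply: contrapT => hno.
have hdense z : cball 0 8^-1 z -> exists2 x, cball z (S / 8) x & V x < dl.
  move=> hz; apply: contrapT => hno2; apply: hno; exists z => // x hx.
  by rewrite leNgt; apply/negP => hlt; apply: hno2; exists x.
pose U : set 'rV[R]_n := cball 0 2^-1.
have Vb : bsol lam L 1 tau kap U V.
  apply: ssol_bsol Vsol => x Ux Vx; apply: phi_mono; last exact: ler_wpM2l.
  by apply: mulr_ge0 => //; have /andP[] := VM x Ux.
have VNb : bsol lam L (b + 1) 1 kap2 U (fun x => - V x).
  by apply: ssol_bsol (VNsol 1) => x _ _; rewrite mul0r.
have m4 : 0 < m / 4 by apply: divr_gt0.
have [d d0 hd] := compact_unif_continuous (@cball_compact _ _ 0 2^-1) cV m4.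
(* Here the mesh begins to depend on [V]: cells are finer than [h1] and than the scale on which [V]
   varies by [m / 4]. *)
have [j0 [j00 hj0]] := exists_pow2_ge (S / h1 + (2 * n1) * S / d).
have [h hE] : exists h, h = S / (2 ^ j0)%:R by exists (S / (2 ^ j0)%:R).
have h0 : 0 < h by rewrite hE; exact: divr_gt0.
have q1 : 0 < S / h1 := divr_gt0 S0 h10.
have q2 : 0 < (2 * n1) * S / d by apply: divr_gt0 => //; apply: mulr_gt0 => //; apply: mulr_gt0.
have hh1 : h <= h1.
  by rewrite hE ler_pdivrMr// mulrC -ler_pdivrMr//; apply: le_trans hj0; rewrite lerDl ltW.
have hd1 : n1 * h < d.
  have : 2 * n1 * h <= d.
    by rewrite hE mulrA ler_pdivrMr// [X in _ <= X]mulrC -ler_pdivrMr//; apply: le_trans hj0; rewrite lerDr ltW.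
  by have := mulr_gt0 n0 h0; purge; lra.
clear q1 q2 hj0.
pose k := (k0 + j0)%N.
have sS : side h j0 = S by rewrite /side hE mulrC divfK// gt_eqF.
have sk : side h k = ell.
  rewrite /side /k expnD natrM -mulrA -/(side h j0) sS SE mulrC divfK ?gt_eqF//.
have j0k : (j0 <= k)%N by rewrite leq_addl.
have V_le x : U x -> V x <= M by move=> /VM /andP[].
have V_ge0 x : U x -> 0 <= V x by move=> /VM /andP[].
have [A cardA hA2] := hA k h V h0 hh1 sk VNb cV V_le Vm.
pose vb s := aa 0 * S ^+ 2 + K * S ^+ 2 * \sum_(i < s) aa i.
have vbS s : vb s.+1 = vb s + K * aa s * S ^+ 2 by rewrite /vb big_ord_recr /=; ring.
have KA0 : 0 <= K * aa N by apply: mulr_ge0; [exact: le_trans ler01 K1|exact: ltW].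
have S20 : 0 <= S ^+ 2 := sqr_ge0 S.
have vb_le s : (s <= N)%N -> vb s <= (N%:R + 1) * (K * aa N) * S ^+ 2.
  move=> sN; have h2 : \sum_(i < s) aa i <= N%:R * aa N.
    apply: (@le_trans _ _ (\sum_(i < s) aa N)).
      by apply: ler_sum => i _; apply: aaN; apply: leq_trans (ltnW (ltn_ord i)) sN.
    rewrite sumr_const card_ord -[leLHS]mulr_natl ler_wpM2r ?ler_nat//; exact: ltW.
  have h3 : K * S ^+ 2 * \sum_(i < s) aa i <= K * S ^+ 2 * (N%:R * aa N).
    by apply: ler_wpM2l h2; apply: mulr_ge0 => //; exact: le_trans ler01 K1.
  have h4 : aa 0 * S ^+ 2 <= K * aa N * S ^+ 2.
    apply: ler_wpM2r => //; apply: le_trans (aaN 0 (leq0n N)) _.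
    by apply: ler_peMl => //; exact: ltW.
  by rewrite /vb; move: h3 h4; purge; lra.
have zb (i : grid n k) : `[cube_center h j0 i] <= 32^-1.
  have -> : 32^-1 = n1 * (ell / 2) by rewrite mulrA n1ell; field.
  apply: norm_le_coords1; first by apply: divr_ge0 => //; exact: ltW.
  by move=> l; rewrite -sk; exact: center_bound.
have ballU (i : grid n k) : stage_ball j0 h i `<=` U.
  apply: cball_sub; rewrite subr0 sS; move: (zb i) S4; purge; lra.
pose EE s := low_cells V k j0 h (aa s) (vb s) : {set grid n k}.
have KNE : KN = (N%:R + 3) * (K * aa N) by rewrite /KN mulrA.
have SS : S ^+ 2 * KN <= S * KN by apply: ler_wpM2r; [exact: ltW|rewrite expr2 ler_piMr// ltW].
have NKA : 0 <= N%:R * (K * aa N) := mulr_ge0 N0 KA0.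
have dense s j i : (s < N)%N -> (j < j0)%N ->
  (exists2 i', i' \in EE s & grid_label j.+1 i' = grid_label j.+1 i) ->
  (#|cube (@grid_label n k) j i| <= @stageM R n lam L * #|cube (@grid_label n k) j i :&: EE s.+1|%SET)%N.
  move=> sN jj hit.
  have := @stage_dense R n lam L L0 lam0 1 tau kap U V k j0 h kap0 Vb cV h0 j0k ballU (aa s) (vb s) j i (aa0 s).
  rewrite -/om -/K -aaS sS -vbS; apply => //.
  - rewrite /aa -[leLHS]mul1r; apply: ler_pM => //; first exact: exprn_ege1.
    by rewrite lerDl.
  - apply: le_trans S1; rewrite mulrC; apply: ler_wpM2l; first exact: ltW.
    rewrite KNE; apply: (@le_trans _ _ (K * aa N)).
      by apply: ler_wpM2l; [exact: le_trans ler01 K1|exact: aaN].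
    by move: KA0 NKA; purge; lra.
  - apply: le_trans S2; apply: le_trans SS; rewrite KNE.
    have h2 := vb_le s.+1 sN.
    have h3 : K * aa s.+1 * S ^+ 2 <= K * aa N * S ^+ 2.
      by apply: ler_wpM2r => //; apply: ler_wpM2l; [exact: le_trans ler01 K1|exact: aaN].
    by move: h2 h3 (mulr_ge0 KA0 S20); purge; lra.
have hit0 i : exists2 i', i' \in EE 0 & grid_label j0 i' = grid_label j0 i.
  have [|x' hx' Vx'] := hdense (cube_center h j0 i).
    by rewrite /cball/= subr0; move: (zb i); purge; lra.
  rewrite /cball/= in hx'.
  pose DD := stage_ball j0 h i.
  have Dx' : DD x'.
    rewrite /DD /stage_ball /cball/= sS; move: S0 hx' (ler_wpM2r (ltW S0) n1p); purge; lra.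
  have cVD : {within DD, continuous V} by exact: continuous_subspaceW (ballU i) cV.
  have [x [Dx hx]] := contact_exists (aa 0) x' (@cball_compact _ _ _ _) Dx' cVD.
  have h2 := hx x' Dx'; rewrite subrr dot0r mulr0 addr0 in h2.
  have Vx0 := V_ge0 x (ballU i x Dx).
  have q0 := mulr_ge0 (ltW (aa0 0)) (dot_ge0 (x - x')).
  have xx' : `[x - x'] < S / 8.
    rewrite eucl_norm_lt; last by apply: divr_ge0 => //; exact: ltW.
    rewrite -(ltr_pM2l (divr_gt0 (aa0 0) (ltr0n _ 2))) -/dl.
    by move: h2 Vx' Vx0; purge; lra.
  have xc : `[x - cube_center h j0 i] < side h j0 / 2.
    by rewrite sS; have := eucl_dist_triangle x' x (cube_center h j0 i); move: hx' xx' S0; purge; lra.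
  have [|i2 hi2 e2] := @in_cell_exists R n k h h0 j0 i x j0k.
    move=> l; apply: le_lt_trans xc.
    by have := coord_le_norm (x - cube_center h j0 i) l; rewrite [X in `|X|]mxE [X in _ + X]mxE.
  exists i2 => //; rewrite inE; apply/asboolP; exists x, x'.
  rewrite /stage_ball (center_label _ e2); split => //.
    by rewrite sS; move: S0 hx' (ler_wpM2r (ltW S0) n1p); purge; lra.
  rewrite /vb big_ord0 mulr0 addr0.
  have := mulr_ge0 (ltW (aa0 0)) S20; move: h2 Vx' q0; rewrite /dl; purge; lra.
have I0 : (0 < #|{: grid n k}|)%N by rewrite card_ffun !card_ord expn_gt0 expn_gt0.
have [i iA iE] := stages_meet (@grid_label0 n k) (fun j i i' => @grid_label_le n k j j.+1 i i' (leqnSn j))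
  j00 dense hit0 hN cardA I0.
(* This cell contains a value at least [m / 2] and one at most [m / 4], against the modulus of
   continuity. *)
have [x hx [Ux Vx]] := hA2 i iA.
move: iE; rewrite inE => /asboolP[x' [y' [hx' [Dx' _] _ Vx']]].
have Ux' := ballU i x' Dx'.
have := hd x x' Ux Ux' (le_lt_trans (in_cell_close h0 hx hx') hd1).
have h2 := vb_le N (leqnn N); rewrite ltr_norml => /andP[_ h3].
have h4 : (N%:R + 1) * (K * aa N) * S ^+ 2 <= S ^+ 2 * KN.
  by rewrite KNE; move: (mulr_ge0 KA0 S20); purge; lra.
by move: h2 h3 h4 SS S3 Vx Vx'; purge; lra.
Qed.

End InteriorLowerBound.

(** * The drift equation *)

Section Drift.
Context {R : realType}.
Local Notation mu := (@lebesgue_measure R).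
Implicit Types (f g : R -> R) (a x y t : R).

Lemma within_continuous_dist (A : set R) f x e : {within A, continuous f} -> A x -> 0 < e ->
  exists2 d : R, 0 < d & forall y, A y -> `|y - x| < d -> `|f y - f x| < e.
Proof.
rewrite continuous_subspace_in => h Ax e0.
have E := @cvgrPdist_lt _ _ _ (@nbhs_subspace _ A x) (nbhs_filter (x : subspace A)) f (f x).
have /E/(_ e e0) := h x (mem_set Ax).
rewrite -(nbhs_subspace_in Ax) => /nbhs_ballP[d /= d0 hd].
exists d => // y Ay hy; rewrite distrC; apply: hd => //.
by rewrite /ball/= distrC.
Qed.

Lemma continuous_distP f x : 
  (forall e : R, 0 < e -> exists2 d : R, 0 < d & forall y, `|y - x| < d -> `|f y - f x| < e) ->
  {for x, continuous f}.
Proof.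
move=> h; have E := @cvgrPdist_lt _ _ _ (nbhs x) (nbhs_filter x) f (f x).
apply/E => e e0; apply/nbhs_ballP; have [d d0 hd] := h e e0.
by exists d => // y; rewrite /ball/= distrC => hy; rewrite distrC; apply: hd.
Qed.

(** Freezing the function to the left of [c] extends it continuously to the line, so that two-sided
    calculus applies at the end point. *)
Lemma clip_continuous f (c : R) : {within `[c, +oo[, continuous f} -> continuous (fun t => f (Num.max t c)).
Proof.
move=> cf x; apply: continuous_distP => e e0.
have mc t : `[c, +oo[%classic (Num.max t c) by rewrite /= in_itv/= andbT le_max lexx orbT.
have [d d0 hd] := within_continuous_dist cf (mc x) e0.
exists d => // y hy; apply: hd => //; apply: le_lt_trans hy.
have := ler_norm (y - x); have := ler_norm (- (y - x)); rewrite normrN => h1 h2.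
rewrite ler_norml; case: (leP y c) => yc; case: (leP x c) => xc; apply/andP; split; lra.
Qed.

Lemma antiderivative f a : continuous f -> exists F : R -> R,
  (forall x, a < x -> is_derive x (1 : R) F (f x)) /\
  (forall x y, a < x -> x < y -> (\int[mu]_(t in `[x, y]) (f t)%:E)%E = (F y - F x)%:E).
Proof.
move=> cf; pose F x : R := (\int[mu]_(t in [set` `[a, x]]) f t)%R.
have dF x : a < x -> is_derive x (1 : R) F (f x).
  move=> ax; have xu : x < x + 1 by rewrite ltrDl.
  have fi : mu.-integrable `[a, x + 1] (EFin \o f).
    apply: continuous_compact_integrable; first exact: segment_compact.
    exact: continuous_subspaceT.
  have [d1 d2] := @continuous_FTC1_closed _ f a x (x + 1) xu fi ax (cf x).
  exact: DeriveDef d1 (etrans (esym (derive1E F x)) d2).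
exists F; split => // x y ax xy.
have cF z : a < z -> {for z, continuous F}.
  move=> az; apply: differentiable_continuous; apply/derivable1_diffP.
  by have := dF z az => ?; apply: ex_derive.
rewrite (@continuous_FTC2 _ f F x y xy)//.
- exact: continuous_subspaceT.
- split.
  + by move=> z; rewrite in_itv/= => /andP[xz _]; have := dF z (lt_trans ax xz) => ?; apply: ex_derive.
  + by apply: cvg_at_right_filter; exact: cF.
  + by apply: cvg_at_left_filter; apply: cF; exact: lt_trans xy.
- move=> z; rewrite in_itv/= => /andP[xz _]; have := dF z (lt_trans ax xz) => ?.
  by rewrite derive1E; apply: derive_val.
Qed.

Variable phi : R -> R.
Hypothesis phi_ge0 : forall t : R, 0 <= t -> 0 <= phi t.
Hypothesis phi_incr : forall s t : R, 0 <= s -> s < t -> phi s < phi t.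
Hypothesis phi_cont : {within `[0, +oo[, continuous phi}.
Hypothesis phi_ge : forall t : R, 0 <= t -> t <= phi t.
Hypothesis phi_osgood :
  (\int[@lebesgue_measure R]_(t in `]0%R, 1%R]) ((phi t)^-1)%:E)%E = +oo%E.

Section Solution.
Variables (nu : R) (f : R -> R).
Hypothesis (nu0 : 0 < nu) (fsol : decay_solution phi nu f).

Let f0 : f 0 = nu. Proof. by case: fsol. Qed.
Let f_ge0 t : 0 <= t -> 0 <= f t. Proof. by case: fsol => _ h _ _; exact: h. Qed.
Let f_derive t : 0 < t -> is_derive t (1 : R) f (- phi (f t)).
Proof. by case: fsol => _ _ _; exact. Qed.

Let f_cont x y : 0 <= x -> {within `[x, y], continuous f}.
Proof.
move=> x0; case: fsol => _ _ cf _; apply: continuous_subspaceW cf => z /=.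
by rewrite !in_itv/= andbT => /andP[xz _]; exact: le_trans xz.
Qed.

Lemma decay_MVT s t : 0 <= s -> s < t ->
  exists2 c, s < c < t & f t - f s = - phi (f c) * (t - s).
Proof.
move=> s0 st; have [|c ci E] := @MVT _ f (fun t => - phi (f t)) s t st _ (f_cont s0).
  by move=> x; rewrite in_itv/= => /andP[sx _]; apply: f_derive; exact: le_lt_trans sx.
by exists c => //; move: ci; rewrite in_itv.
Qed.

Lemma decay_nonincreasing s t : 0 <= s -> s <= t -> f t <= f s.
Proof.
move=> s0; rewrite le_eqVlt => /orP[/eqP->//|st].
have [c /andP[sc _] E] := decay_MVT s0 st.
have c0 : 0 <= c by apply: le_trans s0 _; exact: ltW.
have : 0 <= phi (f c) * (t - s) by rewrite mulr_ge0 ?phi_ge0 ?f_ge0// subr_ge0 ltW.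
by move: E; rewrite mulNr; lra.
Qed.

(** While [f > eta] the slope is below [- eta], so the descent from [nu] takes at most the time
    [nu / eta]. *)
Lemma decay_small eta : 0 < eta -> exists2 T, 0 < T & forall t, T <= t -> f t <= eta.
Proof.
move=> eta0; have T0 : 0 < nu / eta by exact: divr_gt0.
exists (nu / eta) => // t Tt; apply: le_trans (decay_nonincreasing (ltW T0) Tt) _.
rewrite leNgt; apply/negP => h.
have [c /andP[c0 cT] E] := decay_MVT (lexx 0) T0.
have fc : eta < f c by apply: lt_le_trans h _; apply: decay_nonincreasing; exact: ltW.
have pc : eta < phi (f c) by apply: lt_le_trans fc _; apply: phi_ge; exact: f_ge0 (ltW c0).
rewrite f0 subr0 in E; have : nu / eta * eta < nu / eta * phi (f c) by rewrite ltr_pM2l.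
by rewrite divfK ?gt_eqF//; move: E h; rewrite mulNr mulrC; lra.
Qed.

(** Osgood's argument: if [f] vanished at time [t], it would run through [[y, nu]] within that time
    for every small [y > 0], which bounds the integral of [1 / phi] near 0. *)
Lemma decay_pos t : 0 <= t -> 0 < f t.
Proof.
move=> t0; rewrite lt_def f_ge0// andbT; apply/eqP => ft.
have tp : 0 < t by rewrite lt_def t0 andbT; apply: contra_eq_neq ft => ->; rewrite f0 gt_eqF.
(* Time accounts for the integral up to [nu]; if [nu < 1], the rest is at most [(phi nu)^-1] by
   monotonicity. *)
pose C := t + (phi nu)^-1.
have pp x : 0 < x -> 0 < phi x by move=> x0; apply: lt_le_trans x0 (phi_ge (ltW x0)).
have key y : 0 < y -> y < nu -> y < 1 ->
    (\int[mu]_(x in `[y, 1%R]) ((phi x)^-1)%:E <= C%:E)%E.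
  move=> y0 ynu y1; pose g x : R := (phi (Num.max x y))^-1.
  have my x : 0 < Num.max x y by rewrite lt_max y0 orbT.
  have cg : continuous g.
    move=> x; apply: (@continuousV _ _ (fun x => phi (Num.max x y)) x); first by rewrite gt_eqF// pp.
    apply: clip_continuous; apply: continuous_subspaceW phi_cont => z /=.
    by rewrite !in_itv/= !andbT; apply: le_trans; exact: ltW.
  have [F [dF intF]] := antiderivative (-1) cg.
  have cF x : -1 < x -> {for x, continuous F}.
    move=> x1; apply: differentiable_continuous; apply/derivable1_diffP.
    by have := dF x x1 => ?; apply: ex_derive.
  have MVTF p q : 0 < p -> p < q -> exists2 c, p < c & F q - F p = g c * (q - p).
    move=> p0 pq; have [||c ci E] := @MVT _ F g p q pq.
    - by move=> z; rewrite in_itv/= => /andP[pz _]; apply: dF; apply: lt_trans (ltrN10 R) (lt_trans p0 pz).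
    - apply: continuous_in_subspaceT => z /set_mem; rewrite /= in_itv/= => /andP[pz _].
      by apply: cF; apply: lt_trans (ltrN10 R) (lt_le_trans p0 pz).
    - by exists c => //; move: ci; rewrite in_itv => /andP[].
  have g_ge0 x : 0 <= g x by rewrite invr_ge0 phi_ge0// ltW.
  have [s sI fs] : exists2 s, s \in `[0, t] & f s = y.
    apply: IVT => //; first exact: f_cont.
    by rewrite f0 ft; rewrite min_r ?max_l ?(ltW nu0)// (ltW y0) (ltW ynu).
  move: sI; rewrite in_itv/= => /andP[s0 st].
  have s0' : 0 < s by rewrite lt_def s0 andbT; apply: contra_eq_neq fs => ->; rewrite f0 gt_eqF.
  have fy z : 0 <= z -> z <= s -> y <= f z by move=> z0 zs; rewrite -fs; exact: decay_nonincreasing.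
  (* Separation of variables: [F \o f] has derivative -1 up to time [s]. *)
  have Fs : F (f s) - F (f 0) = - s.
    have [||c ci E] := @MVT _ (F \o f) (fun=> -1) 0 s s0'.
    - move=> z; rewrite in_itv/= => /andP[z0 zs].
      have yz := fy z (ltW z0) (ltW zs).
      have d1 := f_derive z0.
      have d2 := dF (f z) (lt_trans (ltrN10 R) (lt_le_trans y0 yz)).
      have -> : -1 = g (f z) * - phi (f z).
        by rewrite /g max_l// mulrN mulVf// gt_eqF// pp// (lt_le_trans y0).
      exact: is_derive1_comp.
    - rewrite continuous_subspace_in => z /set_mem; rewrite /= in_itv/= => /andP[z0 zs].
      apply: (@continuous_comp (subspace `[0, s]) _ _ f F z); first exact: (f_cont (y := s) (lexx 0)).
      exact: cF (lt_trans (ltrN10 R) (lt_le_trans y0 (fy z z0 zs))).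
    - by rewrite /= E mulN1r subr0.
  rewrite (_ : (\int[mu]_(x in `[y, 1%R]) ((phi x)^-1)%:E)%E = (\int[mu]_(x in `[y, 1%R]) (g x)%:E)%E); last first.
    apply: eq_integral => x; rewrite inE/= in_itv/= => /andP[yx _]; by rewrite /g max_l.
  rewrite intF// ?(lt_trans (ltrN10 R))// lee_fin.
  rewrite fs f0 in Fs.
  have F1 : F 1 - F nu <= (phi nu)^-1.
    have pn : 0 <= (phi nu)^-1 by rewrite invr_ge0 phi_ge0// ltW.
    have [->|] := eqVneq 1 nu; first by rewrite subrr.
    rewrite neq_lt => /orP[h|h].
      have [c _ E] := MVTF 1 nu ltr01 h.
      have : 0 <= g c * (nu - 1) by rewrite mulr_ge0// subr_ge0 ltW.
      lra.
    have [c nc ->] := MVTF nu 1 nu0 h.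
    have gc : g c <= (phi nu)^-1.
      rewrite /g max_l; last by apply: ltW; exact: lt_trans nc.
      rewrite lef_pV2 ?posrE ?pp//; last exact: lt_trans nc.
      by apply: ltW; apply: phi_incr => //; exact: ltW.
    apply: le_trans (ler_wpM2l (g_ge0 c) (_ : 1 - nu <= 1)) _; last by rewrite mulr1.
    by rewrite gerBl ltW.
  rewrite /C; lra.
pose y0 := Num.min nu 1 / 2.
have y00 : 0 < y0 by rewrite divr_gt0// lt_min nu0 ltr01.
have y0nu : y0 < nu /\ y0 < 1.
  have m0 : 0 < Num.min nu 1 by rewrite lt_min nu0 ltr01.
  have : Num.min nu 1 <= nu by rewrite ge_min lexx.
  have : Num.min nu 1 <= 1 by rewrite ge_min lexx orbT.
  by rewrite /y0; split; lra.
pose yy (i : nat) := y0 / i.+1%:R.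
have yy0 i : 0 < yy i by exact: divr_gt0.
have yyl i : yy i <= y0 by rewrite /yy ler_pdivrMr// ler_peMr ?ler1n// ltW.
have yyS i j : (i <= j)%N -> yy j <= yy i.
  by move=> ij; rewrite /yy ler_pM2l// lef_pV2 ?posrE// ler_nat.
pose S i := `[yy i, 1%R]%classic.
have US : \bigcup_i S i = `]0%R, 1%R]%classic.
  apply/seteqP; split => x.
    move=> [i _]; rewrite /S/= !in_itv/= => /andP[h ->]; rewrite andbT.
    exact: lt_le_trans h.
  rewrite /= in_itv/= => /andP[x0 x1]; exists (Num.truncn (y0 / x)) => //.
  rewrite /S/= in_itv/= x1 andbT /yy ler_pdivrMr// mulrC -ler_pdivrMr//.
  exact: ltW (Num.Theory.truncnS_gt _).
have := @ge0_nondecreasing_set_cvg_integral _ (measurableTypeR R) R S (fun x => ((phi x)^-1)%:E) (@lebesgue_measure R).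
rewrite US phi_osgood => cv.
have {cv} cv : (\int[mu]_(x in S i) ((phi x)^-1)%:E)%E @[i --> \oo] --> +oo%E.
  apply: cv => //.
  - move=> i j ij; apply/subsetPset => x; rewrite /S/= !in_itv/= => /andP[h ->].
    by rewrite andbT; apply: le_trans (yyS _ _ ij) h.
  - by move=> i; exact: measurable_itv.
  - move=> i; refine ((@measurable_realfun.measurable_EFinP _ (measurableTypeR R) R (S i) (fun x => (phi x)^-1)).2 _).
    apply: (@eq_measurable_fun _ _ _ _ _ (fun x => (phi (Num.max x (yy i)))^-1)).
      by move=> x; rewrite inE /S/= in_itv/= => /andP[h _]; rewrite max_l.
    apply: measurable_funTS; apply: measurable_realfun.continuous_measurable_fun => x.
    apply: (@continuousV _ _ (fun x => phi (Num.max x (yy i))) x).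
      by rewrite gt_eqF// pp// lt_max yy0 orbT.
    apply: clip_continuous; apply: continuous_subspaceW phi_cont => z /=.
    by rewrite !in_itv/= !andbT; apply: le_trans; exact: ltW.
  - by move=> i x; rewrite /S/= in_itv/= => /andP[h _]; rewrite lee_fin invr_ge0 phi_ge0// (le_trans (ltW (yy0 i))).
have : (+oo <= C%:E)%E.
  rewrite -(cvg_lim _ cv)//; apply: lime_le; first by apply/cvg_ex; exists +oo%E.
  near=> i; apply: key => //; apply: le_lt_trans (yyl i) _; by case: y0nu.
by [].
Unshelve. all: by end_near.
Qed.

End Solution.

End Drift.

(** * Profiles of the boundary barriers *)

Section Profiles.
Context {R : realType}.
Variable phi : R -> R.
Hypothesis phi_ge0 : forall t : R, 0 <= t -> 0 <= phi t.
Hypothesis phi_incr : forall s t : R, 0 <= s -> s < t -> phi s < phi t.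
Hypothesis phi_cont : {within `[0, +oo[, continuous phi}.
Hypothesis phi_ge : forall t : R, 0 <= t -> t <= phi t.
Hypothesis phi_osgood :
  (\int[@lebesgue_measure R]_(t in `]0%R, 1%R]) ((phi t)^-1)%:E)%E = +oo%E.

Record profile (f F : R -> R) : Prop := {
  profile_gt0 : forall t : R, 0 < t -> 0 < f t;
  profile_derive : forall t : R, 0 < t -> is_derive t (1 : R) f (- phi (f t));
  profile_le : forall s t : R, 0 < s -> s <= t -> f t <= f s;
  profile_primitive : forall t : R, 0 < t -> is_derive t (1 : R) F (f t) }.

Lemma decay_profile (nu : R) f : 0 < nu -> decay_solution phi nu f ->
  exists F, [/\ profile f F, {for 0, continuous F}, (forall t : R, 0 <= t -> F t - F 0 <= nu * t) &
    forall t : R, 0 < t -> (\int[@lebesgue_measure R]_(s in `[0%R, t]) (f s)%:E)%E = (F t - F 0)%:E].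
Proof.
move=> nu0 fsol.
have [f0 _ cf fd] := fsol.
have [F [dF intF]] := antiderivative (-1) (clip_continuous cf).
have dF' (t : R) : 0 <= t -> is_derive t (1 : R) F (f t).
  by move=> t0; have := dF t (lt_le_trans (ltrN10 R) t0); rewrite max_l.
have cF (t : R) : 0 <= t -> {for t, continuous F}.
  move=> t0; apply: differentiable_continuous; apply/derivable1_diffP.
  by have := dF' t t0 => ?; apply: ex_derive.
exists F; split.
- split.
  + by move=> t t0; apply: (decay_pos phi_ge0 phi_incr phi_cont phi_ge phi_osgood nu0 fsol); exact: ltW.
  + exact: fd.
  + by move=> s t s0; apply: (decay_nonincreasing phi_ge0 fsol); exact: ltW.
  + by move=> t /ltW; exact: dF'.
- exact: cF.
- move=> t; rewrite le_eqVlt => /orP[/eqP<-|t0]; first by rewrite subrr mulr0.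
  have [||c ci ->] := @MVT _ F f 0 t t0.
  + by move=> x; rewrite in_itv/= => /andP[/ltW x0 _]; exact: dF'.
  + apply: continuous_in_subspaceT => z /set_mem; rewrite /= in_itv/= => /andP[z0 _]; exact: cF.
  + move: ci; rewrite in_itv/= => /andP[c0 _]; rewrite subr0 ler_pM2r// -f0.
    by apply: (decay_nonincreasing phi_ge0 fsol) => //; exact: ltW.
- move=> t t0; rewrite -(intF _ _ (ltrN10 R) t0).
  by apply: eq_integral => x; rewrite inE/= in_itv/= => /andP[x0 _]; rewrite max_l.
Qed.

Lemma small_profile (eta : R) : decay_blowup phi -> 0 < eta ->
  exists f F T, [/\ profile f F, 0 < T & forall t : R, T <= t -> f t <= eta].
Proof.
move=> [f fsol _] eta0; have s1 := fsol 1 ltr01.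
have [F [pF _ _ _]] := decay_profile ltr01 s1.
have [T T0 hT] := decay_small phi_ge0 phi_ge ltr01 s1 eta0.
by exists (f 1), F, T.
Qed.

(** The blow-up is available on short intervals only; one of length at most [sig] suffices, as [f]
    is positive beyond it. *)
Lemma large_profile (sig A : R) : decay_blowup phi -> 0 < sig ->
  exists nu f F, [/\ 0 < nu, profile f F, {for 0, continuous F},
    (forall t : R, 0 <= t -> F t - F 0 <= nu * t) & A <= F sig - F 0].
Proof.
move=> [f fsol hb] sig0.
have [eps [eps0 epss he]] : exists eps : R, [/\ 0 < eps, eps <= sig &
    (\int[@lebesgue_measure R]_(t in `[0%R, eps]) (f nu t)%:E)%E @[nu --> +oo] --> +oo%E].
  move: hb => /nbhs_ballP[d /= d0 hd].
  exists (Num.min sig (d / 2)); have m0 : 0 < Num.min sig (d / 2) by rewrite lt_min sig0 divr_gt0.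
  split => //; first by rewrite ge_min lexx.
  apply: hd => //; rewrite /ball/= sub0r normrN gtr0_norm// gt_min; apply/orP; right.
  by rewrite ltr_pdivrMr// mulr_natr mulr2n ltrDl.
have [nu [nu0 hnu]] : exists nu : R, 0 < nu /\
    (A%:E <= \int[@lebesgue_measure R]_(t in `[0%R, eps]) (f nu t)%:E)%E.
  have hA : \forall nu \near +oo, (A%:E <= \int[@lebesgue_measure R]_(t in `[0%R, eps]) (f nu t)%:E)%E.
    by move/cvgeyPge : he; exact.
  have h0 : \forall nu \near +oo, (0 : R) < nu by exact: nbhs_pinfty_gt.
  by have [nu [h1 h2]] := filter_ex (filterI h0 hA); exists nu.
have [F [pF cF Fnu intF]] := decay_profile nu0 (fsol nu nu0).
exists nu, (f nu), F; split => //.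
rewrite intF// lee_fin in hnu; apply: le_trans hnu _; rewrite lerD2r.
move: epss; rewrite le_eqVlt => /orP[/eqP->//|es].
have [||c ci E] := @MVT _ F (f nu) eps sig es.
- by move=> x; rewrite in_itv/= => /andP[ex _]; apply: profile_primitive pF _ _; exact: lt_trans ex.
- apply: derivable_within_continuous => z; rewrite in_itv/= => /andP[ez _].
  have := profile_primitive pF (lt_le_trans eps0 ez) => ?; exact: ex_derive.
- move: ci; rewrite in_itv/= => /andP[ec _].
  by rewrite -subr_ge0 E mulr_ge0 ?subr_ge0 ?ltW// (profile_gt0 pF)// (lt_trans eps0).
Qed.

Lemma profile_quad f F (A B a K t : R) : profile f F -> 0 < B -> 0 < K -> 0 < a + K * t ->
  exists2 d : R, 0 < d & forall s, `|s - t| < d ->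
    (A - B * F (a + K * t)) + (- (B * K * f (a + K * t))) * (s - t)
      + (B * K ^+ 2 * phi (f (a + K * t)) / 4) * (s - t) ^+ 2 <= A - B * F (a + K * s).
Proof.
move=> pF B0 K0 t0; set r := a + K * t.
have dlin (s : R) : is_derive s (1 : R) (fun s => a + K * s) K.
  by apply: is_derive_eq; rewrite /GRing.scale/=; ring.
have dG (s : R) : 0 < a + K * s -> is_derive s (1 : R) (fun s => A - B * F (a + K * s)) (- (B * K * f (a + K * s))).
  move=> s0; have d1 := profile_primitive pF s0.
  have d2 : is_derive s (1 : R) (fun s => F (a + K * s)) (f (a + K * s) * K).
    exact: (@is_derive1_comp _ F (fun s => a + K * s) s).
  by apply: is_derive_eq; rewrite /GRing.scale/=; ring.
have dg : is_derive t (1 : R) (fun s => - (B * K * f (a + K * s))) (B * K ^+ 2 * phi (f r)).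
  have d1 := profile_derive pF t0.
  have d2 : is_derive t (1 : R) (fun s => f (a + K * s)) (- phi (f r) * K).
    exact: (@is_derive1_comp _ f (fun s => a + K * s) t).
  by apply: is_derive_eq; rewrite /GRing.scale/=; ring.
have f0 := profile_gt0 pF t0.
have p0 : 0 < phi (f r) by apply: lt_le_trans f0 (phi_ge (ltW f0)).
have rK : 0 < r / K by exact: divr_gt0.
have g10 : 0 < B * K ^+ 2 * phi (f r) by apply: mulr_gt0 p0; apply: mulr_gt0 => //; exact: exprn_gt0.
have [s hs|d d0 hd] := @local_quad_bound _ (fun s => A - B * F (a + K * s))
   (fun s => - (B * K * f (a + K * s))) t _ (r / K) rK g10 _ dg.
  apply: dG; move: hs; rewrite ltr_pdivlMr// => hs.
  have : - (K * (s - t)) <= `|s - t| * K.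
    by have := ler_norm (- (s - t)); rewrite normrN -mulrN mulrC => h; rewrite ler_pM2r.
  by rewrite /r in hs; move: hs; rewrite mulrBr; lra.
by exists d.
Qed.

End Profiles.

(** * Boundary barriers *)

Section BoundaryBarriers.
Context {R : realType} {n : nat}.
Implicit Types (x y c z : 'rV[R]_n) (t : R).
Variable phi : R -> R.
Hypothesis phi_ge0 : forall t : R, 0 <= t -> 0 <= phi t.
Hypothesis phi_incr : forall s t : R, 0 <= s -> s < t -> phi s < phi t.
Hypothesis phi_cont : {within `[0, +oo[, continuous phi}.
Hypothesis phi_ge : forall t : R, 0 <= t -> t <= phi t.
Hypothesis phi_osgood :
  (\int[@lebesgue_measure R]_(t in `]0%R, 1%R]) ((phi t)^-1)%:E)%E = +oo%E.
Hypothesis phi_blowup : decay_blowup phi.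
Variables (lam L D E tau : R).
Hypotheses (L0 : 0 < L) (lam0 : 0 < lam) (D0 : 0 <= D) (E0 : 0 <= E) (tau0 : 0 < tau).

Let phi_mono (s t : R) : 0 <= s -> s <= t -> phi s <= phi t.
Proof. by move=> s0; rewrite le_eqVlt => /orP[/eqP->//|/(phi_incr s0)/ltW]. Qed.

Ltac purge := clear - R n phi phi_ge0 phi_incr phi_cont phi_ge phi_osgood phi_blowup
  lam L D E tau L0 lam0 D0 E0 tau0 phi_mono.

Lemma profile_MVT f F (s t : R) : profile phi f F -> 0 < s -> s < t ->
  exists2 c, s < c < t & F t - F s = f c * (t - s).
Proof.
move=> pF s0 st; have [||c ci Ec] := @MVT _ F f s t st.
- by move=> x; rewrite in_itv/= => /andP[sx _]; apply: profile_primitive pF _ _; exact: lt_trans sx.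
- apply: derivable_within_continuous => z; rewrite in_itv/= => /andP[sz _].
  have := profile_primitive pF (lt_le_trans s0 sz) => ?; exact: ex_derive.
- by exists c => //; move: ci; rewrite in_itv.
Qed.

(** The barrier is a decreasing function of [|x - c|^2] built from a late piece of a drift solution,
    where [f] is small. Outside the radius [rho0] its rank one term exceeds all others, each a
    multiple of [phi f]. Its slope at the sphere is controlled by [f T], positive by the Osgood
    condition. *)
Lemma hopf_lower (rho0 rho mu : R) : 0 < rho0 -> rho0 < rho -> rho <= 1 -> 0 < mu ->
  exists2 b : R, 0 < b & forall (U : set 'rV[R]_n) W c,
    ssol lam L phi D E tau U W -> {within cball c rho, continuous W} ->
    (forall x, `[x - c] < rho -> U x) ->
    (forall x, cball c rho x -> 0 <= W x) ->
    (forall x, cball c rho0 x -> mu <= W x) ->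
    forall x, cball c rho x -> b * (rho ^+ 2 - dot (x - c) (x - c)) <= W x.
Proof.
move=> r00 r0r r1 mu0.
have E2 : 0 < 2 + E by apply: ltr_wpDr.
(* [be] is the ratio of the barrier's derivative to [f]: [2 * be <= 1] bounds its slope by [f], and
   [E * be <= 1] bounds the value term by [f]. *)
have [be beD] : exists be, be = (2 + E)^-1 by exists (2 + E)^-1.
have be0 : 0 < be by rewrite beD invr_gt0.
have bE : be * (2 + E) = 1 by rewrite beD mulVf// gt_eqF.
have be2 : 2 * be <= 1 by move: bE (mulr_ge0 (ltW be0) E0); rewrite mulrDr; purge; lra.
have beE : E * be <= 1 by move: bE be0; rewrite mulrDr; purge; lra.
have lb0 : 0 < lam * be * rho0 ^+ 2 by apply: mulr_gt0; [exact: mulr_gt0|exact: exprn_gt0].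
have DL : 0 < 2 * D + L + 1 by apply: ltr_wpDl => //; apply: addr_ge0; [exact: mulr_ge0|exact: ltW].
(* In [2 * D + L + 1], [2 * D] beats the two [phi] terms, [L] the first-order term, and 1 gives
   strictness. *)
have [K KD] : exists K, K = (2 * D + L + 1) / (lam * be * rho0 ^+ 2) by eexists.
have K0 : 0 < K by rewrite KD; exact: divr_gt0.
have KE : lam * be * rho0 ^+ 2 * K = 2 * D + L + 1 by rewrite KD mulrC divfK// gt_eqF.
(* The barrier stays below [mu], so no contact occurs in the inner ball, and below [tau], so
   contacts may be tested. *)
pose eta := Num.min mu tau; have eta0 : 0 < eta by rewrite lt_min mu0.
have [f [F [a [pF a0 fa]]]] := small_profile phi_ge0 phi_incr phi_cont phi_ge phi_osgood phi_blowup eta0.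
have rho_gt0 := lt_trans r00 r0r.
have rho2 : 0 < rho ^+ 2 by exact: exprn_gt0.
have rho21 : rho ^+ 2 <= 1 by rewrite expr_le1// ltW.
pose T := a + K * rho ^+ 2.
have aT : a < T by rewrite /T ltrDl mulr_gt0.
have [B BD] : exists B, B = be / K by eexists.
have B0 : 0 < B by rewrite BD; exact: divr_gt0.
have BK : B * K = be by rewrite BD divfK// gt_eqF.
pose G t := B * F T - B * F (a + K * t).
have pos t : 0 <= t -> 0 < a + K * t.
  by move=> t0; apply: lt_le_trans a0 _; rewrite lerDl mulr_ge0// ltW.
have GE t : 0 <= t -> t < rho ^+ 2 -> exists2 c, a + K * t < c < T & G t = be * f c * (rho ^+ 2 - t).
  move=> t0 tr; have sT : a + K * t < T by rewrite /T ltrD2l ltr_pM2l.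
  have [c ci Ec] := profile_MVT pF (pos t t0) sT; exists c => //.
  by rewrite /G -mulrBr Ec -BK /T; ring.
have G_rho : G (rho ^+ 2) = 0 by rewrite /G subrr.
have G_hi t : 0 <= t -> t < rho ^+ 2 -> G t <= be * f (a + K * t).
  move=> t0 tr; have [c /andP[c1 c2] ->] := GE t t0 tr.
  have h1 : f c <= f (a + K * t) by apply: (profile_le pF (pos t t0)); exact: ltW.
  have h2 : rho ^+ 2 - t <= 1 by apply: le_trans rho21; rewrite gerBl.
  have h3 : 0 < f c by apply: (profile_gt0 pF); apply: lt_trans c1; exact: pos.
  rewrite -mulrA ler_pM2l//; apply: le_trans h1.
  by rewrite ler_piMr// ltW.
have G_eta t : 0 <= t -> t < rho ^+ 2 -> G t <= eta.
  move=> t0 tr; apply: le_trans (G_hi t t0 tr) _.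
  have h1 : f (a + K * t) <= eta by apply: fa; rewrite lerDl mulr_ge0// ltW.
  have := ltW (profile_gt0 pF (pos t t0)); have be1 : be <= 1 by move: be2 be0; purge; lra.
  by move=> h2; apply: le_trans h1; rewrite ler_piMl//.
exists (be * f T); first by apply: mulr_gt0 => //; apply: (profile_gt0 pF); exact: lt_trans aT.
move=> U W c Wsol cW hU W0 Wmu.
suff key x : cball c rho x -> G (dot (x - c) (x - c)) <= W x.
  move=> x Kx; have := Kx; rewrite /cball/= le_eqVlt => /orP[/eqP hr|hr].
    by rewrite -sqr_eucl_norm hr subrr mulr0; exact: W0.
  apply: le_trans (key x Kx).
  have tr : dot (x - c) (x - c) < rho ^+ 2 by rewrite -eucl_norm_lt// ltW.
  have [d /andP[d1 d2] ->] := GE _ (dot_ge0 _) tr.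
  rewrite ler_pM2r ?subr_gt0// ler_pM2l//; apply: (profile_le pF); last exact: ltW.
  by apply: lt_trans d1; exact: pos (dot_ge0 _).
move=> Kx; rewrite leNgt; apply/negP => hlt.
have radE z : radial 0 0 c G z = G (dot (z - c) (z - c)) by rewrite /radial mul0r oppr0 mul0r add0r.
have lin s : 0 < a + K * s -> {for s, continuous G}.
  move=> s0; apply: differentiable_continuous; apply/derivable1_diffP.
  have d1 := profile_primitive pF s0.
  have dlin : is_derive s (1 : R) (fun s => a + K * s) K.
    by apply: is_derive_eq; rewrite /GRing.scale/=; ring.
  have d2 : is_derive s (1 : R) (fun s => F (a + K * s)) (f (a + K * s) * K).
    exact: (@is_derive1_comp _ F (fun s => a + K * s) s).
  by rewrite /G; apply: ex_derive.
have [|||||z [Kz Wz] zmin] := @negative_min_touch _ _ (cball c rho) W (radial 0 0 c G).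
- exact: cball_compact.
- exact: cW.
- by move=> z _; apply: radial_continuous; apply: lin; exact: pos (dot_ge0 _).
- by exists x => //; rewrite radE.
- move=> z Kz; rewrite radE => Wz; have zr : `[z - c] < rho.
    rewrite lt_neqAle Kz andbT; apply/eqP => h; move: Wz; rewrite -sqr_eucl_norm h G_rho.
    by rewrite ltNge W0.
  exists (rho - `[z - c]); first by rewrite subr_gt0.
  by move=> z' hz'; rewrite /cball/=; move: (eucl_dist_triangle z z' c) hz'; purge; lra.
rewrite radE in Wz.
set t := dot (z - c) (z - c) in Wz zmin.
have t0 : 0 <= t := dot_ge0 _.
have zr : `[z - c] < rho.
  rewrite lt_neqAle Kz andbT; apply/eqP => h; move: Wz; rewrite /t -sqr_eucl_norm h G_rho.
  by rewrite ltNge W0.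
have tr : t < rho ^+ 2 by rewrite /t -eucl_norm_lt// ltW.
have tlo : rho0 ^+ 2 <= t.
  rewrite /t leNgt -eucl_norm_lt ?ltW//; apply/negP => h.
  have := Wmu z (ltW h); rewrite leNgt => /negP; apply; apply: lt_le_trans Wz _.
  by apply: le_trans (G_eta t t0 tr) _; rewrite ge_min lexx.
set fr := f (a + K * t).
have fr0 : 0 < fr := profile_gt0 pF (pos t t0).
have pf : fr <= phi fr := phi_ge (ltW fr0).
have hG := @profile_quad R phi phi_ge f F (B * F T) B a K t pF B0 K0 (pos t t0).
rewrite -/fr BK in hG.
have H := @radial_ineq _ _ lam L W (ltW L0) 0 0 c G (- (be * fr)) (B * K ^+ 2 * phi fr / 4) z (D * (phi fr + phi fr)).
have BKK : B * K ^+ 2 = be * K by rewrite expr2 mulrA BK.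
have {H} : L * (2 * - (be * fr) - 0) + lam * (4 * (B * K ^+ 2 * phi fr / 4) * t) <= D * (phi fr + phi fr).
  apply: H => //.
  - rewrite BKK; apply: divr_ge0 => //; apply: mulr_ge0; last exact: le_trans (ltW fr0) pf.
    by apply: mulr_ge0; exact: ltW.
  - by rewrite oppr_le0 mulr_ge0// ltW.
  move=> al bb al0 bb0 ht.
  have Wt : W z <= tau.
    by apply: le_trans (ltW Wz) _; apply: le_trans (G_eta t t0 tr) _; rewrite ge_min lexx orbT.
  apply: le_trans (Wsol z al bb _ _ (hU z zr) Wt al0 bb0 ht) _.
  apply: ler_wpM2l => //; apply: lerD; apply: phi_mono.
  - exact: eucl_norm_ge0.
  - rewrite scale0r subr0 eucl_normZ mulrN normrN gtr0_norm; last by rewrite !mulr_gt0.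
    have zn1 : `[z - c] <= 1 by apply: le_trans r1; exact: ltW.
    have h1 : 2 * (be * fr) <= fr by rewrite mulrA ler_piMl// ltW.
    apply: le_trans h1; rewrite ler_piMr// mulr_ge0//; apply: mulr_ge0; exact: ltW.
  - by apply: mulr_ge0 => //; apply: W0.
  - have h1 : E * W z <= E * (be * fr).
      by apply: ler_wpM2l => //; apply: le_trans (ltW Wz) _; exact: G_hi.
    by apply: le_trans h1 _; rewrite mulrA ler_piMl// ltW.
have -> : lam * (4 * (B * K ^+ 2 * phi fr / 4) * t) = lam * be * K * phi fr * t.
  by rewrite BKK; field.
have p0 : 0 < phi fr by exact: lt_le_trans fr0 pf.
have h1 : (2 * D + L + 1) * phi fr <= lam * be * K * phi fr * t.
  rewrite -KE.
  have := ler_wpM2l (ltW (mulr_gt0 (mulr_gt0 (mulr_gt0 lam0 be0) K0) p0)) tlo.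
  by purge; lra.
have h2 : L * (2 * (be * fr)) <= L * phi fr.
  by rewrite ler_pM2l//; apply: le_trans pf; rewrite mulrA ler_piMl ?(ltW fr0).
by move: h1 h2 p0; purge; lra.
Qed.

(** A barrier under [- V] on a shell around the exterior unit ball. The blow-up makes it fall below
    [- M] at [|x - c|^2 = 2], while the finite initial slope [nu] yields the linear bound. *)
Lemma upper_barrier (M : R) :
  exists2 C : R, 0 < C & forall (K U : set 'rV[R]_n) V c,
    (forall t, ssol lam L phi D 0 t U (fun x => - V x)) -> compact K -> {within K, continuous V} ->
    (forall x, K x -> 1 <= dot (x - c) (x - c) <= 2 /\ V x <= M) ->
    (forall x, K x -> [\/ V x <= 0, dot (x - c) (x - c) = 2 |
        [/\ U x, 1 < dot (x - c) (x - c) & exists2 e : R, 0 < e & forall y, `[y - x] < e -> K y]]) ->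
    forall x, K x -> V x <= C * (dot (x - c) (x - c) - 1).
Proof.
have [K KD] : exists K, K = 4 * (2 * D + L + 1) / lam by eexists.
have DL : 0 < 2 * D + L + 1 by apply: ltr_wpDl => //; apply: addr_ge0; [exact: mulr_ge0|exact: ltW].
have K0 : 0 < K by rewrite KD; apply: divr_gt0 => //; exact: mulr_gt0.
have KE : lam * K = 4 * (2 * D + L + 1) by rewrite KD mulrC divfK// gt_eqF.
have [nu [f [F [nu0 pF cF Fnu FM]]]] :=
  large_profile phi_ge0 phi_incr phi_cont phi_ge phi_osgood (4 * K * M) phi_blowup K0.
(* With [B * K = 4^-1] and radius at most 2, the slope of the barrier is at most [f]. *)
have [B BD] : exists B, B = (4 * K)^-1 by eexists.
have B0 : 0 < B by rewrite BD invr_gt0 mulr_gt0.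
have BK : B * K = 4^-1 by rewrite BD; field; rewrite gt_eqF.
exists (nu / 4); first exact: divr_gt0.
move=> KK U V c Vsol cK cV hK hint x Kx.
pose G t := B * F 0 - B * F (- K + K * t).
have argE t : - K + K * t = K * (t - 1) by ring.
have G_lo t : 1 <= t -> - (nu / 4 * (t - 1)) <= G t.
  move=> t1; have t0 : 0 <= K * (t - 1) by rewrite mulr_ge0 ?subr_ge0// ltW.
  rewrite /G argE; have := ler_wpM2l (ltW B0) (Fnu _ t0).
  have -> : B * (nu * (K * (t - 1))) = (B * K) * nu * (t - 1) by ring.
  by rewrite BK; purge; lra.
suff key : G (dot (x - c) (x - c)) <= - V x.
  by have [/andP[x1 _] _] := hK x Kx; move: (G_lo _ x1) key; purge; lra.
have F_mono s : 0 <= s -> F 0 <= F s.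
  rewrite le_eqVlt => /orP[/eqP<-//|s0].
  have [||d di Ed] := @MVT _ F f 0 s s0.
  - by move=> y; rewrite in_itv/= => /andP[y0 _]; exact: profile_primitive pF _ _.
  - apply: continuous_in_subspaceT => y /set_mem; rewrite /= in_itv/= => /andP[+ _].
    rewrite le_eqVlt => /orP[/eqP<-//|y0].
    apply: differentiable_continuous; apply/derivable1_diffP.
    by have := profile_primitive pF y0 => ?; apply: ex_derive.
  - move: di; rewrite in_itv/= => /andP[d0 _].
    by rewrite -subr_ge0 Ed subr0 mulr_ge0 ?ltW// (profile_gt0 pF).
have G_neg t : 1 <= t -> G t <= 0.
  move=> t1; rewrite /G argE -mulrBr mulr_ge0_le0 ?(ltW B0)// subr_le0; apply: F_mono.
  by rewrite mulr_ge0 ?subr_ge0// ltW.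
have G2 : G 2 <= - M.
  rewrite /G argE (_ : K * (2 - 1) = K); last by ring.
  have h := ler_wpM2l (ltW B0) FM.
  have e : B * (4 * K * M) = M by rewrite BD; field; rewrite gt_eqF.
  by rewrite e in h; move: h; purge; lra.
rewrite leNgt; apply/negP => hlt.
have radE z : radial 0 0 c G z = G (dot (z - c) (z - c)) by rewrite /radial mul0r oppr0 mul0r add0r.
have Gc s : 1 <= s -> {for s, continuous G}.
  move=> s1.
  have cF' : {for - K + K * s, continuous F}.
    rewrite argE; have : 0 <= K * (s - 1) by rewrite mulr_ge0 ?subr_ge0// ltW.
    rewrite le_eqVlt => /orP[/eqP<-//|y0].
    apply: differentiable_continuous; apply/derivable1_diffP.
    by have := profile_primitive pF y0 => ?; apply: ex_derive.
  have cl : {for s, continuous (fun s => - K + K * s)}.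
    apply: differentiable_continuous; apply/derivable1_diffP.
    have dlin : is_derive s (1 : R) (fun s => - K + K * s) K.
      by apply: is_derive_eq; rewrite /GRing.scale/=; ring.
    exact: ex_derive.
  have c1 : {for s, continuous (fun s => F (- K + K * s))}.
    exact: (@continuous_comp _ _ _ (fun s => - K + K * s) F s cl cF').
  apply: (@continuousB _ _ _ (fun=> B * F 0) (fun s => B * F (- K + K * s)) s).
    exact: cst_continuous.
  by apply: (@continuousM _ _ (fun=> B) _ s) => //; exact: cst_continuous.
have cNV : {within KK, continuous (fun x => - V x)}.
  by move=> y; exact: (continuousN (cV y)).
have classify z : KK z -> - V z < G (dot (z - c) (z - c)) ->
    [/\ U z, 1 < dot (z - c) (z - c) & exists2 e : R, 0 < e & forall y, `[y - z] < e -> KK y].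
  move=> Kz Vz; have [/andP[z1 z2] zM] := hK z Kz.
  have [h|h|//] := hint z Kz.
    by move: (G_neg _ z1) Vz h; purge; lra.
  by rewrite h in Vz; move: G2 Vz zM; purge; lra.
have [|||||z [Kz Vz] zmin] := @negative_min_touch _ _ KK (fun x => - V x) (radial 0 0 c G).
- exact: cK.
- exact: cNV.
- by move=> z Kz; apply: radial_continuous; apply: Gc; have [/andP[]] := hK z Kz.
- by exists x => //; rewrite radE.
- by move=> z Kz; rewrite radE => /(classify z Kz) [].
rewrite radE in Vz.
have [Uz t1 _] := classify z Kz Vz.
have [/andP[_ t2] _] := hK z Kz.
set t := dot (z - c) (z - c) in Vz zmin t1 t2.
have pos : 0 < - K + K * t by rewrite argE mulr_gt0// subr_gt0.
set fr := f (- K + K * t).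
have fr0 : 0 < fr := profile_gt0 pF pos.
have pf : fr <= phi fr := phi_ge (ltW fr0).
have hG := @profile_quad R phi phi_ge f F (B * F 0) B (- K) K t pF B0 K0 pos.
rewrite -/fr BK in hG.
have H := @radial_ineq _ _ lam L (fun x => - V x) (ltW L0) 0 0 c G (- (4^-1 * fr)) (B * K ^+ 2 * phi fr / 4) z (D * (phi fr + phi fr)).
have BKK : B * K ^+ 2 = K / 4 by rewrite expr2 mulrA BK mulrC.
have {H} : L * (2 * - (4^-1 * fr) - 0) + lam * (4 * (B * K ^+ 2 * phi fr / 4) * t) <= D * (phi fr + phi fr).
  apply: H => //.
  - rewrite BKK; apply: divr_ge0 => //; apply: mulr_ge0; last exact: le_trans (ltW fr0) pf.
    by apply: divr_ge0 => //; exact: ltW.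
  - by rewrite oppr_le0; apply: mulr_ge0 => //; exact: ltW.
  move=> al bb al0 bb0 ht.
  apply: le_trans (Vsol (- V z) z al bb _ _ Uz (lexx _) al0 bb0 ht) _.
  apply: ler_wpM2l => //; apply: lerD; apply: phi_mono => //.
  - exact: eucl_norm_ge0.
  - rewrite scale0r subr0 eucl_normZ mulrN normrN.
    have q0 : 0 < 2 * (4^-1 * fr) by move: fr0; purge; lra.
    rewrite (gtr0_norm q0).
    have zn : `[z - c] <= 2.
      rewrite eucl_norm_le//; apply: le_trans t2 _; rewrite expr2; purge; lra.
    by apply: le_trans (ler_wpM2l (ltW q0) zn) _; purge; lra.
  - by rewrite mul0r.
  - by rewrite mul0r ltW.
have -> : lam * (4 * (B * K ^+ 2 * phi fr / 4) * t) = lam * K / 4 * phi fr * t.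
  by rewrite BKK; field.
have p0 : 0 < phi fr by exact: lt_le_trans fr0 pf.
rewrite KE.
have h1 : (2 * D + L + 1) * phi fr <= 4 * (2 * D + L + 1) / 4 * phi fr * t.
  have := ler_wpM2l (ltW (mulr_gt0 DL p0)) (ltW t1); purge; lra.
have h2 : L * fr <= L * phi fr by rewrite ler_pM2l.
by move: h1 h2 p0 (mulr_gt0 L0 p0); purge; lra.
Qed.

End BoundaryBarriers.

(** * Tangent balls *)

Section Geometry.
Context {R : realType} {n : nat}.
Implicit Types (x y c z w p q N : 'rV[R]_n) (O : set 'rV[R]_n).

Lemma bdry_open O w : open O -> bdry O w <-> closure O w /\ ~ O w.
Proof. by move=> oO; rewrite /bdry (interior_id O).1. Qed.

Lemma bdry_closed O : open O -> closed (bdry O).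
Proof.
move=> oO; have -> : bdry O = closure O `&` ~` O.
  by apply/seteqP; split => x /bdry_open; [move=> /(_ oO)|move=> h; apply/h].
apply: closedI; [exact: closed_closure|exact: open_closedC].
Qed.

Lemma bdry_ball_norm c (r : R) w : bdry (eucl_ball c r) w -> `[w - c] = r.
Proof.
move=> /(bdry_open _ (@eucl_ball_open _ _ c r))[cw /negP].
rewrite -leNgt => rw; apply/eqP; rewrite eq_le rw andbT leNgt; apply/negP => h.
have e0 : 0 < `[w - c] - r by rewrite subr_gt0.
have [y] := (closure_euclP _ _).1 cw _ e0; rewrite /eucl_ball/= => yc yw.
by have := eucl_dist_triangle y w c; rewrite (eucl_normB w y); lra.
Qed.

Lemma segment_meets_bdry O x y : open O -> O x -> ~ O y ->
  exists2 z, bdry O z & `[x - z] <= `[x - y].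
Proof.
move=> oO Ox Oy; apply: contrapT => hno.
pose g (t : R) : 'rV[R]_n := x + t *: (y - x).
have gn t : 0 <= t <= 1 -> `[x - g t] <= `[x - y].
  move=> /andP[t0 t1]; rewrite /g opprD addrA subrr add0r eucl_normN eucl_normZ ger0_norm//.
  by rewrite (eucl_normB y x) ler_piMl ?eucl_norm_ge0.
have cg : continuous g.
  have cs : continuous (fun t : R => t *: (y - x)) by exact: scalel_continuous.
  by move=> t; apply: (@continuousD _ _ _ (fun=> x) _ t); [exact: cst_continuous|exact: cs].
have gO t : 0 <= t <= 1 -> closure O (g t) -> O (g t).
  move=> t01 ct; apply: contrapT => nO; apply: hno; exists (g t); last exact: gn.
  by apply/bdry_open.
have B0 : (`[0, 1] `&` g @^-1` O) 0.
  by split; rewrite /= ?in_itv/= ?lexx ?ler01// /g scale0r addr0.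
have BE : `[0, 1] `&` g @^-1` O = `[0, 1]%classic.
  apply: (@segment_connected R 0 1 _ (ex_intro _ _ B0)).
- by exists (g @^-1` O) => //; apply: open_comp => // t _; exact: cg.
- exists (g @^-1` closure O).
    by apply: closed_comp; [move=> t _; exact: cg|exact: closed_closure].
  apply/seteqP; split => t [/= t01 h]; split => //=; first exact: subset_closure.
  by apply: gO => //; move: t01; rewrite in_itv.
have : (`[0, 1] `&` g @^-1` O) 1 by rewrite BE /= in_itv/= ler01 lexx.
by move=> [_]; rewrite /= /g scale1r addrC subrK.
Qed.

(** Disjointness gives [|p - q| >= d + rho], the equality case of the triangle inequality through
    [w], so the two radii are aligned. *)
Lemma tangent_balls p q w (d rho : R) : 0 < d -> 0 < rho -> `[p - w] = d -> `[w - q] = rho ->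
  (forall z, `[z - p] < d -> `[z - q] < rho -> False) ->
  p - w = (d / rho) *: (w - q).
Proof.
move=> d0 rho0 pw wq hd.
have s0 : 0 < d + rho by exact: addr_gt0.
have pq : d + rho <= `[p - q].
  rewrite leNgt; apply/negP => h.
  apply: (hd (p + (d / (d + rho)) *: (q - p))).
    rewrite addrC addKr eucl_normZ gtr0_norm ?divr_gt0// (eucl_normB q p).
    by rewrite mulrAC ltr_pdivrMr// ltr_pM2l.
  have -> : p + (d / (d + rho)) *: (q - p) - q = (rho / (d + rho)) *: (p - q).
    have -> : p + (d / (d + rho)) *: (q - p) - q = (p - q) - (d / (d + rho)) *: (p - q).
      by rewrite addrAC -(opprB q p) scalerN opprK.
    rewrite -[X in X - _]scale1r -scalerBl; congr (_ *: _); field.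
    by rewrite gt_eqF.
  by rewrite eucl_normZ gtr0_norm ?divr_gt0// mulrAC ltr_pdivrMr// ltr_pM2l.
apply/eqP; rewrite -subr_eq0; apply/eqP; apply: dot_eq0; apply/eqP.
rewrite eq_le dot_ge0 andbT.
have dd : dot (p - w) (p - w) = d ^+ 2 by rewrite -sqr_eucl_norm pw.
have rr : dot (w - q) (w - q) = rho ^+ 2 by rewrite -sqr_eucl_norm wq.
have pE : p - q = (p - w) + (w - q) by rewrite addrA subrK.
have : (d + rho) ^+ 2 <= dot (p - q) (p - q).
  by rewrite -sqr_eucl_norm ler_sqr ?nnegrE ?eucl_norm_ge0// ltW.
move: pE dd rr => ->; move: (p - w) (w - q) => a b dd rr; rewrite !dotE (dotC b a) dd rr => h.
have ab : d * rho <= dot a b by lra.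
rewrite [leLHS](_ : _ = 2 * (d / rho) * (d * rho - dot a b)); last by field; rewrite gt_eqF.
have dr : 0 <= 2 * (d / rho) by rewrite mulr_ge0// ltW// divr_gt0.
by rewrite mulr_ge0_le0// subr_le0.
Qed.

Lemma nearest_bdry O x w : open O -> O x -> bdry O w ->
  exists w', [/\ bdry O w', `[x - w'] <= `[x - w] & forall z, bdry O z -> `[x - w'] <= `[x - z]].
Proof.
move=> oO Ox bw; pose A := bdry O `&` cball x `[x - w].
have cA : compact A.
  apply: (@eucl_compact _ _ _ x `[x - w]); last by move=> z [].
  by apply: closedI; [exact: bdry_closed|exact: cball_closed].
have Aw : A w by split => //; rewrite /cball/= eucl_normB.
have [|w' [bw' w'x] hw'] := @eucl_EVT_min _ _ A (fun z => `[z - x]) (ex_intro _ _ Aw) cA.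
  by apply: continuous_subspaceT; exact: eucl_norm_continuous.
have w'w : `[x - w'] <= `[x - w] by rewrite eucl_normB.
exists w'; split => // z bz; have [h|/ltW h] := leP `[z - x] `[x - w].
  by rewrite (eucl_normB x w') (eucl_normB x z); apply: hw'.
by apply: le_trans w'w _; rewrite (eucl_normB x z).
Qed.

End Geometry.

(** * Linear bounds near the boundary *)

Section TwoSidedBound.
Context {R : realType} {n : nat}.
Implicit Types (x y c z w p q N : 'rV[R]_n) (O : set 'rV[R]_n).
Variable phi : R -> R.
Hypothesis phi_ge0 : forall t : R, 0 <= t -> 0 <= phi t.
Hypothesis phi_incr : forall s t : R, 0 <= s -> s < t -> phi s < phi t.
Hypothesis phi_cont : {within `[0, +oo[, continuous phi}.
Hypothesis phi_ge : forall t : R, 0 <= t -> t <= phi t.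
Hypothesis phi_osgood :
  (\int[@lebesgue_measure R]_(t in `]0%R, 1%R]) ((phi t)^-1)%:E)%E = +oo%E.
Hypothesis phi_blowup : decay_blowup phi.

Section UnitBall.
Variables (lam L D E tau : R).
Hypotheses (L0 : 0 < L) (lam0 : 0 < lam) (D0 : 0 <= D) (E0 : 0 <= E) (tau0 : 0 < tau).

(** The interior estimate controls a small ball whose center [z] is not prescribed. A first Hopf
    barrier about [z] reaches the ball of radius 1/2 about 0, from which a second one reaches the
    unit sphere. The factor 3/8 is [(7 / 8) ^+ 2 - (5 / 8) ^+ 2]. *)
Lemma unit_ball_lower (m M : R) : 0 < m -> 0 < M ->
  exists2 b : R, 0 < b & forall V : 'rV[R]_n -> R,
    {within cball 0 1, continuous V} -> (forall x, cball 0 1 x -> 0 <= V x <= M) -> m <= V 0 ->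
    ssol lam L phi D E tau (eucl_ball 0 1) V ->
    (forall t, ssol lam L phi D 0 t (eucl_ball 0 1) (fun x => - V x)) ->
    forall x, cball 0 1 x -> b * (1 - dot x x) <= V x.
Proof.
move=> m0 M0.
have phi_mono (s t : R) : 0 <= s -> s <= t -> phi s <= phi t.
  by move=> s0; rewrite le_eqVlt => /orP[/eqP->//|/(phi_incr s0)/ltW].
have mM : m <= M + m by rewrite lerDr ltW.
have [S [dl [S0 dl0] hKS]] := @interior_lower_bound R n lam L phi D E tau L0 lam0 D0 E0 tau0 phi_ge0 phi_mono m (M + m) m0 mM.
have r00 : 0 < Num.min S 8^-1 by rewrite lt_min S0 /= invr_gt0 ltr0n.
have r01 : Num.min S 8^-1 < 7 / 8 by rewrite gt_min; apply/orP; right; lra.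
have r78 : 7 / 8 <= 1 :> R by lra.
have [b1 b10 hb1] := @hopf_lower R n phi phi_ge0 phi_incr phi_cont phi_ge phi_osgood phi_blowup
  lam L D E tau L0 lam0 D0 E0 tau0 _ (7 / 8) dl r00 r01 r78 dl0.
have mu0 : 0 < b1 * (3 / 8) by apply: mulr_gt0 => //; lra.
have h2 : 0 < 2^-1 :> R by lra.
have h21 : 2^-1 < 1 :> R by lra.
have [b2 b20 hb2] := @hopf_lower R n phi phi_ge0 phi_incr phi_cont phi_ge phi_osgood phi_blowup
  lam L D E tau L0 lam0 D0 E0 tau0 2^-1 1 (b1 * (3 / 8)) h2 h21 (lexx 1) mu0.
exists b2 => // V cV V01 Vm Vsol VNsol.
have sub_half : cball 0 2^-1 `<=` eucl_ball (0 : 'rV[R]_n) 1.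
  by move=> x; rewrite /cball/eucl_ball/=; lra.
have sub_one (r : R) c : `[c] + r <= 1 -> cball c r `<=` cball (0 : 'rV[R]_n) 1.
  by move=> h; apply: cball_sub; rewrite subr0.
have sub1 : cball 0 2^-1 `<=` cball (0 : 'rV[R]_n) 1 by apply: sub_one; rewrite eucl_norm0; lra.
have [z z8 hz] : exists2 z, cball 0 8^-1 z & forall x, cball z S x -> dl <= V x.
  apply: hKS => //.
  - exact: continuous_subspaceW sub1 cV.
  - by move=> x /sub1 /V01 /andP[-> h]; apply: le_trans h _; rewrite lerDl ltW.
  - exact: ssol_sub sub_half Vsol.
  - by move=> t; exact: ssol_sub sub_half (VNsol t).
rewrite /cball/= subr0 in z8.
have sub2 : cball z (7 / 8) `<=` cball 0 1 by apply: sub_one; lra.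
have h1 x : cball 0 2^-1 x -> b1 * (3 / 8) <= V x.
  rewrite /cball/= subr0 => hx.
  have xz : `[x - z] <= 5 / 8 by have := eucl_normD x (- z); rewrite eucl_normN; lra.
  apply: le_trans (_ : b1 * ((7 / 8) ^+ 2 - dot (x - z) (x - z)) <= _).
    rewrite ler_pM2l//; move: xz; rewrite eucl_norm_le; last lra.
    by rewrite !expr2; lra.
  apply: (hb1 (eucl_ball 0 1) V z Vsol).
  - exact: continuous_subspaceW sub2 cV.
  - by move=> y hy; rewrite /eucl_ball/= subr0; have := eucl_normD (y - z) z; rewrite subrK; lra.
  - by move=> y /sub2 /V01 /andP[].
  - by move=> y hy; apply: hz; apply: le_trans hy _; rewrite ge_min lexx.
  - by rewrite /cball/=; lra.
move=> x Kx; have := hb2 (eucl_ball 0 1) V 0 Vsol cV _ _ h1 x Kx.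
rewrite subr0 expr1n; apply; first by move=> y; rewrite /eucl_ball.
by move=> y /V01 /andP[].
Qed.

End UnitBall.

(** Both the ball about [x] through its nearest point [w] and the interior ball avoid the exterior
    ball and touch it at [w], so [tangent_balls] puts their centers on one normal. *)
Lemma ball_condition_normal O (rb : R) x w : 0 < rb -> open O -> ball_condition O rb -> O x ->
  bdry O w -> (forall z, bdry O z -> `[x - w] <= `[x - z]) ->
  exists N, [/\ `[N] = rb, x - w = (`[x - w] / rb) *: N,
    eucl_ball (w + N) rb `<=` O & eucl_ball (w - N) rb `<=` ~` O].
Proof.
move=> rb0 oO bc Ox bw hnear.
have [[ei [_ bi ei2]] [ee [_ be ee2]]] := bc w bw.
have wi : `[w - ei] = rb.
  by apply: bdry_ball_norm; have [] : (bdry (eucl_ball ei rb) `&` bdry O) w by rewrite ei2.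
have we : `[w - ee] = rb.
  by apply: bdry_ball_norm; have [] : (bdry (eucl_ball ee rb) `&` bdry O) w by rewrite ee2.
have [_ nOw] := (bdry_open w oO).1 bw.
have d0 : 0 < `[x - w].
  rewrite lt_def eucl_norm_ge0 andbT; apply/eqP => /eucl_norm_eq0 /eqP.
  by rewrite subr_eq0 => /eqP xw; apply: nOw; rewrite -xw.
exists (w - ee); split => //.
- apply: (tangent_balls d0 rb0 erefl we) => z zx zee.
  have [y by_ xy] := segment_meets_bdry oO Ox (be z zee).
  by have := hnear y by_; rewrite (eucl_normB z x) in zx; lra.
- have eE : ei - w = (rb / rb) *: (w - ee).
    apply: (tangent_balls rb0 rb0 _ we); first by rewrite eucl_normB.
    by move=> z zi zee; exact: (be z zee) (bi z zi).
  rewrite divff ?gt_eqF// scale1r in eE.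
  by rewrite -eE addrC subrK.
- by rewrite opprB addrC subrK.
Qed.

Section Core.
Variables (lam Lam rb Cstar : R).
Hypotheses (hlam : 0 < lam) (hLam : lam <= Lam) (hrb : 0 < rb).

Ltac purge := clear - R n phi phi_ge0 phi_incr phi_cont phi_ge phi_osgood phi_blowup
  lam Lam rb Cstar hlam hLam hrb.

(* `[x - w'] is the distance from x to the boundary. *)
Lemma two_sided_bound (m M : R) : 0 < m -> 0 < M ->
  exists b, exists2 C : R, 0 < b /\ 0 < C &
  forall (F : 'rV[R]_n -> R -> 'rV[R]_n -> 'M[R]_n -> R) (gam : R -> R)
    (O : set 'rV[R]_n) w (r : R) (u : 'rV[R]_n -> R),
    (forall x p s t X Y, X \is symmetricmx -> Y \is symmetricmx ->
       t <= s -> psd_le X Y -> F x t p Y <= F x s p X) ->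
    (forall x p X, X \is symmetricmx ->
       - F x 0 p X <= phi (eucl_norm p) - pucci_minus lam Lam X) ->
    (forall s x p X, 0 <= s -> X \is symmetricmx ->
       F x s p X <= phi (eucl_norm p) + pucci_plus lam Lam X + gam s) ->
    (forall s, 0 <= s -> s <= 1 -> gam s <= Cstar * phi s) ->
    open O -> ball_condition O rb -> bdry O w -> 0 < r -> r < rb ->
    let B := eucl_ball w (6 * r) in
    viscosity_solution F (O `&` B) u ->
    (forall x, (O `&` B) x -> 0 < u x) ->
    {within closure O `&` B, continuous u} ->
    (forall x, (bdry O `&` B) x -> u x = 0) ->
    (forall x, O x -> `[x - w] <= 5 * r -> u x <= M * r) ->
    (forall w' N, bdry O w' -> `[w' - w] < 2 * r -> `[N] = rb -> eucl_ball (w' + N) rb `<=` O ->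
       m * r <= u (w' + (r / rb) *: N)) ->
    forall x w', O x -> `[x - w] < r -> bdry O w' -> (forall z, bdry O z -> `[x - w'] <= `[x - z]) ->
      b * `[x - w'] <= u x <= C * `[x - w'].
Proof.
move=> m0 M0.
have Lam0 : 0 < Lam by exact: lt_le_trans hLam.
have L0 : 0 < (n%:R + 1) * Lam by apply: mulr_gt0 => //; apply: ltr_wpDl.
have D0 : 0 <= rb * (1 + `|Cstar|) by apply: mulr_ge0; [exact: ltW|apply: addr_ge0].
have tau0 : 0 < rb^-1 by rewrite invr_gt0.
have [b b0 hb] := unit_ball_lower L0 hlam D0 (ltW hrb) tau0 m0 M0.
have [C C0 hC] := @upper_barrier R n phi phi_ge0 phi_incr phi_cont phi_ge phi_osgood phi_blowup
   lam ((n%:R + 1) * Lam) (rb * (1 + `|Cstar|)) L0 hlam D0 M.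
(* With [s = d / r < 1]: inside the shell, [(1 + s) ^+ 2 - 1 <= 3 * s] gives [3 * C]; beyond it
   [3 * s >= 1], and the bound [M * r] gives [3 * M]. *)
exists b, (3 * C + 3 * M); first by split => //; apply: addr_gt0; apply: mulr_gt0.
move=> F gam O w r u F1 F2 F3 F4 oO bc bw r0 rrb B usol upos ucont u0 uM um x w' Ox xw bw' hnear.
have [_ nOw'] := (bdry_open w' oO).1 bw'.
set d := `[x - w'].
have dr : d < r by apply: le_lt_trans (hnear w bw) xw.
have d0 : 0 <= d := eucl_norm_ge0 _.
have [N [Nrb xN Ni Ne]] := ball_condition_normal hrb oO bc Ox bw' hnear.
rewrite -/d in xN.
have w'w : `[w' - w] < 2 * r.
  by have := eucl_dist_triangle x w' w; rewrite (eucl_normB w' x) -/d; lra.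
have rescN k : `[(k / rb) *: N] = `|k|.
  by rewrite eucl_normZ Nrb normrM normfV (gtr0_norm hrb) divfK// gt_eqF.
have rN : `[(r / rb) *: N] = r by rewrite rescN gtr0_norm.
have clO z : closure O z -> B z -> 0 <= u z /\ (`[z - w] <= 5 * r -> u z <= M * r).
  move=> cz Bz; have [Oz|nOz] := pselect (O z).
    by split; [apply: ltW; exact: upos|exact: uM].
  have bz : bdry O z by apply/bdry_open.
  by rewrite (u0 z (conj bz Bz)); split => // _; apply: mulr_ge0; exact: ltW.
have Vcont (e : 'rV[R]_n) (A : set 'rV[R]_n) : (forall y, A y -> (closure O `&` B) (e + r *: y)) ->
    {within A, continuous (rescale u e r)}.
  move=> hA; apply/within_eucl_continuousP => y Ay s s0.
  have [t t0 ht] := (within_eucl_continuousP _ _).1 ucont _ (hA y Ay) (s * r) (mulr_gt0 s0 r0).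
  exists (t / r); first exact: divr_gt0.
  move=> z Az zy; have := ht _ (hA z Az).
  have -> : e + r *: z - (e + r *: y) = r *: (z - y).
    by rewrite opprD addrACA subrr add0r scalerBr.
  rewrite eucl_normZ gtr0_norm// mulrC -ltr_pdivlMr// => /(_ zy).
  by rewrite /rescale -mulrBl normrM normfV (gtr0_norm r0) ltr_pdivrMr.
apply/andP; split.
(* Center of the interior tangent ball of radius [r], on the normal through [x]; the ball stays
   within [5 * r] of [w], where [u] is bounded. *)
- pose eta := w' + (r / rb) *: N.
  have etaw : `[eta - w] < 3 * r.
    by have := eucl_normD (w' - w) ((r / rb) *: N); rewrite rN addrAC; move: w'w; lra.
  have ball_O y : eucl_ball 0 1 y -> O (eta + r *: y).
    rewrite /eucl_ball/= subr0 => hy; apply: Ni; rewrite /eucl_ball/=.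
    have -> : eta + r *: y - (w' + N) = ((r - rb) / rb) *: N + r *: y.
      by apply/rowP => l; rewrite !mxE; field; rewrite gt_eqF.
    apply: le_lt_trans (eucl_normD _ _) _; rewrite rescN eucl_normZ (gtr0_norm r0).
    rewrite distrC gtr0_norm ?subr_gt0//.
    have : r * `[y] < r by rewrite gtr_pMr.
    lra.
  have ball_B y : cball 0 1 y -> B (eta + r *: y) /\ `[eta + r *: y - w] <= 5 * r.
    rewrite /cball/= subr0 => hy; have : `[eta + r *: y - w] <= `[eta - w] + r.
      have -> : eta + r *: y - w = (eta - w) + r *: y by rewrite addrAC.
      apply: le_trans (eucl_normD _ _) _; rewrite lerD2l eucl_normZ (gtr0_norm r0).
      by rewrite ler_piMr// ltW.
    by rewrite /B /eucl_ball/=; move: etaw r0; purge; split; lra.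
  have ball_cl y : cball 0 1 y -> closure O (eta + r *: y).
    move=> hy; rewrite /cball/= subr0 in hy; apply/closure_euclP => e e0.
    pose k := Num.min 1 (e / (2 * r)).
    have k0 : 0 < k by rewrite lt_min ltr01 divr_gt0// mulr_gt0.
    have k1 : k <= 1 by rewrite ge_min lexx.
    have ke : k * (2 * r) <= e by rewrite -ler_pdivlMr ?mulr_gt0// ge_min lexx orbT.
    exists (eta + r *: ((1 - k) *: y)).
      apply: ball_O; rewrite /eucl_ball/= subr0 eucl_normZ ger0_norm; last by move: k1; purge; lra.
      by have : (1 - k) * `[y] <= (1 - k) * 1 by [apply: ler_wpM2l => //; move: k1; purge; lra]; move: k0; purge; lra.
    have -> : eta + r *: ((1 - k) *: y) - (eta + r *: y) = - (r * k) *: y.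
      by apply/rowP => l; rewrite !mxE; ring.
    rewrite eucl_normZ normrN gtr0_norm ?mulr_gt0//.
    have : r * k * `[y] <= r * k * 1 by rewrite ler_wpM2l// mulr_ge0// ltW.
    lra.
  have sub1 : eucl_ball 0 1 `<=` [set y | (O `&` B) (eta + r *: y)].
    move=> y hy; split; first exact: ball_O.
    by apply: (ball_B y _).1; exact: ltW.
  have Vc : {within cball 0 1, continuous (rescale u eta r)}.
    by apply: Vcont => y hy; split; [exact: ball_cl|exact: (ball_B y hy).1].
  have V01 y : cball 0 1 y -> 0 <= rescale u eta r y <= M.
    move=> hy; have [By y5] := ball_B y hy; have [h1 h2] := clO _ (ball_cl y hy) By.
    by rewrite /rescale divr_ge0 ?(ltW r0)//= ler_pdivrMr//; exact: h2.
  have Vm : m <= rescale u eta r 0.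
    by rewrite /rescale scaler0 addr0 ler_pdivlMr//; exact: um.
  have S1 : ssol lam ((n%:R + 1) * Lam) phi (rb * (1 + `|Cstar|)) rb rb^-1 (eucl_ball 0 1) (rescale u eta r).
    exact: ssol_sub sub1 (rescale_ssol hlam hLam hrb phi_ge0 phi_incr F3 F4 usol upos r0 rrb).
  have S2 t : ssol lam ((n%:R + 1) * Lam) phi (rb * (1 + `|Cstar|)) 0 t (eucl_ball 0 1) (fun y => - rescale u eta r y).
    exact: ssol_sub sub1 (rescaleN_ssol Cstar (eta := eta) (tau := t) hlam hLam hrb phi_ge0 F1 F2 usol upos r0 rrb).
  pose s := d / r; have s0 : 0 <= s by rewrite divr_ge0// ltW.
  have s1 : s < 1 by rewrite ltr_pdivrMr// mul1r.
  have xe : x = eta + r *: (((d - r) / r / rb) *: N).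
    have -> : x = w' + (d / rb) *: N by rewrite -xN addrC subrK.
    by apply/rowP => l; rewrite !mxE; field; rewrite !gt_eqF.
  have yn : `[((d - r) / r / rb) *: N] = 1 - s.
    by rewrite rescN mulrBl divff ?gt_eqF// -/s ler0_norm; move: s1; purge; lra.
  have Ky : cball 0 1 (((d - r) / r / rb) *: N) by rewrite /cball/= subr0 yn; lra.
  have := hb _ Vc V01 Vm S1 S2 _ Ky.
  rewrite -sqr_eucl_norm yn /rescale -xe ler_pdivlMr// => h; apply: le_trans h.
  have -> : b * (1 - (1 - s) ^+ 2) * r = b * (s * r) * (2 - s) by ring.
  rewrite divfK ?gt_eqF//; apply: ler_peMr; first by rewrite mulr_ge0// ltW.
  by move: s1; purge; lra.
- pose c := w' - (r / rb) *: N.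
  have caK v : c + v - c = v by rewrite addrAC subrr add0r.
  have cw : `[c - w] < 3 * r.
    have := eucl_normD (w' - w) (- ((r / rb) *: N)); rewrite eucl_normN rN addrAC -/c; lra.
  have ext z : `[z - c] < r -> ~ O z.
    move=> zc; apply: Ne; rewrite /eucl_ball/=.
    have -> : z - (w' - N) = (z - c) + ((rb - r) / rb) *: N.
      by apply/rowP => l; rewrite !mxE; field; rewrite gt_eqF.
    apply: le_lt_trans (eucl_normD _ _) _; rewrite rescN gtr0_norm ?subr_gt0//; lra.
  have sq2 : Num.sqrt 2 <= 2 :> R.
    by rewrite -ler_sqr ?nnegrE ?sqrtr_ge0// sqr_sqrtr// expr2; lra.
  pose K := [set y | closure O (c + r *: y)] `&` cball 0 (Num.sqrt 2).
  have Kt y : K y -> dot y y <= 2.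
    by move=> [_]; rewrite /cball/= subr0 eucl_norm_le ?sqrtr_ge0// sqr_sqrtr.
  have KB y : K y -> B (c + r *: y) /\ `[c + r *: y - w] <= 5 * r.
    move=> [_]; rewrite /cball/= subr0 => hy.
    have : `[c + r *: y - w] <= `[c - w] + r * `[y].
      have -> : c + r *: y - w = (c - w) + r *: y by rewrite addrAC.
      by apply: le_trans (eucl_normD _ _) _; rewrite lerD2l eucl_normZ (gtr0_norm r0).
    have : r * `[y] <= r * 2 by rewrite ler_pM2l//; apply: le_trans hy sq2.
    by rewrite /B /eucl_ball/=; move: cw r0; purge; split; lra.
  have cK : compact K.
    apply: (@eucl_compact _ _ _ 0 (Num.sqrt 2)); last by move=> y [].
    apply: closedI; last exact: cball_closed.
    have ca : continuous (fun y => c + r *: y : 'rV[R]_n).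
      have cs : continuous (fun y => r *: y : 'rV[R]_n) by exact: scaler_continuous.
      by move=> t; apply: (@continuousD _ _ _ (fun=> c) _ t); [exact: cst_continuous|exact: cs].
    by apply: (@closed_comp _ _ (fun y => c + r *: y) (closure O)); [move=> y _; exact: ca|exact: closed_closure].
  have K1 y : K y -> 1 <= `[y].
    move=> [cy _]; rewrite leNgt; apply/negP => y1.
    have e0 : 0 < r * (1 - `[y]) by rewrite mulr_gt0// subr_gt0.
    have [z Oz zy] := (closure_euclP _ _).1 cy _ e0; apply: (ext z _ Oz).
    have := eucl_dist_triangle (c + r *: y) z c; rewrite caK eucl_normZ (gtr0_norm r0); move: zy; purge; lra.
  have K1' y : K y -> 1 <= dot y y.
    by move=> /K1 h; rewrite -sqr_eucl_norm exprn_ege1.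
  have Vc : {within K, continuous (rescale u c r)}.
    by apply: Vcont => y Ky; split; [case: Ky|exact: (KB y Ky).1].
  have S2 t : ssol lam ((n%:R + 1) * Lam) phi (rb * (1 + `|Cstar|)) 0 t
      [set y | (O `&` B) (c + r *: y)] (fun y => - rescale u c r y).
    exact: (rescaleN_ssol Cstar (eta := c) (tau := t) hlam hLam hrb phi_ge0 F1 F2 usol upos r0 rrb).
  have KM y : K y -> 1 <= dot (y - 0) (y - 0) <= 2 /\ rescale u c r y <= M.
    move=> Ky; rewrite subr0 K1'//= Kt//; split => //.
    have [By y5] := KB y Ky; have [_ h] := clO _ Ky.1 By.
    by rewrite /rescale ler_pdivrMr//; exact: h.
  have Kcase y : K y -> [\/ rescale u c r y <= 0, dot (y - 0) (y - 0) = 2 |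
        [/\ (O `&` B) (c + r *: y), 1 < dot (y - 0) (y - 0) & exists2 e : R, 0 < e & forall y', `[y' - y] < e -> K y']].
    move=> Ky; rewrite subr0; have [By _] := KB y Ky.
    have [Oz|nOz] := pselect (O (c + r *: y)); last first.
      have bz : bdry O (c + r *: y) by apply/bdry_open => //; split => //; exact: Ky.1.
      by apply: Or31; rewrite /rescale (u0 _ (conj bz By)) mul0r.
    have [t2|t2] := eqVneq (dot y y) 2; first exact: Or32.
    apply: Or33.
    have [e e0 he] : exists2 e : R, 0 < e & forall z, `[z - (c + r *: y)] < e -> O z.
      by apply/near_euclP; move: oO; rewrite openE => h; exact: h.
    have dy : dot y y < 2 by rewrite lt_neqAle t2 Kt.
    have yq : `[y] < Num.sqrt 2 by rewrite eucl_norm_lt ?sqrtr_ge0// sqr_sqrtr.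
    have shift y' : c + r *: y' - (c + r *: y) = r *: (y' - y).
      by apply/rowP => l; rewrite !mxE; ring.
    have near_O y' : `[y' - y] < e / r -> O (c + r *: y').
      by move=> hy; apply: he; rewrite shift eucl_normZ (gtr0_norm r0) mulrC -ltr_pdivlMr.
    split => //.
    (* A point of [O] on the exterior sphere would have neighbours in [O] inside the exterior
       ball. *)
    + rewrite lt_neqAle K1'// andbT; apply/eqP => y1.
      have yn : `[y] = 1 by rewrite eucl_normE -y1 sqrtr1.
      have er : 0 < e / r by exact: divr_gt0.
      pose k := Num.min 1 (e / r) / 2.
      have k0 : 0 < k by rewrite divr_gt0// lt_min ltr01.
      have k1 : k < 1.
        by have : Num.min 1 (e / r) <= 1 by [rewrite ge_min lexx]; rewrite /k; purge; lra.
      have ke : k < e / r.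
        have h1 : Num.min 1 (e / r) <= e / r by rewrite ge_min lexx orbT.
        by rewrite /k ltr_pdivrMr//; move: h1 er; purge; lra.
      apply: (ext (c + r *: ((1 - k) *: y))).
        rewrite caK !eucl_normZ yn mulr1 (gtr0_norm r0) gtr0_norm; last by move: k1; purge; lra.
        by rewrite gtr_pMr//; move: k0; purge; lra.
      apply: near_O; have -> : (1 - k) *: y - y = - k *: y.
        by apply/rowP => l; rewrite !mxE; ring.
      by rewrite eucl_normZ yn mulr1 normrN gtr0_norm.
    + exists (Num.min (e / r) (Num.sqrt 2 - `[y])); first by rewrite lt_min divr_gt0//= subr_gt0.
      move=> y'; rewrite lt_min => /andP[h1 h2]; split.
        by apply: subset_closure; exact: near_O.
      by rewrite /cball/= subr0; have := eucl_normD (y' - y) y; rewrite subrK; move: h2; purge; lra.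
  pose s := d / r; have s0 : 0 <= s by rewrite divr_ge0// ltW.
  have s1 : s < 1 by rewrite ltr_pdivrMr// mul1r.
  have sd : s * r = d by rewrite divfK// gt_eqF.
  pose y := ((d + r) / r / rb) *: N.
  have xe : x = c + r *: y.
    have -> : x = w' + (d / rb) *: N by rewrite -xN addrC subrK.
    by apply/rowP => l; rewrite !mxE; field; rewrite !gt_eqF.
  have yn : `[y] = 1 + s.
    by rewrite rescN mulrDl divff ?gt_eqF// -/s ger0_norm; move: s0; purge; lra.
  have uxM : u x <= M * r by apply: uM => //; move: xw r0; purge; lra.
  rewrite -sd; have [y2|y2] := leP ((1 + s) ^+ 2) 2.
    have Ky : K y.
      split; first by rewrite /= -xe; exact: subset_closure.
      by rewrite /cball/= subr0 eucl_norm_le ?sqrtr_ge0// sqr_sqrtr// -sqr_eucl_norm yn.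
    have := hC K _ _ 0 S2 cK Vc KM Kcase y Ky.
    rewrite subr0 -sqr_eucl_norm yn /rescale -xe ler_pdivrMr// => h; apply: le_trans h _.
    have -> : C * ((1 + s) ^+ 2 - 1) * r = C * (s * r) * (2 + s) by ring.
    have sr0 : 0 <= s * r by rewrite sd.
    have h1 := mulr_ge0 (ltW C0) sr0; have h2 := mulr_ge0 (ltW M0) sr0.
    have h3 : C * (s * r) * (2 + s) <= C * (s * r) * 3 by apply: ler_wpM2l => //; move: s1; purge; lra.
    by move: h3 h2; purge; lra.
  have s3 : 1 <= 3 * s by move: y2 s0; rewrite expr2; purge; nra.
  have sr0 : 0 <= s * r by rewrite sd.
  have h1 := mulr_ge0 (ltW C0) sr0.
  have h2 : M * r * 1 <= M * r * (3 * s) by rewrite ler_wpM2l// mulr_ge0// ltW.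
  by move: uxM h1 h2; purge; lra.
Qed.

End Core.
End TwoSidedBound.

(** * Use of the scaled extrema, and their replacement by compactness *)

Section Extrema.
Context {R : realType} {n : nat}.
Implicit Types (x y c z w p q N : 'rV[R]_n) (O : set 'rV[R]_n).
Variables (rb r : R) (O : set 'rV[R]_n) (w : 'rV[R]_n) (u : 'rV[R]_n -> R).
Hypotheses (hrb : 0 < rb) (r0 : 0 < r) (rrb : r < rb) (oO : open O).
Local Notation B := (eucl_ball w (6 * r)).
Hypothesis ucont : {within closure O `&` B, continuous u}.
Hypothesis upos : forall x, (O `&` B) x -> 0 < u x.

Definition Gamma_set := [set x : 'rV[R]_n | [/\ O x,
  r < eucl_dist x (bdry O) < 3 * r & B x]].

Lemma eucl_dist_eq x w' (E : set 'rV[R]_n) t : E w' -> `[x - w'] = t ->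
  (forall z, E z -> t <= `[x - z]) -> eucl_dist x E = t.
Proof.
move=> Ew' xw' h; apply/eqP; rewrite eq_le /eucl_dist; apply/andP; split.
  by rewrite -xw'; apply: ge_inf; [exists t => _ [z Ez <-]; exact: h|exists w'].
by apply: lb_le_inf; [exists `[x - w'], w'|move=> _ [z Ez <-]; exact: h].
Qed.

(* The points at height slightly above r on the inner normal lie in Gamma. *)
Lemma lower_at_normal (a : R) w' N : (forall x, Gamma_set x -> a <= u x) ->
  bdry O w' -> `[w' - w] < 2 * r -> `[N] = rb -> eucl_ball (w' + N) rb `<=` O ->
  a <= u (w' + (r / rb) *: N).
Proof.
move=> hG bw' w'w Nrb Ni; set eta := w' + (r / rb) *: N.
have rescN k : `[(k / rb) *: N] = `|k|.
  by rewrite eucl_normZ Nrb normrM normfV (gtr0_norm hrb) divfK// gt_eqF.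
have inO t : 0 < t -> t < 2 * rb -> O (w' + (t / rb) *: N).
  move=> t0 t2; apply: Ni; rewrite /eucl_ball/=.
  have -> : w' + (t / rb) *: N - (w' + N) = ((t - rb) / rb) *: N.
    by apply/rowP => l; rewrite !mxE; field; rewrite gt_eqF.
  by rewrite rescN ltr_norml; apply/andP; split; lra.
have inB t : 0 < t -> t < 3 * r -> B (w' + (t / rb) *: N).
  move=> t0 t3; rewrite /eucl_ball/= addrAC; apply: le_lt_trans (eucl_normD _ _) _.
  by rewrite rescN gtr0_norm//; move: w'w; lra.
rewrite leNgt; apply/negP => hlt.
have e0 : 0 < a - u eta by rewrite subr_gt0.
have Oeta : (closure O `&` B) eta.
  have [r1 r2] : r < 2 * rb /\ r < 3 * r by move: (r0) (hrb) (rrb); split; lra.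
  by split; [apply: subset_closure; exact: inO|exact: inB].
have [d d0 hd] := (within_eucl_continuousP _ _).1 ucont _ Oeta _ e0.
pose k := Num.min (d / 2) (Num.min ((rb - r) / 2) r).
have k0 : 0 < k by rewrite !lt_min r0 !divr_gt0// subr_gt0.
have kd : k <= d / 2 by rewrite ge_min lexx.
have kb : k <= (rb - r) / 2 by rewrite !ge_min lexx orbT.
have kr : k <= r by rewrite !ge_min lexx !orbT.
pose t := r + k; pose p := w' + (t / rb) *: N.
have t0 : 0 < t by exact: addr_gt0.
have trb : t < rb by move: (rrb); rewrite /t; lra.
have t3 : t < 3 * r by move: (r0); rewrite /t; lra.
have Op : O p by apply: inO => //; move: (hrb); lra.
have Bp : B p by exact: inB.
have pw' : `[p - w'] = t.
  by rewrite /p addrAC subrr add0r rescN gtr0_norm.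
have dist : eucl_dist p (bdry O) = t.
  apply: (eucl_dist_eq bw' pw') => z bz; rewrite leNgt; apply/negP => zt.
  have [_ nOz] := (bdry_open z oO).1 bz; apply/nOz/Ni; rewrite /eucl_ball/=.
  have pe : `[p - (w' + N)] = rb - t.
    have -> : p - (w' + N) = ((t - rb) / rb) *: N.
      by apply/rowP => l; rewrite !mxE; field; rewrite gt_eqF.
    by rewrite rescN distrC gtr0_norm// subr_gt0.
  by have := eucl_dist_triangle p z (w' + N); rewrite (eucl_normB z p); lra.
have Gp : Gamma_set p.
  by split => //; rewrite dist t3 andbT /t ltrDl.
have := hG p Gp; have peta : p - eta = (k / rb) *: N.
  by apply/rowP => l; rewrite !mxE /t; field; rewrite gt_eqF.
have := hd p (conj (subset_closure Op) Bp).
rewrite peta rescN gtr0_norm// => /(_ (ltac:(lra))).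
by rewrite ltr_norml => /andP[_]; lra.
Qed.

(** Used when some scaled extremum is degenerate: the relevant centers lie in a compact subset of
    the domain, where [u] has a positive minimum. *)
Lemma inner_center_bound : exists2 m : R, 0 < m &
  forall w' N, bdry O w' -> `[w' - w] < 2 * r -> `[N] = rb -> eucl_ball (w' + N) rb `<=` O ->
    m * r <= u (w' + (r / rb) *: N).
Proof.
pose P := [set y | eucl_ball y r `<=` O] `&` cball w (3 * r).
have PO y : P y -> (O `&` B) y.
  move=> [yO yw]; split; first by apply: yO; rewrite /eucl_ball/= subrr eucl_norm0.
  by move: yw; rewrite /eucl_ball/cball/=; move: (r0); lra.
have cP : compact P.
  apply: (@eucl_compact _ _ _ w (3 * r)); last by move=> y [].
  apply: closedI; last exact: cball_closed.
  apply/eucl_closedP => y hy z; rewrite /eucl_ball/= => zy.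
  have [y' y'O yy] := hy _ (ltac:(by rewrite subr_gt0; exact: zy) : 0 < r - `[z - y]).
  apply: y'O; rewrite /eucl_ball/=.
  by have := eucl_dist_triangle y z y'; rewrite (eucl_normB y y'); lra.
have sub w' N : `[w' - w] < 2 * r -> `[N] = rb -> eucl_ball (w' + N) rb `<=` O -> P (w' + (r / rb) *: N).
  move=> w'w Nrb Ni.
  have rN k : `[(k / rb) *: N] = `|k|.
    by rewrite eucl_normZ Nrb normrM normfV (gtr0_norm hrb) divfK// gt_eqF.
  split; last first.
    rewrite /cball/= addrAC; apply: le_trans (eucl_normD _ _) _.
    by rewrite rN gtr0_norm//; move: w'w; lra.
  move=> z; rewrite /eucl_ball/= => hz; apply: Ni; rewrite /eucl_ball/=.
  have := eucl_dist_triangle (w' + (r / rb) *: N) z (w' + N).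
  have -> : w' + (r / rb) *: N - (w' + N) = ((r - rb) / rb) *: N.
    by apply/rowP => l; rewrite !mxE; field; rewrite gt_eqF.
  by rewrite rN distrC gtr0_norm ?subr_gt0//; lra.
have [P0|P0] := pselect (P !=set0); last first.
  by exists 1 => // w' N _ h1 h2 h3; exfalso; apply: P0; exists (w' + (r / rb) *: N); exact: sub.
have cu : {within P, continuous u}.
  apply: continuous_subspaceW ucont => y /PO [Oy By]; split => //; exact: subset_closure.
have [y Py hy] := eucl_EVT_min P0 cP cu.
exists (u y / r); first by apply: divr_gt0 => //; apply: upos; exact: PO.
move=> w' N _ h1 h2 h3; rewrite divfK ?gt_eqF//; apply: hy; exact: sub.
Qed.

Lemma upper_bound_closed_ball : exists2 M : R, 0 < M &
  forall x, O x -> `[x - w] <= 5 * r -> u x <= M * r.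
Proof.
pose P := closure O `&` cball w (5 * r).
have [P0|P0] := pselect (P !=set0); last first.
  exists 1 => // x Ox xw; exfalso; apply: P0; exists x; split => //; exact: subset_closure.
have cP : compact P.
  apply: (@eucl_compact _ _ _ w (5 * r)); last by move=> y [].
  by apply: closedI; [exact: closed_closure|exact: cball_closed].
have cu : {within P, continuous u}.
  apply: continuous_subspaceW ucont => y [Oy]; rewrite /cball/eucl_ball/= => yw; split => //=.
  by move: (r0) yw; lra.
have [y Py hy] := @eucl_EVT_min _ _ P (fun y => - u y) P0 cP (fun y => continuousN (cu y)).
exists (`|u y| / r + 1); first by apply: ltr_wpDl => //; apply: divr_ge0 => //; exact: ltW.
move=> x Ox xw; have Px : P x by split => //; exact: subset_closure.
have := hy x Px; rewrite mulrDl divfK ?gt_eqF// mul1r; have := ler_norm (u y); move: (r0); lra.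
Qed.

Lemma ereal_inf_lower (G : set 'rV[R]_n) :
  (0 < r^-1%:E * ereal_inf [set (u x)%:E | x in G]%classic)%E ->
  forall x, G x -> 0 < fine (r^-1%:E * ereal_inf [set (u x)%:E | x in G]%classic)%E /\
    fine (r^-1%:E * ereal_inf [set (u x)%:E | x in G]%classic)%E * r <= u x.
Proof.
set I := (r^-1%:E * _)%E; move=> I0 x Gx.
have hI : (I <= (r^-1 * u x)%:E)%E.
  rewrite EFinM; apply: lee_wpmul2l; first by rewrite lee_fin invr_ge0 ltW.
  by apply: ereal_inf_lbound; exists x.
move: I0 hI; case: I => [q| |]//=; rewrite !lte_fin lee_fin => q0 hq; split => //.
by rewrite mulrC -ler_pdivlMl.
Qed.

Lemma ereal_sup_upper (G : set 'rV[R]_n) :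
  (r^-1%:E * ereal_sup [set (u x)%:E | x in G]%classic < +oo)%E ->
  forall x, G x -> u x <= fine (r^-1%:E * ereal_sup [set (u x)%:E | x in G]%classic)%E * r.
Proof.
set I := (r^-1%:E * _)%E; move=> I0 x Gx.
have hI : ((r^-1 * u x)%:E <= I)%E.
  rewrite EFinM; apply: lee_wpmul2l; first by rewrite lee_fin invr_ge0 ltW.
  by apply: ereal_sup_ubound; exists x.
move: I0 hI; case: I => [q| |]//=; rewrite lee_fin => _ hq.
by rewrite mulrC -ler_pdivrMl.
Qed.

End Extrema.

Lemma ratio_bound (R : realType) (b C d s t : R) : 0 < b -> 0 < C -> 0 < d ->
  b * d <= s <= C * d -> b * d <= t <= C * d ->
  (Num.max 1 (C / b))^-1 <= s / t <= Num.max 1 (C / b).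
Proof.
move=> b0 C0 d0 /andP[s1 s2] /andP[t1 t2].
have bd := mulr_gt0 b0 d0.
have s0 : 0 < s by exact: lt_le_trans s1.
have t0 : 0 < t by exact: lt_le_trans t1.
set c := Num.max _ _; have c1 : C / b <= c by rewrite le_max lexx orbT.
have c0 : 0 < c by rewrite lt_max ltr01.
have Cc : C <= c * b by rewrite -ler_pdivrMr.
have Cd : C * d <= c * (b * d) by rewrite mulrA ler_pM2r.
apply/andP; split.
  rewrite ler_pdivlMr// mulrC ler_pdivrMr// mulrC; apply: le_trans t2 _.
  by apply: le_trans Cd _; rewrite ler_pM2l.
rewrite ler_pdivrMr//; apply: le_trans s2 _; apply: le_trans Cd _.
by rewrite ler_pM2l.
Qed.

Theorem corollary7 (R : realType) (n : nat) (lam Lam rb Cstar : R)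
    (phi : R -> R)
    (hlam : 0 < lam) (hLam : lam <= Lam) (hrb : 0 < rb)
    (phi_ge0 : forall t : R, 0 <= t -> 0 <= phi t)
    (phi_incr : forall s t : R, 0 <= s -> s < t -> phi s < phi t)
    (phi_cont : {within `[0, +oo[, continuous phi})
    (phi_ge : forall t : R, 0 <= t -> t <= phi t)
    (phi_osgood :
       (\int[@lebesgue_measure R]_(t in `]0%R, 1%R]) ((phi t)^-1)%:E)%E = +oo%E)
    (phi_blowup : decay_blowup phi) :
  (* K gives the constant as a function of the four scaled extrema *)
  exists K : \bar R -> \bar R -> \bar R -> \bar R -> R,
  forall (F : 'rV[R]_n -> R -> 'rV[R]_n -> 'M[R]_n -> R) (gam : R -> R)
    (Omega : set 'rV[R]_n) (w : 'rV[R]_n) (r : R) (u v : 'rV[R]_n -> R),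
    (* degenerate ellipticity *)
    (forall x p s t X Y, X \is symmetricmx -> Y \is symmetricmx ->
       t <= s -> psd_le X Y -> F x t p Y <= F x s p X) ->
    (* structure condition from below *)
    (forall x p X, X \is symmetricmx ->
       - F x 0 p X <= phi (eucl_norm p) - pucci_minus lam Lam X) ->
    (* structure condition from above *)
    (forall s x p X, 0 <= s -> X \is symmetricmx ->
       F x s p X <= phi (eucl_norm p) + pucci_plus lam Lam X + gam s) ->
    (forall s, 0 <= s -> s <= 1 -> gam s <= Cstar * phi s) ->
    domain Omega -> ball_condition Omega rb -> bdry Omega w ->
    0 < r -> r < rb ->
    let B := eucl_ball w (6 * r) in
    viscosity_solution F (Omega `&` B) u ->
    viscosity_solution F (Omega `&` B) v ->
    (forall x, (Omega `&` B) x -> 0 < u x) ->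
    (forall x, (Omega `&` B) x -> 0 < v x) ->
    (* the boundary values are attained continuously *)
    {within closure Omega `&` B, continuous u} ->
    {within closure Omega `&` B, continuous v} ->
    (forall x, (bdry Omega `&` B) x -> u x = 0) ->
    (forall x, (bdry Omega `&` B) x -> v x = 0) ->
    let Gamma := [set x : 'rV[R]_n | [/\ Omega x,
                    r < eucl_dist x (bdry Omega) < 3 * r & B x]] in
    let infu := (r^-1%:E * ereal_inf [set (u x)%:E | x in Gamma]%classic)%E in
    let infv := (r^-1%:E * ereal_inf [set (v x)%:E | x in Gamma]%classic)%E in
    let supu := (r^-1%:E * ereal_sup [set (u x)%:E | x in (Omega `&` B)]%classic)%E in
    let supv := (r^-1%:E * ereal_sup [set (v x)%:E | x in (Omega `&` B)]%classic)%E in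
    exists c : R,
      [/\ 1 <= c,
          (0 < infu -> 0 < infv -> supu < +oo -> supv < +oo ->
             c = K infu infv supu supv)%E &
          forall x, (Omega `&` eucl_ball w r) x -> c^-1 <= u x / v x <= c].
Proof.
(* Every extended real is sent to a positive number. If [Gamma] is empty its infimum is [+oo], whose
   [fine] is 0, and [mfun] returns 1. *)
pose mfun (e : \bar R) : R := if 0 < fine e then fine e else 1.
pose Mfun (e : \bar R) : R := Num.max 1 (fine e).
have mfun0 e : 0 < mfun e by rewrite /mfun; case: ifP.
have Mfun0 e : 0 < Mfun e by rewrite /Mfun lt_max ltr01.
(* The constants are chosen for each pair before [F], the domain and the solutions are introduced,
   hence cannot depend on them. *)
have const p : exists b, exists C, 0 < p.1 -> 0 < p.2 -> [/\ 0 < b, 0 < C &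
  forall (F : 'rV[R]_n -> R -> 'rV[R]_n -> 'M[R]_n -> R) (gam : R -> R)
    (O : set 'rV[R]_n) w (r : R) (u : 'rV[R]_n -> R),
    (forall x p s t X Y, X \is symmetricmx -> Y \is symmetricmx ->
       t <= s -> psd_le X Y -> F x t p Y <= F x s p X) ->
    (forall x p X, X \is symmetricmx ->
       - F x 0 p X <= phi (eucl_norm p) - pucci_minus lam Lam X) ->
    (forall s x p X, 0 <= s -> X \is symmetricmx ->
       F x s p X <= phi (eucl_norm p) + pucci_plus lam Lam X + gam s) ->
    (forall s, 0 <= s -> s <= 1 -> gam s <= Cstar * phi s) ->
    open O -> ball_condition O rb -> bdry O w -> 0 < r -> r < rb ->
    let B := eucl_ball w (6 * r) in
    viscosity_solution F (O `&` B) u ->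
    (forall x, (O `&` B) x -> 0 < u x) ->
    {within closure O `&` B, continuous u} ->
    (forall x, (bdry O `&` B) x -> u x = 0) ->
    (forall x, O x -> `[x - w] <= 5 * r -> u x <= p.2 * r) ->
    (forall w' N, bdry O w' -> `[w' - w] < 2 * r -> `[N] = rb -> eucl_ball (w' + N) rb `<=` O ->
       p.1 * r <= u (w' + (r / rb) *: N)) ->
    forall x w', O x -> `[x - w] < r -> bdry O w' -> (forall z, bdry O z -> `[x - w'] <= `[x - z]) ->
      b * `[x - w'] <= u x <= C * `[x - w']].
  have [p1|p1] := ltP 0 p.1; last by exists 1, 1 => h; move: p1; rewrite leNgt h.
  have [p2|p2] := ltP 0 p.2; last by exists 1, 1 => _ h; move: p2; rewrite leNgt h.
  have [b [C [b0 C0] h]] := @two_sided_bound R n phi phi_ge0 phi_incr phi_cont phi_ge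
    phi_osgood phi_blowup lam Lam rb Cstar hlam hLam hrb p.1 p.2 p1 p2.
  by exists b, C => _ _; split => //; exact: h.
have [bf /choice[Cf hbC]] := choice const.
pose cst p := Num.max 1 (Cf p / bf p).
exists (fun iu iv su sv => cst (Num.min (mfun iu) (mfun iv), Num.max (Mfun su) (Mfun sv))).
move=> F gam Omega w r u v F1 F2 F3 F4 [oO _] bc bw r0 rrb B usol vsol upos vpos uc vc u0 v0.
move=> Gamma infu infv supu supv.
have sub5 x : Omega x -> `[x - w] <= 5 * r -> (Omega `&` B) x.
  by move=> Ox xw; split => //; rewrite /B /eucl_ball/=; lra.
have key : exists p : R * R, [/\ 0 < p.1, 0 < p.2,
    (0 < infu -> 0 < infv -> supu < +oo -> supv < +oo ->
      p = (Num.min (mfun infu) (mfun infv), Num.max (Mfun supu) (Mfun supv)))%E,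
    (forall x, Omega x -> `[x - w] <= 5 * r -> u x <= p.2 * r /\ v x <= p.2 * r) &
    (forall w' N, bdry Omega w' -> `[w' - w] < 2 * r -> `[N] = rb -> eucl_ball (w' + N) rb `<=` Omega ->
       p.1 * r <= u (w' + (r / rb) *: N) /\ p.1 * r <= v (w' + (r / rb) *: N))].
  (* If an extremum is degenerate, no formula for [c] is required, and the pair comes from
     compactness. *)
  have [[iu [iv [su sv]]]|bad] :=
    pselect ((0 < infu) /\ (0 < infv) /\ (supu < +oo) /\ (supv < +oo))%E.
    exists (Num.min (mfun infu) (mfun infv), Num.max (Mfun supu) (Mfun supv)).
    split => //=; [by rewrite lt_min !mfun0|by rewrite lt_max Mfun0|move=> x Ox xw|].
      have UB := sub5 x Ox xw.
      have hu := ereal_sup_upper r0 su UB; have hv := ereal_sup_upper r0 sv UB.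
      by split; [apply: le_trans hu _|apply: le_trans hv _]; rewrite ler_pM2r// /Mfun !le_max lexx !orbT.
    move=> w' N bw' w'w Nrb Ni.
    have lower (f : 'rV[R]_n -> R) (q : R) : {within closure Omega `&` B, continuous f} ->
        (forall x, Gamma x -> q * r <= f x) -> q * r <= f (w' + (r / rb) *: N).
      by move=> fc hq; apply: (@lower_at_normal R n rb r Omega w f hrb r0 rrb oO fc).
    split; apply: lower => // x Gx.
      have [q0 hq] := ereal_inf_lower r0 iu Gx; apply: le_trans hq; rewrite ler_pM2r//.
      by rewrite ge_min /mfun q0 lexx.
    have [q0 hq] := ereal_inf_lower r0 iv Gx; apply: le_trans hq; rewrite ler_pM2r//.
    by rewrite ge_min {2}/mfun q0 lexx orbT.
  have [mu mu0 hmu] := inner_center_bound hrb r0 rrb uc upos.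
  have [mv mv0 hmv] := inner_center_bound hrb r0 rrb vc vpos.
  have [Mu Mu0 hMu] := upper_bound_closed_ball r0 uc.
  have [Mv Mv0 hMv] := upper_bound_closed_ball r0 vc.
  exists (Num.min mu mv, Num.max Mu Mv); split => /=.
  - by rewrite lt_min mu0.
  - by rewrite lt_max Mu0.
  - by move=> iu iv su sv; exfalso; apply: bad.
  - move=> x Ox xw; split; [apply: le_trans (hMu x Ox xw) _|apply: le_trans (hMv x Ox xw) _];
      by rewrite ler_pM2r// le_max lexx ?orbT.
  - move=> w' N h1 h2 h3 h4; split; [apply: le_trans (hmu w' N h1 h2 h3 h4)|apply: le_trans (hmv w' N h1 h2 h3 h4)];
      by rewrite ler_pM2r// ge_min lexx ?orbT.
have [p [p1 p2 pE hM hm]] := key.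
have [b0 C0 hB] := hbC p p1 p2.
exists (cst p); split.
- by rewrite /cst le_max lexx.
- by move=> iu iv su sv; rewrite (pE iu iv su sv).
move=> x [Ox xw].
have [w' [bw' xw' hnear]] := nearest_bdry oO Ox bw.
have d0 : 0 < `[x - w'].
  rewrite lt_def eucl_norm_ge0 andbT; apply/eqP => /eucl_norm_eq0 /eqP.
  by rewrite subr_eq0 => /eqP e; have [_] := (bdry_open w' oO).1 bw'; rewrite -e.
apply: (ratio_bound b0 C0 d0).
- apply: (hB F gam Omega w r u) => //.
  + by move=> y Oy yw; exact: (hM y Oy yw).1.
  + by move=> w1 N h1 h2 h3 h4; exact: (hm w1 N h1 h2 h3 h4).1.
- apply: (hB F gam Omega w r v) => //.
  + by move=> y Oy yw; exact: (hM y Oy yw).2.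
  + by move=> w1 N h1 h2 h3 h4; exact: (hm w1 N h1 h2 h3 h4).2.
Qed.
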